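(* Let $D$ be a simply connected hyperbolic domain and let $\{g_t\}_{t\ge0}$ and $\{\tilde g_{\tilde t}\}_{\tilde t\ge0}$ be normalized slit Löwner chains in $D$ driven by $b,\sigma,u$ and by $b,\sigma,\tilde u$ respectively (same $b$ and $\sigma$). Suppose there is a continuous monotone function $\lambda$ (with $\lambda(0)=0$) such that $\tilde g_{\lambda(t)}^{-1}(D)=g_t^{-1}(D)$ for all $t\in[0,\infty)$. Then $\lambda(t)=t$, $\tilde u_{\lambda(t)}=u_t$ and $g_t=\tilde g_{\lambda(t)}$ for all $t\in[0,\infty)$.
   Context: Pushforward: $(\phi_*V)(z)=\phi'(\phi^{-1}(z))V(\phi^{-1}(z))$. $\ell_n:=\phi_*\ell_n^{\mathbb{H}}$ with $\ell_n^{\mathbb{H}}(z)=-z^{n+1}$ and a fixed conformal $\phi:\mathbb{H}\to D$. A normalized slit Löwner chain in $D$ driven by $b,\sigma,u$: $b=2\ell_{-2}+b_{-1}\ell_{-1}+b_0\ell_0+b_1\ell_1$, $\sigma=\ell_{-1}+\sigma_0\ell_0+\sigma_1\ell_1$ (real coefficients); $\{h_t\}$ the automorphism flow of $\sigma$; $u$ continuous real, $u_0=0$; $g_t$ solves $\partial_tg_t(z)=-\frac{1}{h'_{u_t}(g_t(z))}b(h_{u_t}(g_t(z)))$, $g_0(z)=z$, and maps its domain of existence $D_t=g_t^{-1}(D)$ conformally onto $D$. *)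

(* Defs.v *)
From Stdlib Require Import Reals.
Open Scope R_scope.

Definition Cplx : Type := (R * R)%type.
Definition RtoC (r : R) : Cplx := (r, 0).
Definition Re (z : Cplx) : R := fst z.
Definition Im (z : Cplx) : R := snd z.
Definition Cadd (z w : Cplx) : Cplx := (fst z + fst w, snd z + snd w).
Definition Copp (z : Cplx) : Cplx := (- fst z, - snd z).
Definition Csub (z w : Cplx) : Cplx := Cadd z (Copp w).
Definition Cmul (z w : Cplx) : Cplx :=
  (fst z * fst w - snd z * snd w, fst z * snd w + snd z * fst w).
Definition Cinv (z : Cplx) : Cplx :=
  (fst z / (fst z ^ 2 + snd z ^ 2), - snd z / (fst z ^ 2 + snd z ^ 2)).
Definition Cdiv (z w : Cplx) : Cplx := Cmul z (Cinv w).
Definition Cnorm (z : Cplx) : R := sqrt (fst z ^ 2 + snd z ^ 2).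
Definition C1 : Cplx := (1, 0).

Definition Hplane (z : Cplx) : Prop := Im z > 0.

Definition has_cderiv (f : Cplx -> Cplx) (z d : Cplx) : Prop :=
  forall eps, eps > 0 -> exists delta, delta > 0 /\
    forall w, Cnorm (Csub w z) < delta ->
      Cnorm (Csub (Csub (f w) (f z)) (Cmul d (Csub w z))) <= eps * Cnorm (Csub w z).

Definition has_tderiv (y : R -> Cplx) (s : R) (v : Cplx) : Prop :=
  forall eps, eps > 0 -> exists delta, delta > 0 /\
    forall r, Rabs (r - s) < delta ->
      Cnorm (Csub (Csub (y r) (y s)) (Cmul (RtoC (r - s)) v)) <= eps * Rabs (r - s).

Definition conformal_param (D : Cplx -> Prop) (phi psi dphi : Cplx -> Cplx) : Prop :=
  (forall w, Hplane w -> D (phi w) /\ psi (phi w) = w /\ has_cderiv phi w (dphi w)) /\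
  (forall z, D z -> Hplane (psi z) /\ phi (psi z) = z).

Definition push (psi dphi : Cplx -> Cplx) (V : Cplx -> Cplx) (z : Cplx) : Cplx :=
  Cmul (dphi (psi z)) (V (psi z)).

(** l_n^H(z) = - z^(n+1), n = -2, -1, 0, 1 *)
Definition lH_m2 (w : Cplx) : Cplx := Copp (Cinv w).
Definition lH_m1 (w : Cplx) : Cplx := Copp C1.
Definition lH_0 (w : Cplx) : Cplx := Copp w.
Definition lH_1 (w : Cplx) : Cplx := Copp (Cmul w w).

Definition ell_m2 psi dphi := push psi dphi lH_m2.
Definition ell_m1 psi dphi := push psi dphi lH_m1.
Definition ell_0 psi dphi := push psi dphi lH_0.
Definition ell_1 psi dphi := push psi dphi lH_1.

Definition b_field (psi dphi : Cplx -> Cplx) (bm1 b0 b1 : R) (z : Cplx) : Cplx :=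
  Cadd (Cmul (RtoC 2) (ell_m2 psi dphi z))
   (Cadd (Cmul (RtoC bm1) (ell_m1 psi dphi z))
    (Cadd (Cmul (RtoC b0) (ell_0 psi dphi z)) (Cmul (RtoC b1) (ell_1 psi dphi z)))).

Definition sigma_field (psi dphi : Cplx -> Cplx) (s0 s1 : R) (z : Cplx) : Cplx :=
  Cadd (ell_m1 psi dphi z)
   (Cadd (Cmul (RtoC s0) (ell_0 psi dphi z)) (Cmul (RtoC s1) (ell_1 psi dphi z))).

Definition is_flow (D : Cplx -> Prop) (sigma : Cplx -> Cplx) (h : R -> Cplx -> Cplx) : Prop :=
  forall z, D z ->
    h 0 z = z /\
    (forall s, D (h s z)) /\
    (forall s, has_tderiv (fun r => h r z) s (sigma (h s z))).

Definition cont_nonneg (f : R -> R) : Prop :=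
  forall t, 0 <= t -> forall eps, eps > 0 -> exists delta, delta > 0 /\
    forall s, 0 <= s -> Rabs (s - t) < delta -> Rabs (f s - f t) < eps.

Definition monotone_nonneg (f : R -> R) : Prop :=
  (forall s t, 0 <= s -> s <= t -> f s <= f t) \/
  (forall s t, 0 <= s -> s <= t -> f t <= f s).

Definition loewner_rhs (b : Cplx -> Cplx) (h : R -> Cplx -> Cplx) (u : R -> R)
    (s : R) (w v : Cplx) : Prop :=
  exists d, has_cderiv (h (u s)) w d /\ v = Copp (Cdiv (b (h (u s) w)) d).

Definition is_sol (D : Cplx -> Prop) (b : Cplx -> Cplx) (h : R -> Cplx -> Cplx) (u : R -> R)
    (z : Cplx) (t : R) (y : R -> Cplx) : Prop :=
  y 0 = z /\
  (forall s, 0 <= s <= t -> D (y s)) /\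
  (forall s, 0 <= s <= t -> forall eps, eps > 0 -> exists delta, delta > 0 /\
     forall r, 0 <= r <= t -> Rabs (r - s) < delta -> Cnorm (Csub (y r) (y s)) < eps) /\
  (forall s, 0 < s < t -> exists v, loewner_rhs b h u s (y s) v /\ has_tderiv y s v).

(** Domain of existence D_t = g_t^{-1}(D) *)
Definition exist_dom (D : Cplx -> Prop) (b : Cplx -> Cplx) (h : R -> Cplx -> Cplx) (u : R -> R)
    (t : R) (z : Cplx) : Prop :=
  D z /\ exists y, is_sol D b h u z t y.

Definition conformal_onto (U V : Cplx -> Prop) (f : Cplx -> Cplx) : Prop :=
  (forall z, U z -> exists d, has_cderiv f z d) /\
  (forall z w, U z -> U w -> f z = f w -> z = w) /\
  (forall z, U z -> V (f z)) /\
  (forall w, V w -> exists z, U z /\ f z = w).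

(** {g_t}_{t>=0} is a normalized slit Loewner chain in D driven by b, sigma
    (through its flow h) and u *)
Definition loewner_chain (D : Cplx -> Prop) (b : Cplx -> Cplx) (h : R -> Cplx -> Cplx)
    (u : R -> R) (g : R -> Cplx -> Cplx) : Prop :=
  cont_nonneg u /\ u 0 = 0 /\
  (forall t z y, 0 <= t -> is_sol D b h u z t y -> g t z = y t) /\
  (forall t, 0 <= t -> conformal_onto (exist_dom D b h u t) D (g t)).

(* Main.v *)
(** The equation is transported to the half-plane by [psi]. There the flow of sigma
    consists of Moebius maps [M_u], and the quantity
    [E = |w1 - w2|^2 / (Im w1 * Im w2)] satisfies Hadamard's formula
    [E' = 2 E (E + 4) Q1 Q2] along the Loewner flow, where [Q = Im (- 1 / M_u w)] is a
    Poisson kernel. Since [g_t] and [gt_(lam t)] have the same domain, Schwarz-Pick applied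
    to [gt_(lam t) o g_t^-1] and to its inverse shows that [E] is the same for both chains.
    Comparing derivatives, [lam] is differentiable with [lam' = Q1 Q2 / (Qt1 Qt2)] for
    every pair of points, hence the ratio [Q / Qt] does not depend on the point. As the
    logarithmic derivative of [Q] in [u] is [s0 + 2 Re (1 / M_u w)], this
    ratio at two points controls [ut_(lam t) - u_t], and then [lam' - 1], by the
    displacement of the two trajectories. Gronwall's lemma gives that the displacement
    vanishes, first locally in time and then for all times. *)
Require Import Defs.
From Stdlib Require Import Reals Lra Lia Psatz ClassicalEpsilon.
From Coquelicot Require Import Coquelicot.
Open Scope R_scope.

(** * Goursat's theorem on rectangles *)

(** No boundary point need be fixed by the flow of [sigma] or by [b], so a capacity normalized at
    such a point cannot serve as a clock. The hyperbolic distance is insensitive to automorphisms: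
    the terms of [b] with coefficients [bm1], [b0], [b1] act as isometries and drop out of its
    derivative. The driving terms are merely continuous and cannot be differentiated; hence their
    difference is bounded algebraically by the displacement of trajectories, and only the
    displacement enters the differential inequality. On the analytic side, complex derivatives are
    given pointwise with no continuity in the point, and the definitions supply neither openness of
    the domains of existence nor continuity of the inverse maps. Schwarz-Pick therefore starts from
    Goursat's bisection. Removable singularities are circumvented: the n-th power of a function
    continuous at the singular point is multiplied by a factor vanishing there, the maximum
    principle is applied to the product, and n-th roots erase the factor. Continuity of the inverse
    maps comes from the expansion of the hyperbolic distance. *)

(** Compactness by bisection: a failing rectangle has a failing quarter, and the nested failing
    rectangles shrink to a point where the local hypothesis is contradicted. A single scale [s] for
    both sides keeps all rectangles similar to the first one. *)
Lemma rect_bisection (P : R -> R -> R -> Prop) (a c L H : R) :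
  0 < L -> 0 < H ->
  (forall x y s, 0 < s -> a <= x -> x + L * s <= a + L -> c <= y -> y + H * s <= c + H ->
     P x y (s/2) -> P (x + L * (s/2)) y (s/2) ->
     P x (y + H * (s/2)) (s/2) -> P (x + L * (s/2)) (y + H * (s/2)) (s/2) -> P x y s) ->
  (forall x0 y0, a <= x0 <= a + L -> c <= y0 <= c + H ->
     exists delta, delta > 0 /\ forall x y s, 0 < s < delta ->
       x <= x0 <= x + L * s -> y <= y0 <= y + H * s ->
       a <= x -> x + L * s <= a + L -> c <= y -> y + H * s <= c + H -> P x y s) ->
  P a c 1.
Proof.
intros HL HH Hsplit Hloc.
apply NNPP; intro Hn.
set (Q := fun v : R * R * R => let '(x, y, s) := v in
  0 < s /\ a <= x /\ x + L * s <= a + L /\ c <= y /\ y + H * s <= c + H /\ ~ P x y s).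
assert (Hstep : forall v, Q v -> exists v', Q v' /\
   snd v' = snd v / 2 /\ fst (fst v) <= fst (fst v') /\ snd (fst v) <= snd (fst v') /\
   fst (fst v') + L * snd v' <= fst (fst v) + L * snd v /\
   snd (fst v') + H * snd v' <= snd (fst v) + H * snd v).
{ intros [[x y] s] (Hs & H1 & H2 & H3 & H4 & H5).
  assert (0 < L * s) by nra. assert (0 < H * s) by nra.
  destruct (classic (P x y (s/2))) as [P1|P1].
  2:{ exists (x, y, s/2); simpl; repeat split; auto; try lra; nra. }
  destruct (classic (P (x + L * (s/2)) y (s/2))) as [P2|P2].
  2:{ exists (x + L * (s/2), y, s/2); simpl; repeat split; auto; try lra; nra. }
  destruct (classic (P x (y + H * (s/2)) (s/2))) as [P3|P3].
  2:{ exists (x, y + H * (s/2), s/2); simpl; repeat split; auto; try lra; nra. }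
  destruct (classic (P (x + L * (s/2)) (y + H * (s/2)) (s/2))) as [P4|P4].
  2:{ exists (x + L * (s/2), y + H * (s/2), s/2); simpl; repeat split; auto; try lra; nra. }
  exfalso; apply H5, Hsplit; auto. }
set (nx := fun v => epsilon (inhabits v) (fun v' => Q v' /\
   snd v' = snd v / 2 /\ fst (fst v) <= fst (fst v') /\ snd (fst v) <= snd (fst v') /\
   fst (fst v') + L * snd v' <= fst (fst v) + L * snd v /\
   snd (fst v') + H * snd v' <= snd (fst v) + H * snd v)).
set (sq := fix sq n := match n with O => (a, c, 1) | S k => nx (sq k) end).
assert (Q0 : Q (sq O)) by (simpl; repeat split; auto; lra).
assert (Hnx : forall v, Q v -> Q (nx v) /\
   snd (nx v) = snd v / 2 /\ fst (fst v) <= fst (fst (nx v)) /\ snd (fst v) <= snd (fst (nx v)) /\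
   fst (fst (nx v)) + L * snd (nx v) <= fst (fst v) + L * snd v /\
   snd (fst (nx v)) + H * snd (nx v) <= snd (fst v) + H * snd v).
{ intros v Hv; apply (epsilon_spec (inhabits v) _ (Hstep v Hv)). }
assert (Qn : forall n, Q (sq n)).
{ induction n; [exact Q0 | exact (proj1 (Hnx _ IHn))]. }
assert (Hs : forall n, snd (sq n) = (/2)^n).
{ induction n; [reflexivity|].
  destruct (Hnx _ (Qn n)) as (_ & E & _). change (sq (S n)) with (nx (sq n)).
  rewrite E, IHn; simpl; lra. }
assert (Hmono : forall n k, fst (fst (sq n)) <= fst (fst (sq (n + k)%nat)) /\
   snd (fst (sq n)) <= snd (fst (sq (n + k)%nat)) /\
   fst (fst (sq (n+k)%nat)) + L * snd (sq (n+k)%nat) <= fst (fst (sq n)) + L * snd (sq n) /\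
   snd (fst (sq (n+k)%nat)) + H * snd (sq (n+k)%nat) <= snd (fst (sq n)) + H * snd (sq n)).
{ intros n k; induction k.
  - rewrite Nat.add_0_r; lra.
  - rewrite Nat.add_succ_r. change (sq (S (n + k))) with (nx (sq (n + k)%nat)).
    destruct (Hnx _ (Qn (n + k)%nat)) as (_ & _ & E); lra. }
assert (Hpos : forall n, 0 < snd (sq n)) by (intro n; rewrite Hs; apply pow_lt; lra).
(* Each lower left corner is below every upper right corner, so the suprema of the lower left
   coordinates give a point common to all rectangles. *)
assert (Hcross : forall m n, fst (fst (sq m)) <= fst (fst (sq n)) + L * snd (sq n) /\
                             snd (fst (sq m)) <= snd (fst (sq n)) + H * snd (sq n)).
{ intros m n. pose proof (Hpos m). pose proof (Hpos n).
  assert (0 < L * snd (sq m)) by nra. assert (0 < H * snd (sq m)) by nra.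
  assert (0 < L * snd (sq n)) by nra. assert (0 < H * snd (sq n)) by nra.
  destruct (Nat.le_gt_cases m n) as [h|h].
  - pose proof (Hmono m (n - m)%nat) as E. replace (m + (n - m))%nat with n in E by lia. lra.
  - pose proof (Hmono n (m - n)%nat) as E. replace (n + (m - n))%nat with m in E by lia. lra. }
destruct (completeness (fun r => exists n, r = fst (fst (sq n)))) as [x0 [Hx1 Hx2]].
{ exists (a + L). intros r [n ->]. destruct (Hcross n O) as [h _]. simpl in h. lra. }
{ eexists; exists O; reflexivity. }
destruct (completeness (fun r => exists n, r = snd (fst (sq n)))) as [y0 [Hy1 Hy2]].
{ exists (c + H). intros r [n ->]. destruct (Hcross n O) as [_ h]. simpl in h. lra. }
{ eexists; exists O; reflexivity. }
assert (Hx : forall n, fst (fst (sq n)) <= x0 <= fst (fst (sq n)) + L * snd (sq n)).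
{ intro n; split; [apply Hx1; eauto|]. apply Hx2. intros r [m ->]. apply Hcross. }
assert (Hy : forall n, snd (fst (sq n)) <= y0 <= snd (fst (sq n)) + H * snd (sq n)).
{ intro n; split; [apply Hy1; eauto|]. apply Hy2. intros r [m ->]. apply Hcross. }
destruct (Hloc x0 y0) as [delta [Hd Hl]].
{ pose proof (Hx O) as h; simpl in h; lra. }
{ pose proof (Hy O) as h; simpl in h; lra. }
destruct (pow_lt_1_zero (/2)) with (y := delta) as [N HN]; auto.
{ rewrite Rabs_pos_eq; lra. }
specialize (HN N (le_n _)). rewrite <- Hs, Rabs_pos_eq in HN by (left; apply Hpos).
pose proof (Qn N) as QN. specialize (Hx N). specialize (Hy N). specialize (Hpos N).
destruct (sq N) as [[x y] s]; simpl in *.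
apply QN, Hl; tauto.
Qed.

(** The counterclockwise integral of p dx + q dy. Opposite sides share one integrand, so that their
    near cancellation on small rectangles is visible. *)
Definition boundary_integral (p q : R -> R -> R) (a b c d : R) : R :=
  RInt (fun x => p x c - p x d) a b + RInt (fun y => q b y - q a y) c d.

(** Joint differentiability of [p] and [q] at one point; closedness of p dx + q dy is the use of the
    same [k] for the y-derivative of [p] and the x-derivative of [q]. *)
Definition closed_form_at (p q : R -> R -> R) (x0 y0 : R) : Prop :=
  exists px k qy, forall eps, eps > 0 -> exists delta, delta > 0 /\
    forall x y, Rabs (x - x0) < delta -> Rabs (y - y0) < delta ->
      Rabs (p x y - p x0 y0 - px * (x - x0) - k * (y - y0))
        <= eps * (Rabs (x - x0) + Rabs (y - y0)) /\
      Rabs (q x y - q x0 y0 - k * (x - x0) - qy * (y - y0))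
        <= eps * (Rabs (x - x0) + Rabs (y - y0)).

Lemma continuous_of_linear_bound (f : R -> R) (x0 K : R) (delta : R) :
  0 < delta -> (forall x, Rabs (x - x0) < delta -> Rabs (f x - f x0) <= K * Rabs (x - x0)) ->
  continuous f x0.
Proof.
intros Hd H. apply continuity_pt_filterlim.
intros eps He.
set (K' := Rabs K + 1).
assert (0 < K') by (unfold K'; pose proof (Rabs_pos K); lra).
exists (Rmin delta (eps / K')). split.
{ apply Rmin_glb_lt; auto. apply Rdiv_lt_0_compat; lra. }
intros x [_ Hx]. simpl in *. unfold Rdist in *.
pose proof (Rmin_l delta (eps / K')). pose proof (Rmin_r delta (eps / K')).
apply Rle_lt_trans with (K' * Rabs (x - x0)).
{ eapply Rle_trans; [apply H; lra|].
  apply Rmult_le_compat_r; [apply Rabs_pos|]. unfold K'; pose proof (Rle_abs K); lra. }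
apply Rlt_le_trans with (K' * (eps / K')).
{ apply Rmult_lt_compat_l; lra. }
right; field; lra.
Qed.

Lemma closed_form_continuous (p q : R -> R -> R) (x0 y0 : R) :
  closed_form_at p q x0 y0 ->
  continuous (fun x => p x y0) x0 /\ continuous (fun y => q x0 y) y0.
Proof.
intros (px & k & qy & H). destruct (H 1) as (delta & Hd & Hb); [lra|].
split.
- apply continuous_of_linear_bound with (K := Rabs px + 1) (delta := delta); auto.
  intros x Hx. destruct (Hb x y0 Hx) as [h _]. { rewrite Rminus_diag, Rabs_R0; lra. }
  rewrite Rminus_diag, Rabs_R0 in h.
  replace (p x y0 - p x0 y0) with
    ((p x y0 - p x0 y0 - px * (x - x0) - k * 0) + px * (x - x0)) by ring.
  eapply Rle_trans; [apply Rabs_triang|]. rewrite Rabs_mult. lra.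
- apply continuous_of_linear_bound with (K := Rabs qy + 1) (delta := delta); auto.
  intros y Hy. destruct (Hb x0 y) as [_ h]; auto. { rewrite Rminus_diag, Rabs_R0; lra. }
  rewrite Rminus_diag, Rabs_R0 in h.
  replace (q x0 y - q x0 y0) with
    ((q x0 y - q x0 y0 - k * 0 - qy * (y - y0)) + qy * (y - y0)) by ring.
  eapply Rle_trans; [apply Rabs_triang|]. rewrite Rabs_mult. lra.
Qed.

Lemma RInt_near_const (f : R -> R) (a b m e : R) :
  a <= b -> ex_RInt f a b -> (forall x, a <= x <= b -> Rabs (f x - m) <= e) ->
  Rabs (RInt f a b - m * (b - a)) <= e * (b - a).
Proof.
intros Hab Hf H.
assert (h1 : RInt f a b <= RInt (fun _ => m + e) a b).
{ apply RInt_le; auto. apply ex_RInt_const.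
  intros x Hx. specialize (H x). assert (a <= x <= b) by lra.
  pose proof (Rle_abs (f x - m)). specialize (H H0). lra. }
assert (h2 : RInt (fun _ => m - e) a b <= RInt f a b).
{ apply RInt_le; auto. apply ex_RInt_const.
  intros x Hx. specialize (H x). assert (a <= x <= b) by lra. specialize (H H0).
  pose proof (Rle_abs (-(f x - m))). rewrite Rabs_Ropp in H1. lra. }
rewrite RInt_const in h1, h2. unfold scal in *; simpl in *; unfold mult in *; simpl in *.
apply Rabs_le. lra.
Qed.

Lemma boundary_integral_split (p q : R -> R -> R) (a m b c n d : R) :
  a <= m <= b -> c <= n <= d ->
  (forall x y, a <= x <= b -> c <= y <= d -> continuous (fun x => p x y) x) ->
  (forall x y, a <= x <= b -> c <= y <= d -> continuous (fun y => q x y) y) ->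
  boundary_integral p q a b c d =
  boundary_integral p q a m c n + boundary_integral p q m b c n +
  boundary_integral p q a m n d + boundary_integral p q m b n d.
Proof.
intros Hm Hn Hp Hq.
assert (Ep : forall x1 x2 y, a <= x1 <= x2 -> x2 <= b -> c <= y <= d -> ex_RInt (fun x => p x y) x1 x2).
{ intros. apply (ex_RInt_continuous (V := R_CompleteNormedModule)).
  intros z. rewrite Rmin_left, Rmax_right by lra. intros. apply Hp; lra. }
assert (Eq : forall x y1 y2, c <= y1 <= y2 -> y2 <= d -> a <= x <= b -> ex_RInt (fun y => q x y) y1 y2).
{ intros. apply (ex_RInt_continuous (V := R_CompleteNormedModule)).
  intros z. rewrite Rmin_left, Rmax_right by lra. intros. apply Hq; lra. }
assert (Mp : forall x1 x2 y1 y2, a <= x1 <= x2 -> x2 <= b -> c <= y1 <= d -> c <= y2 <= d ->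
  RInt (fun x => p x y1 - p x y2) x1 x2 = RInt (fun x => p x y1) x1 x2 - RInt (fun x => p x y2) x1 x2).
{ intros. apply (RInt_minus (V := R_CompleteNormedModule)); apply Ep; auto. }
assert (Mq : forall x1 x2 y1 y2, c <= y1 <= y2 -> y2 <= d -> a <= x1 <= b -> a <= x2 <= b ->
  RInt (fun y => q x1 y - q x2 y) y1 y2 = RInt (fun y => q x1 y) y1 y2 - RInt (fun y => q x2 y) y1 y2).
{ intros. apply (RInt_minus (V := R_CompleteNormedModule)); apply Eq; auto. }
unfold boundary_integral.
rewrite !Mp, !Mq by lra.
assert (Cp : forall y, c <= y <= d -> RInt (fun x => p x y) a b =
   RInt (fun x => p x y) a m + RInt (fun x => p x y) m b).
{ intros. symmetry. apply (RInt_Chasles (V := R_CompleteNormedModule)); apply Ep; lra. }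
assert (Cq : forall x, a <= x <= b -> RInt (fun y => q x y) c d =
   RInt (fun y => q x y) c n + RInt (fun y => q x y) n d).
{ intros. symmetry. apply (RInt_Chasles (V := R_CompleteNormedModule)); apply Eq; lra. }
rewrite !Cp, !Cq by lra. ring.
Qed.

(** The affine parts contribute [- k * h * l] and [k * l * h], which cancel because of the common
    [k]. Only the two remainders, each of size [e * (l + h)], survive on every pair of opposite
    sides. *)
Lemma boundary_integral_local (p q : R -> R -> R) (x0 y0 px k qy e x y l h : R) :
  0 <= l -> 0 <= h -> 0 <= e -> x <= x0 <= x + l -> y <= y0 <= y + h ->
  (forall u v, x <= u <= x + l -> y <= v <= y + h ->
      Rabs (p u v - p x0 y0 - px * (u - x0) - k * (v - y0))
        <= e * (Rabs (u - x0) + Rabs (v - y0)) /\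
      Rabs (q u v - q x0 y0 - k * (u - x0) - qy * (v - y0))
        <= e * (Rabs (u - x0) + Rabs (v - y0))) ->
  ex_RInt (fun t => p t y - p t (y + h)) x (x + l) ->
  ex_RInt (fun t => q (x + l) t - q x t) y (y + h) ->
  Rabs (boundary_integral p q x (x + l) y (y + h)) <= 2 * e * (l + h) * (l + h).
Proof.
intros Hl Hh He Hx Hy H E1 E2.
assert (B : forall u v, x <= u <= x + l -> y <= v <= y + h ->
   e * (Rabs (u - x0) + Rabs (v - y0)) <= e * (l + h)).
{ intros u v Hu Hv. apply Rmult_le_compat_l; auto.
  apply Rplus_le_compat; apply Rabs_le; lra. }
assert (A1 : Rabs (RInt (fun t => p t y - p t (y + h)) x (x + l) - - k * h * (x + l - x))
   <= 2 * e * (l + h) * (x + l - x)).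
{ apply RInt_near_const; auto; [lra|].
  intros t Ht. destruct (H t y) as [h1 _]; [lra|lra|]. destruct (H t (y + h)) as [h2 _]; [lra|lra|].
  pose proof (B t y ltac:(lra) ltac:(lra)). pose proof (B t (y + h) ltac:(lra) ltac:(lra)).
  replace (p t y - p t (y + h) - - k * h) with
   ((p t y - p x0 y0 - px * (t - x0) - k * (y - y0)) -
    (p t (y + h) - p x0 y0 - px * (t - x0) - k * (y + h - y0))) by ring.
  eapply Rle_trans; [apply Rabs_triang|]. rewrite Rabs_Ropp. lra. }
assert (A2 : Rabs (RInt (fun t => q (x + l) t - q x t) y (y + h) - k * l * (y + h - y))
   <= 2 * e * (l + h) * (y + h - y)).
{ apply RInt_near_const; auto; [lra|].
  intros t Ht. destruct (H (x + l) t) as [_ h1]; [lra|lra|]. destruct (H x t) as [_ h2]; [lra|lra|].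
  pose proof (B (x + l) t ltac:(lra) ltac:(lra)). pose proof (B x t ltac:(lra) ltac:(lra)).
  replace (q (x + l) t - q x t - k * l) with
   ((q (x + l) t - q x0 y0 - k * (x + l - x0) - qy * (t - y0)) -
    (q x t - q x0 y0 - k * (x - x0) - qy * (t - y0))) by ring.
  eapply Rle_trans; [apply Rabs_triang|]. rewrite Rabs_Ropp. lra. }
unfold boundary_integral.
replace (x + l - x) with l in A1 by ring. replace (y + h - y) with h in A2 by ring.
replace (RInt (fun t => p t y - p t (y + h)) x (x + l) + RInt (fun t => q (x + l) t - q x t) y (y + h))
 with ((RInt (fun t => p t y - p t (y + h)) x (x + l) - - k * h * l)
      + (RInt (fun t => q (x + l) t - q x t) y (y + h) - k * l * h)) by ring.
eapply Rle_trans; [apply Rabs_triang|]. lra.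
Qed.

Theorem goursat_rectangle (p q : R -> R -> R) (a b c d : R) :
  a < b -> c < d ->
  (forall x y, a <= x <= b -> c <= y <= d -> closed_form_at p q x y) ->
  boundary_integral p q a b c d = 0.
Proof.
intros Hab Hcd Hcl.
assert (Hp : forall x y, a <= x <= b -> c <= y <= d -> continuous (fun x => p x y) x).
{ intros x y Hx Hy. apply (closed_form_continuous p q x y), Hcl; auto. }
assert (Hq : forall x y, a <= x <= b -> c <= y <= d -> continuous (fun y => q x y) y).
{ intros x y Hx Hy. apply (closed_form_continuous p q x y), Hcl; auto. }
set (L := b - a). set (H := d - c).
assert (HL : 0 < L) by (unfold L; lra). assert (HH : 0 < H) by (unfold H; lra).
apply Rabs_eq_0. apply Rle_antisym; [|apply Rabs_pos].
apply le_epsilon. intros eta Heta. rewrite Rplus_0_l.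
cut (Rabs (boundary_integral p q a (a + L * 1) c (c + H * 1)) <= eta * 1 ^ 2).
{ replace (a + L * 1) with b by (unfold L; ring). replace (c + H * 1) with d by (unfold H; ring). lra. }
(* The bound [eta * s ^ 2] passes from the quarters to the whole, because four times [(s/2) ^ 2] is
   [s ^ 2]. *)
apply (rect_bisection (fun x y s =>
  Rabs (boundary_integral p q x (x + L * s) y (y + H * s)) <= eta * s ^ 2) a c L H HL HH).
- intros x y s Hs H1 H2 H3 H4 P1 P2 P3 P4.
  assert (0 < L * s) by nra. assert (0 < H * s) by nra.
  rewrite (boundary_integral_split p q x (x + L * (s/2)) _ y (y + H * (s/2)) _); try nra.
  2,3: intros; (apply Hp || apply Hq); unfold L, H in *; lra.
  replace (x + L * (s / 2) + L * (s / 2)) with (x + L * s) in * by field.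
  replace (y + H * (s / 2) + H * (s / 2)) with (y + H * s) in * by field.
  eapply Rle_trans; [eapply Rle_trans; [apply Rabs_triang|apply Rplus_le_compat_r]|].
  { eapply Rle_trans; [apply Rabs_triang|apply Rplus_le_compat_r]. apply Rabs_triang. }
  simpl in *. lra.
- intros x0 y0 Hx0 Hy0.
  destruct (Hcl x0 y0) as (px & k & qy & Hd); [unfold L in *; lra|unfold H in *; lra|].
  (* Chosen so that the local bound [2 * e * (L * s + H * s) ^ 2] is exactly [eta * s ^ 2]. *)
  set (e := eta / (2 * (L + H) * (L + H))).
  assert (He : 0 < e). { apply Rdiv_lt_0_compat; auto. nra. }
  destruct (Hd e He) as (delta & Hdelta & Hb).
  exists (Rmin (delta / L) (delta / H)). split.
  { apply Rmin_glb_lt; apply Rdiv_lt_0_compat; auto. }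
  intros x y s Hs Hx Hy H1 H2 H3 H4.
  assert (0 < L * s) by nra. assert (0 < H * s) by nra.
  assert (L * s < delta).
  { apply Rlt_le_trans with (L * (delta / L)). apply Rmult_lt_compat_l; auto.
    pose proof (Rmin_l (delta / L) (delta / H)); lra. right; field; lra. }
  assert (H * s < delta).
  { apply Rlt_le_trans with (H * (delta / H)). apply Rmult_lt_compat_l; auto.
    pose proof (Rmin_r (delta / L) (delta / H)); lra. right; field; lra. }
  replace (eta * s ^ 2) with (2 * e * (L * s + H * s) * (L * s + H * s)).
  2:{ unfold e. field. lra. }
  apply (boundary_integral_local p q x0 y0 px k qy); try lra.
  + intros u v Hu Hv. apply Hb; apply Rabs_lt_between'; lra.
  + apply (ex_RInt_minus (V := R_NormedModule)); apply (ex_RInt_continuous (V := R_CompleteNormedModule));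
    intros z; rewrite Rmin_left, Rmax_right by lra; intros; apply Hp; unfold L, H in *; lra.
  + apply (ex_RInt_minus (V := R_NormedModule)); apply (ex_RInt_continuous (V := R_CompleteNormedModule));
    intros z; rewrite Rmin_left, Rmax_right by lra; intros; apply Hq; unfold L, H in *; lra.
Qed.

(** * Limits and derivatives of complex functions *)

(** An arbitrary filter lets one set of limit rules serve for complex points, for two-sided times
    and for times confined to an interval. *)
Definition tends {T : Type} (F : (T -> Prop) -> Prop) (f : T -> C) (l : C) : Prop :=
  forall eps, eps > 0 -> F (fun x => Cmod (f x - l)%C < eps).

(** The neighbourhoods are not punctured, so a limit along them takes the value at the centre into
    account. *)
Definition nbhdC (z : C) (P : C -> Prop) : Prop :=
  exists delta, delta > 0 /\ forall w, Cmod (w - z)%C < delta -> P w.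

Definition nbhdR (s : R) (P : R -> Prop) : Prop :=
  exists delta, delta > 0 /\ forall r, Rabs (r - s) < delta -> P r.

#[local] Instance nbhdC_filter (z : C) : Filter (nbhdC z).
Proof.
constructor.
- exists 1; split; [lra|auto].
- intros P Q (d1 & H1 & K1) (d2 & H2 & K2). exists (Rmin d1 d2). split.
  { apply Rmin_glb_lt; auto. }
  intros w Hw. pose proof (Rmin_l d1 d2). pose proof (Rmin_r d1 d2). split; [apply K1|apply K2]; lra.
- intros P Q H (d & Hd & K). exists d; auto.
Qed.

#[local] Instance nbhdR_filter (s : R) : Filter (nbhdR s).
Proof.
constructor.
- exists 1; split; [lra|auto].
- intros P Q (d1 & H1 & K1) (d2 & H2 & K2). exists (Rmin d1 d2). split.
  { apply Rmin_glb_lt; auto. }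
  intros w Hw. pose proof (Rmin_l d1 d2). pose proof (Rmin_r d1 d2). split; [apply K1|apply K2]; lra.
- intros P Q H (d & Hd & K). exists d; auto.
Qed.

Lemma nbhdC_center (z : C) (P : C -> Prop) : nbhdC z P -> P z.
Proof.
intros (d & Hd & H). apply H. replace (z - z)%C with (0 : C) by ring. rewrite Cmod_0; auto.
Qed.

Lemma nbhdR_center (z : R) (P : R -> Prop) : nbhdR z P -> P z.
Proof. intros (d & Hd & H). apply H. rewrite Rminus_diag, Rabs_R0; auto. Qed.

Lemma Cmod_minus_sym (z w : C) : Cmod (z - w) = Cmod (w - z).
Proof. rewrite <- Cmod_opp. f_equal. ring. Qed.

Lemma Cmod_triangle_rev (z w : C) : Cmod z - Cmod w <= Cmod (z - w).
Proof.
pose proof (Cmod_triangle (z - w) w) as h. replace (z - w + w)%C with z in h by ring. lra.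
Qed.

Lemma Cmod_eq0_minus (z w : C) : Cmod (z - w) = 0 -> z = w.
Proof. intros h. apply Cmod_eq_0 in h. replace z with (z - w + w)%C by ring. rewrite h; ring. Qed.

Section Tends.
Context {T : Type} (F : (T -> Prop) -> Prop) {FF : Filter F}.

Lemma tends_ext (f g : T -> C) (l : C) :
  F (fun x => f x = g x) -> tends F f l -> tends F g l.
Proof.
intros He Hf eps Heps. generalize (filter_and _ _ He (Hf eps Heps)).
apply filter_imp. intros x [<- h]; auto.
Qed.

Lemma tends_eq (f : T -> C) (l m : C) : tends F f l -> l = m -> tends F f m.
Proof. intros H <-; exact H. Qed.

Lemma tends_const (c : C) : tends F (fun _ => c) c.
Proof.
intros eps Heps. apply filter_forall. intros _. replace (c - c)%C with (0 : C) by ring.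
rewrite Cmod_0; auto.
Qed.

Lemma tends_plus (f g : T -> C) (l m : C) :
  tends F f l -> tends F g m -> tends F (fun x => f x + g x)%C (l + m)%C.
Proof.
intros Hf Hg eps Heps.
assert (He : eps / 2 > 0) by lra.
generalize (filter_and _ _ (Hf _ He) (Hg _ He)).
apply filter_imp. intros x [h1 h2].
replace (f x + g x - (l + m))%C with ((f x - l) + (g x - m))%C by ring.
eapply Rle_lt_trans; [apply Cmod_triangle|lra].
Qed.

Lemma tends_opp (f : T -> C) (l : C) : tends F f l -> tends F (fun x => - f x)%C (- l)%C.
Proof.
intros Hf eps Heps. generalize (Hf eps Heps). apply filter_imp. intros x h.
replace (- f x - - l)%C with (- (f x - l))%C by ring. rewrite Cmod_opp; auto.
Qed.

Lemma tends_minus (f g : T -> C) (l m : C) :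
  tends F f l -> tends F g m -> tends F (fun x => f x - g x)%C (l - m)%C.
Proof. intros; apply tends_plus; auto; apply tends_opp; auto. Qed.

Lemma tends_conj (f : T -> C) (l : C) : tends F f l -> tends F (fun x => Cconj (f x)) (Cconj l).
Proof.
intros Hf eps Heps. generalize (Hf eps Heps). apply filter_imp. intros x h.
rewrite <- Cminus_conj, Cmod_conj; auto.
Qed.

Lemma tends_bounded (f : T -> C) (l : C) : tends F f l -> F (fun x => Cmod (f x) <= Cmod l + 1).
Proof.
intros Hf. generalize (Hf 1 Rlt_0_1). apply filter_imp. intros x h.
pose proof (Cmod_triangle_rev (f x) l). lra.
Qed.

Lemma tends_away (f : T -> C) (l : C) :
  l <> 0 -> tends F f l -> F (fun x => Cmod l / 2 < Cmod (f x)).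
Proof.
intros Hl Hf. apply Cmod_gt_0 in Hl. 
assert (He : Cmod l / 2 > 0) by lra. generalize (Hf _ He).
apply filter_imp. intros x h. rewrite Cmod_minus_sym in h.
pose proof (Cmod_triangle_rev l (f x)). lra.
Qed.

Lemma tends_mult (f g : T -> C) (l m : C) :
  tends F f l -> tends F g m -> tends F (fun x => f x * g x)%C (l * m)%C.
Proof.
intros Hf Hg eps Heps.
set (K := Cmod l + Cmod m + 1).
pose proof (Cmod_ge_0 l). pose proof (Cmod_ge_0 m).
assert (HK : 0 < K) by (unfold K; lra).
assert (He : eps / (2 * K) > 0) by (apply Rdiv_lt_0_compat; lra).
generalize (filter_and _ _ (tends_bounded _ _ Hg) (filter_and _ _ (Hf _ He) (Hg _ He))).
apply filter_imp. intros x (h0 & h1 & h2).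
replace (f x * g x - l * m)%C with ((f x - l) * g x + l * (g x - m))%C by ring.
eapply Rle_lt_trans; [apply Cmod_triangle|]. rewrite !Cmod_mult.
apply Rlt_le_trans with (eps / (2 * K) * K + K * (eps / (2 * K))).
2:{ right; field; lra. }
pose proof (Cmod_ge_0 (f x - l)). pose proof (Cmod_ge_0 (g x - m)).
apply Rplus_lt_le_compat.
- apply Rle_lt_trans with (Cmod (f x - l) * K).
  { apply Rmult_le_compat_l; auto. unfold K; lra. }
  apply Rmult_lt_compat_r; auto.
- apply Rmult_le_compat; try lra. unfold K; lra.
Qed.

Lemma tends_inv (f : T -> C) (l : C) :
  l <> 0 -> tends F f l -> tends F (fun x => / f x)%C (/ l)%C.
Proof.
intros Hl Hf eps Heps. pose proof (proj1 (Cmod_gt_0 l) Hl) as Hl'.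
set (K := Cmod l).
assert (HK : 0 < K * K) by (apply Rmult_lt_0_compat; exact Hl').
assert (He : eps * (K * K / 2) > 0) by (apply Rmult_lt_0_compat; lra).
generalize (filter_and _ _ (tends_away _ _ Hl Hf) (Hf _ He)).
apply filter_imp. intros x [h1 h2].
assert (Hx : f x <> 0) by (apply Cmod_gt_0; lra).
replace (/ f x - / l)%C with (- (f x - l) * (/ f x * / l))%C by (field; auto).
rewrite !Cmod_mult, Cmod_opp, !Cmod_inv by auto. fold K in h1, Hl' |- *.
apply Rmult_lt_reg_r with (Cmod (f x) * K); [apply Rmult_lt_0_compat; lra|].
replace (Cmod (f x - l) * (/ Cmod (f x) * / K) * (Cmod (f x) * K)) with (Cmod (f x - l))
  by (field; lra).
eapply Rlt_le_trans; [exact h2|]. apply Rmult_le_compat_l; [lra|]. nra.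
Qed.

Lemma tends_comp (f : T -> C) (g : C -> C) (l m : C) :
  tends F f l -> tends (nbhdC l) g m -> tends F (fun x => g (f x)) m.
Proof.
intros Hf Hg eps Heps. destruct (Hg eps Heps) as (d & Hd & K).
generalize (Hf d Hd). apply filter_imp. intros x; apply K.
Qed.

Lemma tends_nbhd (f : T -> C) (l : C) (P : C -> Prop) :
  tends F f l -> nbhdC l P -> F (fun x => P (f x)).
Proof.
intros Hf (d & Hd & K). generalize (Hf d Hd). apply filter_imp. intros x; apply K.
Qed.

Lemma tends_RtoC_fst (f : T -> C) (l : C) :
  tends F f l -> tends F (fun x => RtoC (fst (f x))) (RtoC (fst l)).
Proof.
intros Hf eps Heps. generalize (Hf eps Heps). apply filter_imp. intros x h.
eapply Rle_lt_trans; [|exact h].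
rewrite <- RtoC_minus, Cmod_R. exact (re_le_Cmod (f x - l)).
Qed.

End Tends.

Lemma im_le_Cmod (z : C) : Rabs (snd z) <= Cmod z.
Proof. eapply Rle_trans; [apply Rmax_r|apply Rmax_Cmod]. Qed.

Lemma tends_id (z : C) : tends (nbhdC z) (fun w => w) z.
Proof. intros eps Heps. exists eps; auto. Qed.

Lemma tends_unique (z : C) (f : C -> C) (l m : C) :
  (forall delta, delta > 0 -> exists w, Cmod (w - z) < delta /\ w <> z) ->
  forall g, tends (nbhdC z) f l -> tends (nbhdC z) g m -> (forall w, w <> z -> f w = g w) -> l = m.
Proof.
intros Hz g Hf Hg Hfg. apply Cmod_eq0_minus. apply Rle_antisym; [|apply Cmod_ge_0].
apply le_epsilon. intros eps Heps. rewrite Rplus_0_l.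
assert (He : eps / 2 > 0) by lra.
destruct (filter_and _ _ (Hf _ He) (Hg _ He)) as (d & Hd & K).
destruct (Hz d Hd) as (w & Hw & Hn). destruct (K w Hw) as [h1 h2].
rewrite <- (Hfg w Hn) in h2.
replace (l - m)%C with ((f w - m) - (f w - l))%C by ring.
eapply Rle_trans; [apply Cmod_triangle|]. rewrite Cmod_opp. lra.
Qed.

Lemma nbhdC_punctured (z : C) (delta : R) : delta > 0 ->
  exists w, Cmod (w - z) < delta /\ w <> z.
Proof.
intros Hd. exists (z + RtoC (delta / 2))%C.
replace (z + RtoC (delta / 2) - z)%C with (RtoC (delta / 2)) by ring.
rewrite Cmod_R, Rabs_pos_eq by lra. split; [lra|].
intro h. assert (RtoC (delta / 2) = 0) as h'.
{ replace (RtoC (delta / 2)) with (z + RtoC (delta / 2) - z)%C by ring. rewrite h; ring. }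
apply RtoC_inj in h'. lra.
Qed.

(* Caratheodory's form of differentiability: the calculus rules then reduce to
   those for limits. *)
Lemma has_cderiv_slope (f : C -> C) (z d : C) :
  has_cderiv f z d <->
  exists s : C -> C, (forall w, f w = f z + s w * (w - z))%C /\ s z = d /\ tends (nbhdC z) s d.
Proof.
split.
- intros H.
  exists (fun w => if excluded_middle_informative (w = z) then d else ((f w - f z) / (w - z))%C).
  assert (E : forall w, w <> z -> (w - z)%C <> 0).
  { intros w Hw h. apply Hw. replace w with (w - z + z)%C by ring. rewrite h; ring. }
  split; [|split].
  + intros w. destruct (excluded_middle_informative (w = z)) as [->|n]; [ring|]. field; auto.
  + destruct (excluded_middle_informative (z = z)); congruence.
  + intros eps Heps. destruct (H (eps / 2) ltac:(lra)) as (delta & Hd & K).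
    exists delta; split; auto. intros w Hw.
    destruct (excluded_middle_informative (w = z)) as [->|n].
    { replace (d - d)%C with (0 : C) by ring. rewrite Cmod_0; auto. }
    specialize (K w Hw).
    change (Cmod (f w - f z - d * (w - z)) <= eps / 2 * Cmod (w - z)) in K.
    specialize (E w n).
    replace ((f w - f z) / (w - z) - d)%C with ((f w - f z - d * (w - z)) / (w - z))%C by (field; auto).
    rewrite Cmod_div by auto. apply Cmod_gt_0 in E.
    apply Rle_lt_trans with (eps / 2); [|lra].
    apply Rmult_le_reg_r with (Cmod (w - z)); auto.
    unfold Rdiv at 1. rewrite Rmult_assoc, Rinv_l, Rmult_1_r by lra. exact K.
- intros (s & H & Hz & Hs) eps Heps.
  destruct (Hs eps Heps) as (delta & Hd & K). exists delta; split; auto. intros w Hw.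
  change (Cmod (f w - f z - d * (w - z)) <= eps * Cmod (w - z)).
  rewrite (H w). replace (f z + s w * (w - z) - f z - d * (w - z))%C with ((s w - d) * (w - z))%C by ring.
  rewrite Cmod_mult. apply Rmult_le_compat_r; [apply Cmod_ge_0|]. left; apply K; auto.
Qed.

Lemma has_tderiv_slope (y : R -> C) (t : R) (v : C) :
  has_tderiv y t v <->
  exists s : R -> C, (forall r, y r = y t + RtoC (r - t) * s r)%C /\ s t = v /\ tends (nbhdR t) s v.
Proof.
split.
- intros H.
  exists (fun r => if excluded_middle_informative (r = t) then v else ((y r - y t) / RtoC (r - t))%C).
  assert (E : forall r, r <> t -> RtoC (r - t)%R <> 0).
  { intros r Hr h. apply RtoC_inj in h. lra. }
  split; [|split].
  + intros w. destruct (excluded_middle_informative (w = t)) as [->|n].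
    { rewrite Rminus_diag. ring. } field. apply E; auto.
  + destruct (excluded_middle_informative (t = t)); congruence.
  + intros eps Heps. destruct (H (eps / 2) ltac:(lra)) as (delta & Hd & K).
    exists delta; split; auto. intros w Hw.
    destruct (excluded_middle_informative (w = t)) as [->|n].
    { replace (v - v)%C with (0 : C) by ring. rewrite Cmod_0; auto. }
    specialize (K w Hw).
    change (Cmod (y w - y t - RtoC (w - t) * v) <= eps / 2 * Rabs (w - t)) in K.
    specialize (E w n).
    replace ((y w - y t) / RtoC (w - t) - v)%C
      with ((y w - y t - RtoC (w - t) * v) / RtoC (w - t))%C by (field; auto).
    rewrite Cmod_div by auto. apply Cmod_gt_0 in E. rewrite Cmod_R in *.
    apply Rle_lt_trans with (eps / 2); [|lra].
    apply Rmult_le_reg_r with (Rabs (w - t)); auto.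
    unfold Rdiv at 1. rewrite Rmult_assoc, Rinv_l, Rmult_1_r by lra. exact K.
- intros (s & H & Hz & Hs) eps Heps.
  destruct (Hs eps Heps) as (delta & Hd & K). exists delta; split; auto. intros w Hw.
  change (Cmod (y w - y t - RtoC (w - t) * v) <= eps * Rabs (w - t)).
  rewrite (H w). replace (y t + RtoC (w - t) * s w - y t - RtoC (w - t) * v)%C
    with ((s w - v) * RtoC (w - t))%C by ring.
  rewrite Cmod_mult, Cmod_R. apply Rmult_le_compat_r; [apply Rabs_pos|]. left; apply K; auto.
Qed.

Lemma has_cderiv_tends (f : C -> C) (z d : C) : has_cderiv f z d -> tends (nbhdC z) f (f z).
Proof.
intros H. apply has_cderiv_slope in H. destruct H as (s & H & _ & Hs).
apply (tends_ext _ (fun w => f z + s w * (w - z))%C).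
{ apply filter_forall. intro; symmetry; auto. }
apply tends_eq with (f z + d * (z - z))%C; [|ring].
apply tends_plus; [apply _|apply tends_const, _|]. apply tends_mult; [apply _|auto|].
apply tends_minus; [apply _|apply tends_id|apply tends_const, _].
Qed.

Lemma tends_Rid (t : R) : tends (nbhdR t) (fun r => RtoC (r - t)) 0.
Proof.
intros eps Heps. exists eps; split; auto. intros r Hr.
replace (RtoC (r - t) - 0)%C with (RtoC (r - t)) by ring. rewrite Cmod_R; auto.
Qed.

Lemma has_tderiv_tends (y : R -> C) (t : R) (v : C) : has_tderiv y t v -> tends (nbhdR t) y (y t).
Proof.
intros H. apply has_tderiv_slope in H. destruct H as (s & H & _ & Hs).
apply (tends_ext _ (fun r => y t + RtoC (r - t) * s r)%C).
{ apply filter_forall. intro; symmetry; auto. }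
apply tends_eq with (y t + 0 * v)%C; [|ring].
apply tends_plus; [apply _|apply tends_const, _|]. apply tends_mult; [apply _| |auto]. apply tends_Rid.
Qed.

Lemma has_cderiv_const (c z : C) : has_cderiv (fun _ => c) z (RtoC 0).
Proof.
apply has_cderiv_slope. exists (fun _ => 0 : C). split; [intros; ring|].
split; [reflexivity|apply tends_const, _].
Qed.

Lemma has_cderiv_id (z : C) : has_cderiv (fun w => w) z (RtoC 1).
Proof.
apply has_cderiv_slope. exists (fun _ => 1 : C). split; [intros; ring|].
split; [reflexivity|apply tends_const, _].
Qed.

Lemma has_cderiv_plus (f g : C -> C) (z d e : C) :
  has_cderiv f z d -> has_cderiv g z e -> has_cderiv (fun w => f w + g w)%C z (d + e)%C.
Proof.
intros Hf Hg. apply has_cderiv_slope in Hf, Hg. apply has_cderiv_slope.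
destruct Hf as (s & Hs & <- & Ts), Hg as (r & Hr & <- & Tr).
exists (fun w => s w + r w)%C. split; [|split; [reflexivity|apply tends_plus; auto; apply _]].
intros w. rewrite (Hs w), (Hr w). ring.
Qed.

Lemma has_cderiv_mult (f g : C -> C) (z d e : C) :
  has_cderiv f z d -> has_cderiv g z e -> has_cderiv (fun w => f w * g w)%C z (d * g z + f z * e)%C.
Proof.
intros Hf Hg. pose proof (has_cderiv_tends _ _ _ Hg) as Cg.
apply has_cderiv_slope in Hf, Hg. apply has_cderiv_slope.
destruct Hf as (s & Hs & <- & Ts), Hg as (r & Hr & <- & Tr).
exists (fun w => s w * g w + f z * r w)%C. split; [|split; [reflexivity|]].
- intros w. rewrite (Hs w), (Hr w). ring.
- apply tends_plus; [apply _| |]; apply tends_mult; auto; try apply _. apply tends_const, _.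
Qed.

Lemma has_cderiv_ext (f g : C -> C) (z d : C) :
  nbhdC z (fun w => f w = g w) -> has_cderiv f z d -> has_cderiv g z d.
Proof.
intros He H eps Heps. destruct (H eps Heps) as (d1 & H1 & K1).
pose proof (nbhdC_center _ _ He) as Ez.
destruct He as (d2 & H2 & K2). exists (Rmin d1 d2). split; [apply Rmin_glb_lt; auto|].
intros w Hw. pose proof (Rmin_l d1 d2). pose proof (Rmin_r d1 d2).
change (Cmod (w - z) < Rmin d1 d2) in Hw.
rewrite <- Ez, <- K2 by lra. apply K1. change (Cmod (w - z) < d1). lra.
Qed.

Lemma has_cderiv_eq (f : C -> C) (z d d' : C) : has_cderiv f z d -> d = d' -> has_cderiv f z d'.
Proof. intros H <-; exact H. Qed.

Lemma has_cderiv_opp (f : C -> C) (z d : C) :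
  has_cderiv f z d -> has_cderiv (fun w => - f w)%C z (- d)%C.
Proof.
intros Hf. apply has_cderiv_slope in Hf. apply has_cderiv_slope.
destruct Hf as (s & Hs & <- & Ts).
exists (fun w => - s w)%C. split; [|split; [reflexivity|apply tends_opp; auto; apply _]].
intros w. rewrite (Hs w). ring.
Qed.

Lemma has_cderiv_minus (f g : C -> C) (z d e : C) :
  has_cderiv f z d -> has_cderiv g z e -> has_cderiv (fun w => f w - g w)%C z (d - e)%C.
Proof. intros; apply has_cderiv_plus; auto; apply has_cderiv_opp; auto. Qed.

Lemma has_cderiv_inv (f : C -> C) (z d : C) :
  f z <> 0 -> has_cderiv f z d -> has_cderiv (fun w => / f w)%C z (- d * (/ f z * / f z))%C.
Proof.
intros Hz Hf. pose proof (has_cderiv_tends _ _ _ Hf) as Cf.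
destruct (tends_away _ _ _ Hz Cf) as (delta & Hd & K).
pose proof (proj1 (Cmod_gt_0 _) Hz).
(* The slope identity is required at every point, whereas [f] may vanish far from [z]. Outside a
   disc the inverse is therefore replaced by the constant [/ f z], with slope zero. *)
apply (has_cderiv_ext (fun w => if Rlt_dec (Cmod (w - z)) delta then (/ f w)%C else (/ f z)%C)).
{ exists delta; split; auto. intros w Hw. destruct (Rlt_dec (Cmod (w - z)) delta); tauto. }
apply has_cderiv_slope in Hf. apply has_cderiv_slope.
destruct Hf as (s & Hs & <- & Ts).
exists (fun w => if Rlt_dec (Cmod (w - z)) delta then (- s w * (/ f z * / f w))%C else 0 : C).
assert (E0 : Cmod (z - z) = 0). { replace (z - z)%C with (0 : C) by ring. apply Cmod_0. }
split; [|split].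
- intros w. destruct (Rlt_dec (Cmod (z - z)) delta) as [_|n]; [|lra].
  destruct (Rlt_dec (Cmod (w - z)) delta) as [h|n]; [|ring].
  assert (f w <> 0). { apply Cmod_gt_0. specialize (K w h). lra. }
  transitivity (/ f z - (f w - f z) * (/ f z * / f w))%C; [field; auto|].
  rewrite (Hs w) at 1. ring.
- destruct (Rlt_dec (Cmod (z - z)) delta) as [_|n]; [reflexivity|lra].
- apply (tends_ext _ (fun w => - s w * (/ f z * / f w))%C).
  { exists delta; split; auto. intros w Hw. destruct (Rlt_dec (Cmod (w - z)) delta); tauto. }
  apply tends_mult; [apply _|apply tends_opp; auto; apply _|].
  apply tends_mult; [apply _|apply tends_const, _|]. apply tends_inv; auto; apply _.
Qed.

Lemma has_cderiv_comp (f g : C -> C) (z d e : C) :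
  has_cderiv g z e -> has_cderiv f (g z) d -> has_cderiv (fun w => f (g w)) z (d * e)%C.
Proof.
intros Hg Hf. pose proof (has_cderiv_tends _ _ _ Hg) as Cg.
apply has_cderiv_slope in Hf, Hg. apply has_cderiv_slope.
destruct Hf as (s & Hs & <- & Ts), Hg as (r & Hr & <- & Tr).
exists (fun w => s (g w) * r w)%C. split; [|split; [reflexivity|]].
- intros w. assert (E : (g w - g z = r w * (w - z))%C) by (rewrite (Hr w) at 1; ring).
  rewrite (Hs (g w)) at 1. rewrite E. ring.
- apply tends_mult; auto; try apply _. apply (tends_comp _ g s (g z)); auto.
Qed.

Lemma has_cderiv_pow (f : C -> C) (z d : C) (n : nat) :
  has_cderiv f z d -> exists e, has_cderiv (fun w => f w ^ n)%C z e.
Proof.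
intros Hf. induction n as [|n [e IH]].
- exists (RtoC 0). apply (has_cderiv_const (RtoC 1)).
- exists (d * f z ^ n + f z * e)%C. apply (has_cderiv_mult f (fun w => f w ^ n)%C); auto.
Qed.

Lemma has_cderiv_unique (f : C -> C) (z d e : C) :
  has_cderiv f z d -> has_cderiv f z e -> d = e.
Proof.
intros Hf Hg. apply has_cderiv_slope in Hf, Hg.
destruct Hf as (s & Hs & _ & Ts), Hg as (r & Hr & _ & Tr).
apply (tends_unique z s d e (nbhdC_punctured z) r); auto.
intros w Hw. assert ((w - z)%C <> 0).
{ intro h. apply Hw. replace w with (w - z + z)%C by ring. rewrite h; ring. }
pose proof (Hs w) as h1. rewrite (Hr w) in h1.
transitivity ((f z + s w * (w - z) - f z) / (w - z))%C; [field; auto|].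
rewrite <- h1. field; auto.
Qed.

Lemma has_tderiv_comp (f : C -> C) (y : R -> C) (t : R) (d v : C) :
  has_tderiv y t v -> has_cderiv f (y t) d -> has_tderiv (fun r => f (y r)) t (d * v)%C.
Proof.
intros Hy Hf. pose proof (has_tderiv_tends _ _ _ Hy) as Cy.
apply has_cderiv_slope in Hf. apply has_tderiv_slope in Hy. apply has_tderiv_slope.
destruct Hf as (s & Hs & <- & Ts), Hy as (r & Hr & <- & Tr).
exists (fun w => s (y w) * r w)%C. split; [|split; [reflexivity|]].
- intros w. assert (E : (y w - y t = RtoC (w - t) * r w)%C) by (rewrite (Hr w) at 1; ring).
  rewrite (Hs (y w)) at 1. rewrite E. ring.
- apply tends_mult; auto; try apply _. apply (tends_comp _ y s (y t)); auto.
Qed.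

Lemma has_tderiv_eq (y : R -> C) (t : R) (d d' : C) : has_tderiv y t d -> d = d' -> has_tderiv y t d'.
Proof. intros H <-; exact H. Qed.

(** The bridge to real calculus: componentwise, time derivatives become accessible to [auto_derive]
    and to the mean value theorem. *)
Lemma has_tderiv_is_derive (y : R -> C) (t : R) (v : C) :
  has_tderiv y t v <->
  is_derive (fun r => fst (y r)) t (fst v) /\ is_derive (fun r => snd (y r)) t (snd v).
Proof.
split.
- intros H.
  assert (E : forall eps, eps > 0 -> exists delta, delta > 0 /\ forall h, h <> 0 -> Rabs h < delta ->
     Rabs ((fst (y (t + h)) - fst (y t)) / h - fst v) < eps /\
     Rabs ((snd (y (t + h)) - snd (y t)) / h - snd v) < eps).
  { intros eps Heps. destruct (H (eps / 2) ltac:(lra)) as (delta & Hd & K).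
    exists delta; split; auto. intros h Hn Hh.
    assert (h1 : Rabs (t + h - t) < delta) by (replace (t + h - t) with h by ring; auto).
    specialize (K (t + h) h1). replace (t + h - t) with h in K by ring.
    change (Cmod (y (t + h)%R - y t - RtoC h * v) <= eps / 2 * Rabs h) in K.
    assert (0 < Rabs h) by (apply Rabs_pos_lt; auto).
    pose proof (re_le_Cmod (y (t + h)%R - y t - RtoC h * v)) as h2.
    pose proof (im_le_Cmod (y (t + h)%R - y t - RtoC h * v)) as h3.
    simpl in h2, h3.
    split; apply Rle_lt_trans with (eps / 2); try lra; apply Rmult_le_reg_r with (Rabs h); auto;
      rewrite <- Rabs_mult.
    - replace (((fst (y (t + h)) - fst (y t)) / h - fst v) * h)
       with (fst (y (t + h)%R) + - fst (y t) + - (h * fst v - 0 * snd v)) by (field; auto).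
      eapply Rle_trans; [exact h2|exact K].
    - replace (((snd (y (t + h)) - snd (y t)) / h - snd v) * h)
       with (snd (y (t + h)%R) + - snd (y t) + - (h * snd v + 0 * fst v)) by (field; auto).
      eapply Rle_trans; [exact h3|exact K]. }
  split; apply is_derive_Reals; intros eps Heps; destruct (E eps Heps) as (delta & Hd & K);
    exists (mkposreal delta Hd); intros h H1 H2; apply K; auto.
- intros [H1 H2]. apply is_derive_Reals in H1, H2. intros eps Heps.
  destruct (H1 (eps / 2) ltac:(lra)) as [d1 K1]. destruct (H2 (eps / 2) ltac:(lra)) as [d2 K2].
  exists (Rmin d1 d2). split; [apply Rmin_glb_lt; apply cond_pos|].
  intros r Hr. pose proof (Rmin_l d1 d2). pose proof (Rmin_r d1 d2).
  change (Cmod (y r - y t - RtoC (r - t) * v) <= eps * Rabs (r - t)).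
  destruct (Req_dec r t) as [->|n].
  { rewrite Rminus_diag, Rabs_R0. replace (y t - y t - 0 * v)%C with (0 : C) by ring. rewrite Cmod_0; lra. }
  assert (n' : r - t <> 0) by lra.
  specialize (K1 (r - t) n' ltac:(lra)). specialize (K2 (r - t) n' ltac:(lra)).
  replace (t + (r - t)) with r in K1, K2 by ring.
  assert (0 < Rabs (r - t)) by (apply Rabs_pos_lt; auto).
  apply Rmult_lt_compat_r with (r := Rabs (r - t)) in K1, K2; auto. rewrite <- Rabs_mult in K1, K2.
  replace (((fst (y r) - fst (y t)) / (r - t) - fst v) * (r - t))
    with (fst (y r) + - fst (y t) + - ((r - t) * fst v - 0 * snd v)) in K1 by (field; auto).
  replace (((snd (y r) - snd (y t)) / (r - t) - snd v) * (r - t))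
    with (snd (y r) + - snd (y t) + - ((r - t) * snd v + 0 * fst v)) in K2 by (field; auto).
  set (z := (y r - y t - RtoC (r - t) * v)%C).
  replace z with (RtoC (fst z) + Ci * RtoC (snd z))%C.
  2:{ destruct z as [z1 z2]. unfold RtoC, Ci, Cplus, Cmult; simpl. f_equal; ring. }
  eapply Rle_trans; [apply Cmod_triangle|]. rewrite Cmod_mult, Cmod_Ci, !Cmod_R. simpl. lra.
Qed.

(** * Mean value property and maximum principle *)

Definition polar (r theta : R) : C := (r * cos theta, r * sin theta).

Lemma Cmod_le_sum (z : C) : Cmod z <= Rabs (fst z) + Rabs (snd z).
Proof.
replace z with (RtoC (fst z) + Ci * RtoC (snd z))%C at 1.
2:{ destruct z as [z1 z2]. unfold RtoC, Ci, Cplus, Cmult; simpl. f_equal; ring. }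
eapply Rle_trans; [apply Cmod_triangle|]. rewrite Cmod_mult, Cmod_Ci, !Cmod_R. lra.
Qed.

Lemma Cmod_polar (r theta : R) : 0 <= r -> Cmod (polar r theta) = r.
Proof.
intros Hr. unfold Cmod, polar; simpl.
replace (r * cos theta * (r * cos theta * 1) + r * sin theta * (r * sin theta * 1))
  with (r * r * (Rsqr (sin theta) + Rsqr (cos theta))) by (unfold Rsqr; ring).
rewrite sin2_cos2, Rmult_1_r. apply sqrt_square; auto.
Qed.

Definition cexp (w : C) : C := polar (exp (fst w)) (snd w).

Lemma cexp_plus (w v : C) : cexp (w + v) = (cexp w * cexp v)%C.
Proof.
unfold cexp, polar, Cplus, Cmult; simpl. rewrite exp_plus, cos_plus, sin_plus. f_equal; ring.
Qed.

Lemma linear_approx (f : R -> R) (d : R) : derivable_pt_lim f 0 d ->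
  forall eps, eps > 0 -> exists delta, delta > 0 /\
    forall h, Rabs h < delta -> Rabs (f h - f 0 - d * h) <= eps * Rabs h.
Proof.
intros H eps Heps. destruct (H eps Heps) as [delta K]. exists delta; split; [apply cond_pos|].
intros h Hh. destruct (Req_dec h 0) as [->|n].
{ rewrite Rabs_R0. replace (f 0 - f 0 - d * 0) with 0 by ring. rewrite Rabs_R0; lra. }
specialize (K h n Hh). rewrite Rplus_0_l in K.
assert (0 < Rabs h) by (apply Rabs_pos_lt; auto).
apply Rmult_lt_compat_r with (r := Rabs h) in K; auto. rewrite <- Rabs_mult in K.
replace (((f h - f 0) / h - d) * h) with (f h - f 0 - d * h) in K by (field; auto). lra.
Qed.

Lemma has_cderiv_cexp (w : C) : has_cderiv cexp w (cexp w).
Proof.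
assert (H0 : has_cderiv cexp (RtoC 0) (RtoC 1)).
{ intros eps Heps.
  (* The errors below add up to at most [7 * e * m], hence the eighth of [eps]; the bound 1/8 keeps
     [exp a] below 2. *)
  set (e := Rmin (eps / 8) (1 / 8)).
  assert (He : e > 0) by (unfold e; apply Rmin_glb_lt; lra).
  assert (e <= eps / 8) by apply Rmin_l. assert (e <= 1 / 8) by apply Rmin_r. clearbody e.
  destruct (linear_approx exp 1) with (eps := e) as (d1 & D1 & K1); auto.
  { rewrite <- exp_0. apply derivable_pt_lim_exp. }
  destruct (linear_approx cos 0) with (eps := e) as (d2 & D2 & K2); auto.
  { pose proof (derivable_pt_lim_cos 0) as h. rewrite sin_0, Ropp_0 in h. exact h. }
  destruct (linear_approx sin 1) with (eps := e) as (d3 & D3 & K3); auto.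
  { rewrite <- cos_0. apply derivable_pt_lim_sin. }
  exists (Rmin (Rmin d1 d2) (Rmin d3 e)). split.
  { repeat apply Rmin_glb_lt; auto. }
  intros h Hh. change C in h.
  change (Cmod (h - 0) < Rmin (Rmin d1 d2) (Rmin d3 e)) in Hh.
  change (Cmod (cexp h - cexp 0 - RtoC 1 * (h - 0)) <= eps * Cmod (h - 0)).
  replace (h - 0)%C with h in * by ring.
  pose proof (Rmin_l (Rmin d1 d2) (Rmin d3 e)). pose proof (Rmin_r (Rmin d1 d2) (Rmin d3 e)).
  pose proof (Rmin_l d1 d2). pose proof (Rmin_r d1 d2).
  pose proof (Rmin_l d3 e). pose proof (Rmin_r d3 e).
  destruct h as [a b].
  pose proof (re_le_Cmod (a, b)) as Ha. pose proof (im_le_Cmod (a, b)) as Hb. simpl in Ha, Hb.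
  assert (Aa : Rabs a < Rmin (Rmin d1 d2) (Rmin d3 e)) by (eapply Rle_lt_trans; eauto).
  specialize (K1 a ltac:(lra)). specialize (K2 b ltac:(lra)). specialize (K3 b ltac:(lra)).
  rewrite exp_0 in K1. rewrite cos_0 in K2. rewrite sin_0 in K3.
  set (m := Cmod (a, b)) in *.
  assert (Hm : 0 <= m) by apply Cmod_ge_0.
  pose proof (Rabs_pos a). pose proof (Rabs_pos b).
  assert (E1 : Rabs (exp a - 1) <= 2 * Rabs a).
  { replace (exp a - 1) with ((exp a - 1 - 1 * a) + a) by ring.
    eapply Rle_trans; [apply Rabs_triang|]. nra. }
  assert (E2 : Rabs (exp a) <= 2).
  { replace (exp a) with ((exp a - 1) + 1) by ring.
    eapply Rle_trans; [apply Rabs_triang|]. rewrite Rabs_R1. lra. }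
  pose proof (Rabs_pos (exp a)).
  assert (e * Rabs a <= e * m) by (apply Rmult_le_compat_l; lra).
  assert (e * Rabs b <= e * m) by (apply Rmult_le_compat_l; lra).
  eapply Rle_trans; [apply Cmod_le_sum|]. unfold cexp, polar; simpl. rewrite exp_0, cos_0, sin_0.
  replace (exp a * cos b + - (1 * 1) + - (1 * (a) - 0 * b))
    with ((exp a - 1 - 1 * a) + exp a * (cos b - 1 - 0 * b)) by ring.
  replace (exp a * sin b + - (1 * 0) + - (1 * b + 0 * a))
    with (exp a * (sin b - 0 - 1 * b) + (exp a - 1) * b) by ring.
  pose proof (Rabs_triang (exp a - 1 - 1 * a) (exp a * (cos b - 1 - 0 * b))) as T1.
  pose proof (Rabs_triang (exp a * (sin b - 0 - 1 * b)) ((exp a - 1) * b)) as T2.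
  rewrite Rabs_mult in T1. rewrite !Rabs_mult in T2.
  assert (P1 : Rabs (exp a) * Rabs (cos b - 1 - 0 * b) <= 2 * (e * m)).
  { apply Rmult_le_compat; try lra; apply Rabs_pos. }
  assert (P2 : Rabs (exp a) * Rabs (sin b - 0 - 1 * b) <= 2 * (e * m)).
  { apply Rmult_le_compat; try lra; apply Rabs_pos. }
  assert (P3 : Rabs (exp a - 1) * Rabs b <= (2 * e) * m).
  { apply Rmult_le_compat; try lra; apply Rabs_pos. }
  assert (e * m <= eps / 8 * m) by (apply Rmult_le_compat_r; lra).
  assert (0 <= eps * m) by (apply Rmult_le_pos; lra).
  lra. }
apply (has_cderiv_ext (fun v => cexp w * cexp (v - w))%C).
{ apply filter_forall. intros v. rewrite <- cexp_plus. f_equal. ring. }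
apply has_cderiv_eq with (0 * cexp (w - w) + cexp w * (1 * (1 - 0)))%C; [|ring].
apply (has_cderiv_mult (fun _ => cexp w) (fun v => cexp (v - w)%C)); [apply has_cderiv_const|].
apply (has_cderiv_comp cexp (fun v => v - w)%C).
{ apply has_cderiv_minus; [apply has_cderiv_id|apply has_cderiv_const]. }
replace (w - w)%C with (RtoC 0) by ring. exact H0.
Qed.

(** The form is the imaginary part of G dz. Its closedness is a Cauchy-Riemann equation: both mixed
    partial derivatives equal [fst D]. *)
Lemma closed_form_of_has_cderiv (G : C -> C) (x0 y0 : R) (D : C) :
  has_cderiv G (x0, y0) D ->
  closed_form_at (fun x y => snd (G (x, y))) (fun x y => fst (G (x, y))) x0 y0.
Proof.
intros H. exists (snd D), (fst D), (- snd D). intros eps Heps.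
destruct (H eps Heps) as (delta & Hd & K). exists (delta / 2); split; [lra|].
intros x y Hx Hy.
assert (Hm : Cmod ((x, y) - (x0, y0)) <= Rabs (x - x0) + Rabs (y - y0)).
{ apply (Cmod_le_sum ((x, y) - (x0, y0))). }
specialize (K (x, y)).
change (Cmod ((x, y) - (x0, y0)) < delta ->
  Cmod (G (x, y) - G (x0, y0) - D * ((x, y) - (x0, y0))) <= eps * Cmod ((x, y) - (x0, y0))) in K.
specialize (K ltac:(lra)).
assert (K' : Cmod (G (x, y) - G (x0, y0) - D * ((x, y) - (x0, y0)))
   <= eps * (Rabs (x - x0) + Rabs (y - y0))).
{ eapply Rle_trans; [exact K|]. apply Rmult_le_compat_l; lra. }
split; eapply Rle_trans; [|exact K'| |exact K'].
- eapply Rle_trans; [|apply im_le_Cmod]. right; f_equal. simpl. ring.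
- eapply Rle_trans; [|apply re_le_Cmod]. right; f_equal. unfold Re; simpl. ring.
Qed.

Lemma tends_continuity_pt (f : R -> C) (t : R) :
  tends (nbhdR t) f (f t) -> continuity_pt (fun r => Cmod (f r)) t /\ continuity_pt (fun r => fst (f r)) t.
Proof.
intros H. split; intros eps Heps; destruct (H eps Heps) as (delta & Hd & K); exists delta;
  (split; [auto|]); intros x [_ Hx]; specialize (K x Hx); simpl; unfold Rdist.
- eapply Rle_lt_trans; [|exact K]. apply Rabs_le.
  pose proof (Cmod_triangle_rev (f x) (f t)). pose proof (Cmod_triangle_rev (f t) (f x)).
  rewrite (Cmod_minus_sym (f t)) in H1. lra.
- eapply Rle_lt_trans; [|exact K]. apply (re_le_Cmod (f x - f t)).
Qed.

Lemma tends_polar (z0 : C) (r t : R) : tends (nbhdR t) (fun s => z0 + polar r s)%C (z0 + polar r t)%C.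
Proof.
apply has_tderiv_tends with (v := (- (r * sin t), r * cos t) : C).
apply has_tderiv_is_derive. simpl. split; auto_derive; auto; ring.
Qed.

(** In the coordinate [z0 + cexp w] an annulus becomes a rectangle of height [2 * PI]. Goursat's
    theorem there says that the circle integral does not depend on the radius, and the radius can
    then shrink to zero. *)
Theorem mean_value_property (f : C -> C) (z0 : C) (R0 r : R) :
  0 < r < R0 -> (forall z, Cmod (z - z0) < R0 -> exists d, has_cderiv f z d) ->
  RInt (fun t => fst (f (z0 + polar r t)%C)) 0 (2 * PI) = 2 * PI * fst (f z0).
Proof.
intros Hr Hf.
assert (HPI : 0 < 2 * PI) by (pose proof PI_RGT_0; lra).
set (I := fun s => RInt (fun t => fst (f (z0 + polar s t)%C)) 0 (2 * PI)).
assert (Hcirc : forall s t, 0 <= s -> s < R0 -> Cmod (z0 + polar s t - z0) < R0).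
{ intros s t H1 H2. replace (z0 + polar s t - z0)%C with (polar s t) by ring. rewrite Cmod_polar; auto. }
assert (Hint : forall s, 0 <= s -> s < R0 ->
   ex_RInt (fun t => fst (f (z0 + polar s t)%C)) 0 (2 * PI)).
{ intros s H1 H2. apply (ex_RInt_continuous (V := R_CompleteNormedModule)).
  intros t _. apply continuity_pt_filterlim.
  apply (tends_continuity_pt (fun t => f (z0 + polar s t)%C)).
  destruct (Hf (z0 + polar s t)%C (Hcirc s t H1 H2)) as [d Hd].
  apply (tends_comp _ _ f (z0 + polar s t)%C); [apply tends_polar|].
  apply has_cderiv_tends with d; auto. }
assert (Hconst : forall s, 0 < s < r -> I s = I r).
{ intros s Hs. unfold I.
  set (G := fun w => f (z0 + cexp w)%C).
  pose proof (goursat_rectangle (fun x y => snd (G (x, y))) (fun x y => fst (G (x, y)))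
    (ln s) (ln r) 0 (2 * PI) ltac:(apply ln_increasing; lra) HPI) as HG.
  unfold boundary_integral in HG.
  (* The two horizontal sides cancel by periodicity of [cexp]. *)
  rewrite (RInt_ext (fun x => snd (G (x, 0)) - snd (G (x, 2 * PI))) (fun _ => 0)) in HG.
  2:{ intros x _. unfold G, cexp, polar; simpl. rewrite cos_0, sin_0, cos_2PI, sin_2PI. ring. }
  rewrite RInt_const in HG.
  rewrite (RInt_ext _ (fun t => fst (f (z0 + polar r t)%C) - fst (f (z0 + polar s t)%C))) in HG.
  2:{ intros t _. unfold G, cexp; simpl. rewrite !exp_ln by lra. reflexivity. }
  rewrite (RInt_minus (V := R_CompleteNormedModule)) in HG by (apply Hint; lra).
  unfold minus, plus, opp, scal in HG; simpl in HG. unfold mult in HG; simpl in HG.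
  cut (RInt (fun t => fst (f (z0 + polar r t)%C)) 0 (2 * PI)
     - RInt (fun t => fst (f (z0 + polar s t)%C)) 0 (2 * PI) = 0); [lra|].
  rewrite Rmult_0_r, Rplus_0_l in HG. apply HG.
  intros x y Hx _.
  destruct (Hf (z0 + cexp (x, y))%C) as [d Hd].
  { apply Hcirc; simpl. left; apply exp_pos. apply Rle_lt_trans with (exp (ln r)); [|rewrite exp_ln; lra].
    destruct (proj2 Hx) as [h| ->]; [left; apply exp_increasing; auto|lra]. }
  apply (closed_form_of_has_cderiv G x y (d * (0 + cexp (x, y)))%C).
  apply (has_cderiv_comp f (fun w => z0 + cexp w)%C); auto.
  apply has_cderiv_plus; [apply has_cderiv_const|apply has_cderiv_cexp]. }
apply Rminus_diag_uniq. apply Rabs_eq_0. apply Rle_antisym; [|apply Rabs_pos].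
apply le_epsilon. intros eps Heps. rewrite Rplus_0_l.
destruct (Hf z0) as [d Hd].
{ replace (z0 - z0)%C with (0 : C) by ring. rewrite Cmod_0; lra. }
apply has_cderiv_tends in Hd.
set (e := eps / (2 * PI)).
assert (He : e > 0) by (apply Rdiv_lt_0_compat; lra).
destruct (Hd e He) as (delta & Hdelta & K).
set (s := Rmin (r / 2) (delta / 2)).
assert (Hs : 0 < s) by (apply Rmin_glb_lt; lra).
assert (s <= r / 2) by apply Rmin_l. assert (s <= delta / 2) by apply Rmin_r.
fold (I r). rewrite <- (Hconst s) by lra.
replace eps with (e * (2 * PI - 0)) by (unfold e; field; lra).
replace (2 * PI * fst (f z0)) with (fst (f z0) * (2 * PI - 0)) by ring.
apply RInt_near_const; [lra|apply Hint; lra|].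
intros t _. left. eapply Rle_lt_trans; [|apply (K (z0 + polar s t)%C)].
- apply (re_le_Cmod (f (z0 + polar s t)%C - f z0)).
- replace (z0 + polar s t - z0)%C with (polar s t) by ring. rewrite Cmod_polar; lra.
Qed.

(** The mean value property controls real parts only. Multiplication by the conjugate of [f z0]
    makes the real part at the centre equal to the square of [Cmod (f z0)], while on the circle it
    is at most [Cmod (f z0) * M]. *)
Theorem maximum_at_center (f : C -> C) (z0 : C) (R0 r M : R) :
  0 < r < R0 -> (forall z, Cmod (z - z0) < R0 -> exists d, has_cderiv f z d) ->
  (forall t, 0 <= t <= 2 * PI -> Cmod (f (z0 + polar r t)%C) <= M) -> Cmod (f z0) <= M.
Proof.
intros Hr Hf HM.
assert (HPI : 0 < 2 * PI) by (pose proof PI_RGT_0; lra).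
assert (HM0 : 0 <= M) by (eapply Rle_trans; [apply Cmod_ge_0|apply (HM 0); lra]).
destruct (Req_dec (Cmod (f z0)) 0) as [->|n]; auto.
pose proof (Cmod_ge_0 (f z0)).
set (c := Cconj (f z0)). set (g := fun z => (c * f z)%C).
assert (Hg : forall z, Cmod (z - z0) < R0 -> exists d, has_cderiv g z d).
{ intros z Hz. destruct (Hf z Hz) as [d Hd]. eexists.
  apply has_cderiv_mult; [apply has_cderiv_const|exact Hd]. }
pose proof (mean_value_property g z0 R0 r Hr Hg) as HI.
assert (E : fst (g z0) = Cmod (f z0) ^ 2).
{ rewrite Cmod2_alt. unfold g, c, Cconj, Cmult; simpl. unfold Re, Im. ring. }
rewrite E in HI.
assert (HL : RInt (fun t => fst (g (z0 + polar r t)%C)) 0 (2 * PI) <= RInt (fun _ => Cmod (f z0) * M) 0 (2 * PI)).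
{ apply RInt_le; [lra| |apply ex_RInt_const|].
  - apply (ex_RInt_continuous (V := R_CompleteNormedModule)).
    intros t _. apply continuity_pt_filterlim.
    apply (tends_continuity_pt (fun t => g (z0 + polar r t)%C)).
    destruct (Hg (z0 + polar r t)%C) as [d Hd].
    { replace (z0 + polar r t - z0)%C with (polar r t) by ring. rewrite Cmod_polar; lra. }
    apply (tends_comp _ _ g (z0 + polar r t)%C); [apply tends_polar|].
    apply has_cderiv_tends with d; auto.
  - intros t Ht. eapply Rle_trans; [apply Rle_abs|]. eapply Rle_trans; [apply re_le_Cmod|].
    unfold g. rewrite Cmod_mult. unfold c. rewrite Cmod_conj. apply Rmult_le_compat_l; auto. apply HM; lra. }
rewrite HI, RInt_const in HL. unfold scal in HL; simpl in HL. unfold mult in HL; simpl in HL.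
apply Rmult_le_reg_l with (2 * PI * Cmod (f z0)); [apply Rmult_lt_0_compat; lra|]. lra.
Qed.

Lemma circle_lower_bound (f : C -> C) (z0 : C) (r : R) :
  (forall t, tends (nbhdC (z0 + polar r t)) f (f (z0 + polar r t)%C)) ->
  (forall t, f (z0 + polar r t)%C <> 0) ->
  exists m, 0 < m /\ forall t, 0 <= t <= 2 * PI -> m <= Cmod (f (z0 + polar r t)%C).
Proof.
intros Hc Hn.
destruct (continuity_ab_min (fun t => Cmod (f (z0 + polar r t)%C)) 0 (2 * PI)) as [t0 [Ht0 _]].
{ pose proof PI_RGT_0; lra. }
{ intros t _. apply (tends_continuity_pt (fun t => f (z0 + polar r t)%C)).
  apply (tends_comp _ _ f (z0 + polar r t)%C); [apply tends_polar|apply Hc]. }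
exists (Cmod (f (z0 + polar r t0)%C)). split; auto.
apply Cmod_gt_0, Hn.
Qed.

(** * Injective holomorphic maps *)

Lemma has_cderiv_of_slope (f s : C -> C) (z d : C) :
  nbhdC z (fun w => f w = f z + s w * (w - z))%C -> tends (nbhdC z) s d -> has_cderiv f z d.
Proof.
intros He Hs eps Heps.
destruct (filter_and _ _ He (Hs eps Heps)) as (delta & Hd & K). exists delta; split; auto.
intros w Hw. destruct (K w Hw) as [E h].
change (Cmod (f w - f z - d * (w - z)) <= eps * Cmod (w - z)).
rewrite E. replace (f z + s w * (w - z) - f z - d * (w - z))%C with ((s w - d) * (w - z))%C by ring.
rewrite Cmod_mult. apply Rmult_le_compat_r; [apply Cmod_ge_0|]. left; auto.
Qed.

Lemma Cminus_neq_0 (z w : C) : z <> w -> (z - w)%C <> 0.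
Proof. intros H h. apply H. replace z with (z - w + w)%C by ring. rewrite h; ring. Qed.

Lemma nbhdC_ball (z0 z : C) (r : R) : Cmod (z - z0) < r -> nbhdC z (fun w => Cmod (w - z0) < r).
Proof.
intros H. exists (r - Cmod (z - z0)); split; [lra|]. intros w Hw.
replace (w - z0)%C with ((w - z) + (z - z0))%C by ring.
eapply Rle_lt_trans; [apply Cmod_triangle|]. lra.
Qed.

Lemma nbhdC_neq (z a : C) : z <> a -> nbhdC z (fun w => w <> a).
Proof.
intros H. apply Cminus_neq_0, Cmod_gt_0 in H. exists (Cmod (z - a)); split; auto.
intros w Hw ->. rewrite Cmod_minus_sym in Hw. lra.
Qed.

Lemma tends_pow {T : Type} (F : (T -> Prop) -> Prop) {FF : Filter F} (f : T -> C) (l : C) (n : nat) :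
  tends F f l -> tends F (fun x => f x ^ n)%C (l ^ n)%C.
Proof.
intros H. induction n as [|n IH].
- exact (tends_const F (RtoC 1)).
- apply (tends_mult F f (fun x => f x ^ n)%C); auto.
Qed.

(** Taking n-th roots makes [c] and [B] disappear; the argument runs through Bernoulli's inequality
    [poly]. This removes the auxiliary factor introduced at a removable singularity. *)
Lemma root_of_power_bounds (x K c B : R) :
  0 < K -> 0 < c -> (forall n, x ^ n * c <= K ^ n * B) -> x <= K.
Proof.
intros HK Hc H. destruct (Rle_lt_dec x K) as [h|h]; auto. exfalso.
set (h0 := x / K - 1).
assert (Hx : x = K * (1 + h0)) by (unfold h0; field; lra).
assert (Hh : 0 < h0) by nra.
assert (HN : exists n : nat, B / c < INR n * h0).
{ destruct (INR_unbounded ((B / c) / h0)) as [n Hn]. exists n.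
  apply Rmult_lt_reg_r with (/ h0); [apply Rinv_0_lt_compat; auto|].
  replace (INR n * h0 * / h0) with (INR n) by (field; lra). exact Hn. }
destruct HN as [n Hn]. specialize (H n).
rewrite Hx, Rpow_mult_distr in H.
assert (HKn : 0 < K ^ n) by (apply pow_lt; auto).
assert ((1 + h0) ^ n * c <= B).
{ apply Rmult_le_reg_l with (K ^ n); auto. lra. }
pose proof (poly n h0 Hh).
assert (B < INR n * h0 * c).
{ apply Rmult_lt_reg_r with (/ c); [apply Rinv_0_lt_compat; auto|].
  replace (INR n * h0 * c * / c) with (INR n * h0) by (field; lra). exact Hn. }
assert ((1 + INR n * h0) * c <= (1 + h0) ^ n * c) by (apply Rmult_le_compat_r; lra).
lra.
Qed.

Lemma constant_of_zero_cderiv (f : C -> C) (z0 w : C) (r : R) :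
  (forall z, Cmod (z - z0) < r -> has_cderiv f z (RtoC 0)) -> Cmod (w - z0) < r -> f w = f z0.
Proof.
intros H Hw.
set (p := fun t : R => (z0 + RtoC t * (w - z0))%C).
assert (Hp : forall t, has_tderiv p t (w - z0)%C).
{ intros t. apply has_tderiv_is_derive. destruct z0 as [a b], w as [c d]. unfold p; simpl.
  split; auto_derive; auto; ring. }
assert (Hd : forall t, 0 <= t <= 1 -> has_tderiv (fun t => f (p t)) t (RtoC 0)).
{ intros t Ht. apply has_tderiv_eq with (RtoC 0 * (w - z0))%C; [|ring].
  apply has_tderiv_comp; auto. apply H. unfold p.
  replace (z0 + t * (w - z0) - z0)%C with (RtoC t * (w - z0))%C by ring.
  rewrite Cmod_mult, Cmod_R, Rabs_pos_eq by lra. pose proof (Cmod_ge_0 (w - z0)). nra. }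
assert (E0 : p 0 = z0) by (unfold p; ring). assert (E1 : p 1 = w) by (unfold p; ring).
assert (K : forall g : R -> R, (forall t, 0 <= t <= 1 -> is_derive g t 0) -> g 1 = g 0).
{ intros g Hg. destruct (MVT_gen g 0 1 (fun _ => 0)) as (c & _ & E).
  - rewrite Rmin_left, Rmax_right by lra. intros; apply Hg; lra.
  - rewrite Rmin_left, Rmax_right by lra. intros x Hx. apply continuity_pt_filterlim.
    apply (ex_derive_continuous (V := R_NormedModule)). eexists; apply Hg; lra.
  - lra. }
rewrite <- E1, <- E0 at 1.
assert (K1 := K (fun t => fst (f (p t)))). assert (K2 := K (fun t => snd (f (p t)))).
simpl in K1, K2. rewrite E1, E0 in *.
apply injective_projections; [apply K1|apply K2]; intros t Ht;
  apply (proj1 (has_tderiv_is_derive _ _ _) (Hd t Ht)).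
Qed.

(* Hurwitz' argument: for nearby [a] with [df a <> 0] the function
   [(w - a) / (f w - f a)] is bounded on a circle around [a0], hence at [a0],
   which prevents [df a0 = 0]. The factor [w - a] next to the n-th power makes the
   removable singularity at [a] harmless. *)
Lemma injective_cderiv_neq_0 (f df : C -> C) (a0 : C) (R0 : R) :
  0 < R0 ->
  (forall z, Cmod (z - a0) < R0 -> has_cderiv f z (df z)) ->
  (forall z w, Cmod (z - a0) < R0 -> Cmod (w - a0) < R0 -> f z = f w -> z = w) ->
  df a0 <> 0.
Proof.
intros HR Hf Hinj H0.
assert (Z0 : Cmod (a0 - a0) = 0). { replace (a0 - a0)%C with (0 : C) by ring. apply Cmod_0. }
set (r := R0 / 2).
assert (Hpol : forall t, Cmod (a0 + polar r t - a0) = r).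
{ intros t. replace (a0 + polar r t - a0)%C with (polar r t) by ring. apply Cmod_polar. unfold r; lra. }
destruct (circle_lower_bound (fun z => f z - f a0)%C a0 r) as (m & Hm & Hlow).
{ intros t. apply tends_minus; [apply _| |apply tends_const, _].
  apply has_cderiv_tends with (df (a0 + polar r t)%C), Hf. rewrite Hpol; unfold r; lra. }
{ intros t. apply Cminus_neq_0. intro h. apply Hinj in h.
  - specialize (Hpol t). rewrite h, Z0 in Hpol. unfold r in Hpol; lra.
  - rewrite Hpol; unfold r; lra.
  - rewrite Z0; auto. }
assert (Hkey : forall a, a <> a0 -> Cmod (a - a0) < r / 2 -> Cmod (f a - f a0) < m / 2 -> df a <> 0 ->
   Cmod (a0 - a) <= 3 * r / m * Cmod (f a0 - f a)).
{ intros a Hne Ha Hfa Hda.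
  assert (Hr : 0 < r) by (unfold r; lra).
  assert (Ha' : Cmod (a - a0) < R0) by (unfold r in *; lra).
  (* The hypothesis [df a <> 0] makes the value at [a] the limit of the quotient, so [g] is
     continuous at [a]; this is all that the slope [g w ^ n] requires. *)
  set (g := fun w => if excluded_middle_informative (w = a) then (/ df a)%C else ((w - a) / (f w - f a))%C).
  assert (Hga : g a = (/ df a)%C) by (unfold g; destruct (excluded_middle_informative (a = a)); congruence).
  assert (Hgw : forall w, w <> a -> g w = ((w - a) / (f w - f a))%C).
  { intros w Hw. unfold g. destruct (excluded_middle_informative (w = a)); congruence. }
  assert (Hfw : forall w, Cmod (w - a0) < R0 -> w <> a -> (f w - f a)%C <> 0).
  { intros w Hw Hn. apply Cminus_neq_0. intro h. apply Hn, Hinj; auto. }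
  assert (Tg : tends (nbhdC a) g (/ df a)%C).
  { pose proof (Hf a Ha') as D. apply has_cderiv_slope in D. destruct D as (s & Hs & Es & Ts).
    apply (tends_ext _ (fun w => / s w)%C); [|apply tends_inv; auto; apply _].
    generalize (nbhdC_ball _ _ _ Ha'). apply filter_imp. intros w Hw.
    unfold g. destruct (excluded_middle_informative (w = a)) as [->|n]; [congruence|].
    pose proof (Hfw w Hw n) as E. pose proof (Cminus_neq_0 _ _ n).
    assert (E' : (f w - f a = s w * (w - a))%C) by (rewrite (Hs w) at 1; ring).
    assert (s w <> 0). { intro h. apply E. rewrite E', h. ring. }
    rewrite E'. field; auto. }
  assert (Dg : forall n w, Cmod (w - a0) < R0 -> exists d, has_cderiv (fun w => g w ^ n * (w - a))%C w d).
  { intros n w Hw. destruct (excluded_middle_informative (w = a)) as [->|Hn].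
    - exists ((/ df a) ^ n)%C.
      apply (has_cderiv_of_slope _ (fun w => g w ^ n)%C); [|apply tends_pow; auto; apply _].
      apply filter_forall. intros w. ring.
    - assert (D1 : has_cderiv (fun v => v - a)%C w (1 - 0)%C).
      { apply has_cderiv_minus; [apply has_cderiv_id|apply has_cderiv_const]. }
      assert (D2 : has_cderiv (fun v => f v - f a)%C w (df w - 0)%C).
      { apply has_cderiv_minus; [apply Hf; auto|apply has_cderiv_const]. }
      assert (D3 := has_cderiv_inv (fun v => f v - f a)%C _ _ (Hfw w Hw Hn) D2).
      assert (D4 := has_cderiv_mult (fun v => v - a)%C (fun v => / (f v - f a))%C _ _ _ D1 D3).
      assert (D5 : has_cderiv g w ((1 - 0) * / (f w - f a) +
         (w - a) * (- (df w - 0) * (/ (f w - f a) * / (f w - f a))))%C).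
      { apply (has_cderiv_ext (fun v => (v - a) * / (f v - f a))%C); auto.
        generalize (nbhdC_neq _ _ Hn). apply filter_imp. intros v Hv. symmetry. apply Hgw; auto. }
      destruct (has_cderiv_pow g _ _ n D5) as [e De].
      eexists. apply (has_cderiv_mult (fun v => g v ^ n)%C); eauto. }
  rewrite Cmod_minus_sym, (Cmod_minus_sym (f a0)).
  assert (Hpos : 0 < Cmod (f a - f a0)).
  { rewrite Cmod_minus_sym. apply Cmod_gt_0, Hfw; auto. rewrite Z0; auto. }
  (* On the circle the numerator of [g] is at most [3 * r / 2] and its denominator at least
     [m / 2]. *)
  assert (HK : Cmod (g a0) <= 3 * r / m).
  { assert (Ca : 0 < Cmod (a0 - a)) by (apply Cmod_gt_0, Cminus_neq_0; auto).
    apply root_of_power_bounds with (c := Cmod (a0 - a)) (B := 2 * r); auto.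
    { apply Rdiv_lt_0_compat; lra. }
    intros n. rewrite <- Cmod_pow, <- Cmod_mult.
    apply (maximum_at_center (fun w => g w ^ n * (w - a))%C a0 R0 r); [unfold r; lra|apply Dg|].
    intros t Ht. set (w := (a0 + polar r t)%C).
    assert (Ew : Cmod (w - a0) = r) by apply Hpol.
    assert (Hwa : w <> a) by (intro h; rewrite h in Ew; lra).
    assert (B1 : Cmod (w - a) <= 3 * r / 2).
    { replace (w - a)%C with ((w - a0) - (a - a0))%C by ring.
      eapply Rle_trans; [apply Cmod_triangle|]. rewrite Cmod_opp. lra. }
    assert (B2 : m / 2 <= Cmod (f w - f a)).
    { replace (f w - f a)%C with ((f w - f a0) - (f a - f a0))%C by ring.
      pose proof (Cmod_triangle_rev (f w - f a0) (f a - f a0)).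
      specialize (Hlow t Ht). fold w in Hlow. lra. }
    assert (Hw : Cmod (w - a0) < R0) by (unfold r in *; lra).
    rewrite Cmod_mult, Cmod_pow. apply Rmult_le_compat; try lra.
    - apply pow_le, Cmod_ge_0.
    - apply Cmod_ge_0.
    - apply pow_incr. split; [apply Cmod_ge_0|].
      rewrite Hgw, Cmod_div by auto.
      apply Rmult_le_reg_r with (Cmod (f w - f a)); [lra|].
      unfold Rdiv at 1. rewrite Rmult_assoc, Rinv_l, Rmult_1_r by lra.
      apply Rle_trans with (3 * r / m * (m / 2)).
      + eapply Rle_trans; [exact B1|]. right; field; lra.
      + apply Rmult_le_compat_l; auto. left; apply Rdiv_lt_0_compat; lra. }
  rewrite Hgw, Cmod_div, Cmod_minus_sym, (Cmod_minus_sym (f a0)) in HK; auto.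
  2:{ apply Hfw; auto. rewrite Z0; auto. }
  apply Rmult_le_compat_r with (r := Cmod (f a - f a0)) in HK; [|lra].
  unfold Rdiv at 1 in HK. rewrite Rmult_assoc, Rinv_l, Rmult_1_r in HK by lra. exact HK. }
assert (Hr : 0 < r) by (unfold r; lra).
pose proof (Hf a0 ltac:(rewrite Z0; auto)) as D0.
pose proof (has_cderiv_tends _ _ _ D0) as T0.
rewrite H0 in D0.
(* With this threshold [Hkey] would yield that [Cmod (a - a0)] is at most half of itself. Hence [df]
   vanishes on a disc around [a0], and [f] is constant there, against injectivity. *)
assert (He : m / (6 * r) > 0) by (apply Rdiv_lt_0_compat; lra).
destruct (D0 _ He) as (d1 & Hd1 & K1).
assert (Hm2 : m / 2 > 0) by lra.
destruct (T0 _ Hm2) as (d2 & Hd2 & K2).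
set (d := Rmin (Rmin d1 d2) (r / 2)).
assert (Hd : 0 < d) by (unfold d; repeat apply Rmin_glb_lt; lra).
assert (L : d <= d1 /\ d <= d2 /\ d <= r / 2).
{ unfold d. pose proof (Rmin_l (Rmin d1 d2) (r / 2)). pose proof (Rmin_r (Rmin d1 d2) (r / 2)).
  pose proof (Rmin_l d1 d2). pose proof (Rmin_r d1 d2). lra. }
assert (Hz : forall a, Cmod (a - a0) < d -> df a = 0).
{ intros a Ha. destruct (classic (a = a0)) as [->|n]; auto.
  apply NNPP; intro Hda.
  pose proof (Hkey a n ltac:(lra) (K2 a ltac:(lra)) Hda) as h.
  assert (h1 : Cmod (f a - f a0 - 0 * (a - a0)) <= m / (6 * r) * Cmod (a - a0)) by (apply K1; change (Cmod (a - a0) < d1); lra).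
  replace (f a - f a0 - 0 * (a - a0))%C with (f a - f a0)%C in h1 by ring.
  rewrite Cmod_minus_sym, (Cmod_minus_sym (f a0)) in h.
  assert (0 < Cmod (a - a0)) by (apply Cmod_gt_0, Cminus_neq_0; auto).
  assert (3 * r / m * Cmod (f a - f a0) <= 3 * r / m * (m / (6 * r) * Cmod (a - a0))).
  { apply Rmult_le_compat_l; auto. left; apply Rdiv_lt_0_compat; lra. }
  replace (3 * r / m * (m / (6 * r) * Cmod (a - a0))) with (Cmod (a - a0) / 2) in * by (field; lra).
  lra. }
destruct (nbhdC_punctured a0 d Hd) as (w & Hw & Hne).
apply Hne, Hinj; [unfold r in *; lra|rewrite Z0; auto|].
apply constant_of_zero_cderiv with d; auto.
intros z Hz'. rewrite <- (Hz z Hz'). apply Hf. unfold r in *; lra.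
Qed.

(** If [zeta] near [f w0] were omitted, the inverse of [f w - zeta] would be holomorphic, at most
    [2 / m] on a circle and larger at its centre, against the maximum principle. *)
Lemma injective_open_at (f : C -> C) (w0 : C) (R0 : R) :
  0 < R0 ->
  (forall z, Cmod (z - w0) < R0 -> exists d, has_cderiv f z d) ->
  (forall z w, Cmod (z - w0) < R0 -> Cmod (w - w0) < R0 -> f z = f w -> z = w) ->
  exists m, 0 < m /\ forall zeta, Cmod (zeta - f w0) < m ->
    exists w, Cmod (w - w0) < R0 /\ f w = zeta.
Proof.
intros HR Hf Hinj.
assert (Z0 : Cmod (w0 - w0) = 0). { replace (w0 - w0)%C with (0 : C) by ring. apply Cmod_0. }
set (r := R0 / 2).
assert (Hpol : forall t, Cmod (w0 + polar r t - w0) = r).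
{ intros t. replace (w0 + polar r t - w0)%C with (polar r t) by ring. apply Cmod_polar. unfold r; lra. }
destruct (circle_lower_bound (fun z => f z - f w0)%C w0 r) as (m & Hm & Hlow).
{ intros t. apply tends_minus; [apply _| |apply tends_const, _].
  destruct (Hf (w0 + polar r t)%C) as [d Hd]; [rewrite Hpol; unfold r; lra|].
  apply has_cderiv_tends with d; auto. }
{ intros t. apply Cminus_neq_0. intro h. apply Hinj in h.
  - specialize (Hpol t). rewrite h, Z0 in Hpol. unfold r in Hpol; lra.
  - rewrite Hpol; unfold r; lra.
  - rewrite Z0; auto. }
exists (m / 2). split; [lra|]. intros zeta Hz. apply NNPP; intro Hn.
assert (Hne : forall w, Cmod (w - w0) < R0 -> (f w - zeta)%C <> 0).
{ intros w Hw. apply Cminus_neq_0. intro h. apply Hn. eauto. }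
assert (HM : Cmod (/ (f w0 - zeta)) <= 2 / m).
{ apply (maximum_at_center (fun w => / (f w - zeta))%C w0 R0 r); [unfold r; lra| |].
  - intros w Hw. destruct (Hf w Hw) as [d Hd]. eexists.
    apply (has_cderiv_inv (fun w => f w - zeta)%C); [apply Hne; auto|].
    apply has_cderiv_minus; [exact Hd|apply has_cderiv_const].
  - intros t Ht. specialize (Hlow t Ht). set (w := (w0 + polar r t)%C) in *.
    assert (Hw : Cmod (w - w0) < R0) by (unfold w; rewrite Hpol; unfold r; lra).
    rewrite Cmod_inv by auto.
    replace (2 / m) with (/ (m / 2)) by (field; lra). apply Rinv_le_contravar; [lra|].
    replace (f w - zeta)%C with ((f w - f w0) - (zeta - f w0))%C by ring.
    pose proof (Cmod_triangle_rev (f w - f w0) (zeta - f w0)). lra. }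
assert (H0 := Hne w0 ltac:(rewrite Z0; auto)).
rewrite Cmod_inv in HM by auto. apply Cmod_gt_0 in H0.
rewrite Cmod_minus_sym in Hz.
assert (h : / (m / 2) < / Cmod (f w0 - zeta)) by (apply Rinv_lt_contravar; auto; apply Rmult_lt_0_compat; lra).
replace (/ (m / 2)) with (2 / m) in h by (field; lra). lra.
Qed.

Lemma nbhdC_Hplane (w : C) : Hplane w -> nbhdC w Hplane.
Proof.
intros Hw. exists (snd w). split; [exact Hw|]. intros v Hv.
pose proof (im_le_Cmod (w - v)) as h. rewrite Cmod_minus_sym in h. simpl in h.
pose proof (Rle_abs (snd w + - snd v)). unfold Hplane, Defs.Im in *. lra.
Qed.

(** * Regularity of the inverse of a conformal parametrization *)

Section ConformalParam.
Context (D : C -> Prop) (phi psi dphi : C -> C) (Hphi : conformal_param D phi psi dphi).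

Lemma param_inj (v w : C) : Hplane v -> Hplane w -> phi v = phi w -> v = w.
Proof.
intros Hv Hw E. rewrite <- (proj1 (proj2 (proj1 Hphi v Hv))), <- (proj1 (proj2 (proj1 Hphi w Hw))), E.
reflexivity.
Qed.

Lemma dphi_neq_0 (w : C) : Hplane w -> dphi w <> 0.
Proof.
intros Hw. destruct (nbhdC_Hplane w Hw) as (r & Hr & K).
apply (injective_cderiv_neq_0 phi dphi w r Hr).
- intros z Hz. apply (proj1 Hphi z (K z Hz)).
- intros z v Hz Hv. apply param_inj; auto.
Qed.

(** Openness of [D] and continuity of [psi] at once. Neither is part of [conformal_param]; both
    follow from the open mapping property of the injective map [phi]. *)
Lemma param_inverse_near (w0 : C) (P : C -> Prop) : Hplane w0 -> nbhdC w0 P ->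
  nbhdC (phi w0) (fun z => D z /\ P (psi z)).
Proof.
intros Hw HP. destruct (filter_and _ _ HP (nbhdC_Hplane w0 Hw)) as (r & Hr & K).
destruct (injective_open_at phi w0 r Hr) as (m & Hm & Hopen).
- intros z Hz. eexists. apply (proj1 Hphi z). apply K; auto.
- intros z v Hz Hv. apply param_inj; apply K; auto.
- exists m; split; auto. intros z Hz. destruct (Hopen z Hz) as (w & Hwr & <-).
  destruct (K w Hwr) as [Pw Hw'].
  destruct (proj1 Hphi w Hw') as (D1 & E & _). rewrite E. auto.
Qed.

Lemma param_domain_open (z : C) : D z -> nbhdC z D.
Proof.
intros Hz. destruct (proj2 Hphi z Hz) as [Hw E]. rewrite <- E.
generalize (param_inverse_near (psi z) (fun _ => True) Hw (filter_true)).
apply filter_imp; tauto.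
Qed.

Lemma has_cderiv_psi (z : C) : D z -> has_cderiv psi z (/ dphi (psi z))%C.
Proof.
intros Hz. destruct (proj2 Hphi z Hz) as [Hw E]. set (w0 := psi z) in *.
assert (T : tends (nbhdC z) psi w0).
{ intros eps Heps. rewrite <- E.
  generalize (param_inverse_near w0 (fun w => Cmod (w - w0) < eps) Hw (tends_id w0 eps Heps)).
  apply filter_imp; tauto. }
destruct (proj1 Hphi w0 Hw) as (_ & _ & Dw).
pose proof (dphi_neq_0 w0 Hw) as Hne.
apply has_cderiv_slope in Dw. destruct Dw as (s & Hs & Es & Ts).
assert (Ts' : tends (nbhdC z) (fun v => s (psi v)) (dphi w0)) by (apply (tends_comp _ psi s w0); auto).
apply (has_cderiv_of_slope _ (fun v => / s (psi v))%C); [|apply tends_inv; auto; apply _].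
generalize (filter_and _ _ (param_domain_open z Hz) (tends_away _ _ _ Hne Ts')).
apply filter_imp. intros v [Dv Hsv].
assert (s (psi v) <> 0).
{ apply Cmod_gt_0. pose proof (Cmod_ge_0 (dphi w0)). lra. }
pose proof (Hs (psi v)) as h. rewrite (proj2 (proj2 Hphi v Dv)), E in h.
fold w0. transitivity (w0 + / s (psi v) * (z + s (psi v) * (psi v - w0) - z))%C; [field; auto|].
rewrite <- h. reflexivity.
Qed.

End ConformalParam.

(** * The Moebius flow *)

Lemma has_tderiv_plus (y z : R -> C) (t : R) (v w : C) :
  has_tderiv y t v -> has_tderiv z t w -> has_tderiv (fun r => y r + z r)%C t (v + w)%C.
Proof.
intros Hf Hg. apply has_tderiv_slope in Hf, Hg. apply has_tderiv_slope.
destruct Hf as (s & Hs & <- & Ts), Hg as (r & Hr & <- & Tr).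
exists (fun x => s x + r x)%C. split; [|split; [reflexivity|apply tends_plus; auto; apply _]].
intros x. rewrite (Hs x), (Hr x). ring.
Qed.

Lemma has_tderiv_opp (y : R -> C) (t : R) (v : C) :
  has_tderiv y t v -> has_tderiv (fun r => - y r)%C t (- v)%C.
Proof.
intros Hf. apply has_tderiv_slope in Hf. apply has_tderiv_slope.
destruct Hf as (s & Hs & <- & Ts).
exists (fun x => - s x)%C. split; [|split; [reflexivity|apply tends_opp; auto; apply _]].
intros x. rewrite (Hs x). ring.
Qed.

Lemma has_tderiv_minus (y z : R -> C) (t : R) (v w : C) :
  has_tderiv y t v -> has_tderiv z t w -> has_tderiv (fun r => y r - z r)%C t (v - w)%C.
Proof. intros; apply has_tderiv_plus; auto; apply has_tderiv_opp; auto. Qed.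

Lemma has_tderiv_mult (y z : R -> C) (t : R) (v w : C) :
  has_tderiv y t v -> has_tderiv z t w ->
  has_tderiv (fun r => y r * z r)%C t (v * z t + y t * w)%C.
Proof.
intros Hf Hg. pose proof (has_tderiv_tends _ _ _ Hg) as Cg.
apply has_tderiv_slope in Hf, Hg. apply has_tderiv_slope.
destruct Hf as (s & Hs & <- & Ts), Hg as (r & Hr & <- & Tr).
exists (fun x => s x * z x + y t * r x)%C. split; [|split; [reflexivity|]].
- intros x. assert (E : (z x - z t = RtoC (x - t) * r x)%C) by (rewrite (Hr x) at 1; ring).
  rewrite (Hs x) at 1.
  replace (y t * z t + RtoC (x - t) * (s x * z x + y t * r x))%C
   with (y t * z t + RtoC (x - t) * s x * z x + y t * (RtoC (x - t) * r x))%C by ring.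
  rewrite <- E. ring.
- apply tends_plus; [apply _| |]; apply tends_mult; auto; try apply _. apply tends_const, _.
Qed.

Lemma has_tderiv_RtoC (f : R -> R) (t l : R) :
  is_derive f t l -> has_tderiv (fun r => RtoC (f r)) t (RtoC l).
Proof.
intros H. apply has_tderiv_is_derive. simpl. split; auto. apply (is_derive_const (V := R_NormedModule)).
Qed.

Lemma is_derive_zero_constant (g : R -> R) :
  (forall t, is_derive g t 0) -> forall s t, g s = g t.
Proof.
intros H s t. destruct (MVT_gen g s t (fun _ => 0)) as (c & _ & E).
- auto.
- intros x _. apply continuity_pt_filterlim.
  apply (ex_derive_continuous (V := R_NormedModule)). eexists; apply H.
- lra.
Qed.

Lemma has_tderiv_zero_constant (y : R -> C) :
  (forall t, has_tderiv y t (RtoC 0)) -> forall s t, y s = y t.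
Proof.
intros H s t.
apply injective_projections.
- apply (is_derive_zero_constant (fun r => fst (y r))). intros x.
  apply (proj1 (has_tderiv_is_derive _ _ _) (H x)).
- apply (is_derive_zero_constant (fun r => snd (y r))). intros x.
  apply (proj1 (has_tderiv_is_derive _ _ _) (H x)).
Qed.

Ltac eq_in_R := match goal with |- @eq _ ?a ?b => change (@eq R a b) end.

(* [exp (u X) = Cf u + Sf u X] when [X ^ 2 = delta]. *)
Definition exp_coeffs (delta : R) (Cf Sf : R -> R) : Prop :=
  Cf 0 = 1 /\ Sf 0 = 0 /\
  (forall u, is_derive Cf u (delta * Sf u)) /\ (forall u, is_derive Sf u (Cf u)).

Lemma exp_coeffs_exist (delta : R) : exists Cf Sf, exp_coeffs delta Cf Sf.
Proof.
destruct (Rtotal_order delta 0) as [h|[-> |h]].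
- set (k := sqrt (- delta)). assert (Hk : 0 < k) by (apply sqrt_lt_R0; lra).
  assert (E : k * k = - delta) by (apply sqrt_sqrt; lra). clearbody k.
  exists (fun u => cos (k * u)), (fun u => sin (k * u) / k).
  split; [rewrite Rmult_0_r; apply cos_0|]. split; [rewrite Rmult_0_r, sin_0; field; lra|].
  split; intros u; auto_derive; auto.
  + assert (E' : delta = - (k * k)) by lra. rewrite E'. eq_in_R. field; lra.
  + eq_in_R. field; lra.
- exists (fun _ => 1), (fun u => u). split; [reflexivity|]. split; [reflexivity|].
  split; intros u; auto_derive; auto; eq_in_R; ring.
- set (k := sqrt delta). assert (Hk : 0 < k) by (apply sqrt_lt_R0; lra).
  assert (E : k * k = delta) by (apply sqrt_sqrt; lra). clearbody k.
  exists (fun u => (exp (k * u) + exp (- (k * u))) / 2), (fun u => (exp (k * u) - exp (- (k * u))) / 2 / k).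
  split; [rewrite Rmult_0_r, Ropp_0, exp_0; field|].
  split; [rewrite Rmult_0_r, Ropp_0, exp_0; field; lra|].
  split; intros u; auto_derive; auto.
  + rewrite <- E. eq_in_R. field; lra.
  + eq_in_R. field; lra.
Qed.

Lemma exp_coeffs_Derive (delta : R) (Cf Sf : R -> R) (u : R) :
  exp_coeffs delta Cf Sf ->
  Derive (fun x : R => Cf x) u = delta * Sf u /\ Derive (fun x : R => Sf x) u = Cf u.
Proof. intros (_ & _ & HC & HS). split; apply is_derive_unique; auto. Qed.

Lemma exp_coeffs_det (delta : R) (Cf Sf : R -> R) (u : R) :
  exp_coeffs delta Cf Sf -> Cf u ^ 2 - delta * Sf u ^ 2 = 1.
Proof.
intros H. assert (DC := fun u => proj1 (exp_coeffs_Derive _ _ _ u H)).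
assert (DS := fun u => proj2 (exp_coeffs_Derive _ _ _ u H)). destruct H as (C0 & S0 & HC & HS).
rewrite (is_derive_zero_constant (fun u => Cf u ^ 2 - delta * Sf u ^ 2)) with (t := 0).
{ rewrite C0, S0. ring. }
intros t. pose proof (HC t). pose proof (HS t).
auto_derive. { repeat split; eexists; eauto. }
rewrite ?DC, ?DS. eq_in_R. ring.
Qed.

Lemma exp_coeffs_add (delta : R) (Cf Sf : R -> R) (u v : R) :
  exp_coeffs delta Cf Sf ->
  Cf (u + v) = Cf u * Cf v + delta * Sf u * Sf v /\ Sf (u + v) = Sf u * Cf v + Cf u * Sf v.
Proof.
intros H. pose proof (exp_coeffs_det delta Cf Sf u H) as Hdet.
assert (DC := fun u => proj1 (exp_coeffs_Derive _ _ _ u H)).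
assert (DS := fun u => proj2 (exp_coeffs_Derive _ _ _ u H)).
destruct H as (C0 & S0 & HC & HS).
(* With X as in [exp_coeffs], the product of exp ((u + v) X) and exp (- u X) is constant in u; [E1]
   and [E2] concern its two coefficients. *)
assert (E1 := is_derive_zero_constant (fun u => Cf (u + v) * Cf u - delta * Sf (u + v) * Sf u)).
assert (E2 := is_derive_zero_constant (fun u => Sf (u + v) * Cf u - Cf (u + v) * Sf u)).
assert (h1 := fun H => E1 H u 0). assert (h2 := fun H => E2 H u 0). simpl in h1, h2.
rewrite Rplus_0_l, C0, S0 in h1, h2.
assert (K1 : forall t, is_derive (fun u => Cf (u + v) * Cf u - delta * Sf (u + v) * Sf u) t 0).
{ intros t. auto_derive. { repeat split; eexists; eauto. }
  rewrite ?DC, ?DS. eq_in_R. ring. }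
assert (K2 : forall t, is_derive (fun u => Sf (u + v) * Cf u - Cf (u + v) * Sf u) t 0).
{ intros t. auto_derive. { repeat split; eexists; eauto. }
  rewrite ?DC, ?DS. eq_in_R. ring. }
specialize (h1 K1). specialize (h2 K2).
assert (Ev : Cf v = Cf (u + v) * Cf u - delta * Sf (u + v) * Sf u) by lra.
assert (Es : Sf v = Sf (u + v) * Cf u - Cf (u + v) * Sf u) by lra.
rewrite Ev, Es. split.
- transitivity (Cf (u + v) * (Cf u ^ 2 - delta * Sf u ^ 2)); [rewrite Hdet|]; ring.
- transitivity (Sf (u + v) * (Cf u ^ 2 - delta * Sf u ^ 2)); [rewrite Hdet|]; ring.
Qed.

Section MobiusFlow.
Context (s0 s1 : R) (Cf Sf : R -> R) (HCS : exp_coeffs (s0 ^ 2 / 4 - s1) Cf Sf).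

(* The flow of [- (1 + s0 w + s1 w^2)] is [w |-> mob_num u w / mob_den u w], the
   Moebius transformation of the matrix [exp (u [[- s0 / 2, - 1], [s1, s0 / 2]])]. *)
Definition ca (u : R) : R := Cf u - Sf u * s0 / 2.
Definition cb (u : R) : R := - Sf u.
Definition cc (u : R) : R := Sf u * s1.
Definition cd (u : R) : R := Cf u + Sf u * s0 / 2.
Definition mob_num (u : R) (w : C) : C := (RtoC (ca u) * w + RtoC (cb u))%C.
Definition mob_den (u : R) (w : C) : C := (RtoC (cc u) * w + RtoC (cd u))%C.

(** The generating matrix is traceless and its square is [s0 ^ 2 / 4 - s1] times the identity, so
    the determinant reduces to the conserved quantity of [exp_coeffs_det]. *)
Lemma mob_det (u : R) : ca u * cd u - cb u * cc u = 1.
Proof.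
rewrite <- (exp_coeffs_det _ _ _ u HCS). unfold ca, cb, cc, cd. field.
Qed.

Lemma is_derive_ca (u : R) : is_derive ca u (- s0 / 2 * ca u - cc u).
Proof.
assert (DC := fun u => proj1 (exp_coeffs_Derive _ _ _ u HCS)).
assert (DS := fun u => proj2 (exp_coeffs_Derive _ _ _ u HCS)).
destruct HCS as (_ & _ & HC & HS). unfold ca, cc. auto_derive. { repeat split; eexists; eauto. }
rewrite ?DC, ?DS. eq_in_R. field.
Qed.

Lemma is_derive_cb (u : R) : is_derive cb u (- s0 / 2 * cb u - cd u).
Proof.
assert (DC := fun u => proj1 (exp_coeffs_Derive _ _ _ u HCS)).
assert (DS := fun u => proj2 (exp_coeffs_Derive _ _ _ u HCS)).
destruct HCS as (_ & _ & HC & HS). unfold cb, cd. auto_derive. { repeat split; eexists; eauto. }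
rewrite ?DC, ?DS. eq_in_R. field.
Qed.

Lemma is_derive_cc (u : R) : is_derive cc u (s1 * ca u + s0 / 2 * cc u).
Proof.
assert (DC := fun u => proj1 (exp_coeffs_Derive _ _ _ u HCS)).
assert (DS := fun u => proj2 (exp_coeffs_Derive _ _ _ u HCS)).
destruct HCS as (_ & _ & HC & HS). unfold ca, cc. auto_derive. { repeat split; eexists; eauto. }
rewrite ?DC, ?DS. eq_in_R. field.
Qed.

Lemma is_derive_cd (u : R) : is_derive cd u (s1 * cb u + s0 / 2 * cd u).
Proof.
assert (DC := fun u => proj1 (exp_coeffs_Derive _ _ _ u HCS)).
assert (DS := fun u => proj2 (exp_coeffs_Derive _ _ _ u HCS)).
destruct HCS as (_ & _ & HC & HS). unfold cb, cd. auto_derive. { repeat split; eexists; eauto. }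
rewrite ?DC, ?DS. eq_in_R. field.
Qed.

Lemma mob_at_0 : ca 0 = 1 /\ cb 0 = 0 /\ cc 0 = 0 /\ cd 0 = 1.
Proof. destruct HCS as (C0 & S0 & _). unfold ca, cb, cc, cd. rewrite C0, S0. lra. Qed.

Lemma real_affine_neq_0 (a b : R) (w : C) :
  Hplane w -> (a <> 0 \/ b <> 0) -> (RtoC a * w + RtoC b)%C <> 0.
Proof.
intros Hw Hab h. unfold Hplane, Defs.Im in Hw. destruct w as [x y]. simpl in Hw.
apply (f_equal fst) in h as h1. apply (f_equal snd) in h as h2. simpl in h1, h2.
assert (a = 0) by nra. subst a. destruct Hab; [lra|]. nra.
Qed.

Lemma mob_num_neq_0 (u : R) (w : C) : Hplane w -> mob_num u w <> 0.
Proof.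
intros Hw. apply real_affine_neq_0; auto. pose proof (mob_det u).
destruct (Req_dec (ca u) 0) as [E|]; auto. right; intro E'. rewrite E, E' in H. lra.
Qed.

Lemma mob_den_neq_0 (u : R) (w : C) : Hplane w -> mob_den u w <> 0.
Proof.
intros Hw. apply real_affine_neq_0; auto. pose proof (mob_det u).
destruct (Req_dec (cc u) 0) as [E|]; auto. right; intro E'. rewrite E, E' in H. lra.
Qed.

Lemma mob_det_C (u : R) : (RtoC (ca u) * RtoC (cd u) - RtoC (cb u) * RtoC (cc u) = 1)%C.
Proof. rewrite <- !RtoC_mult, <- RtoC_minus, mob_det. reflexivity. Qed.

Lemma mob_Hplane (u : R) (w : C) : Hplane w -> Hplane (mob_num u w / mob_den u w)%C.
Proof.
intros Hw. pose proof (mob_den_neq_0 u w Hw) as Hq.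
pose proof (mob_det u) as Hdet. unfold mob_den, mob_num in *.
unfold Hplane, Defs.Im in *. destruct w as [x y]. simpl in *.
set (a := ca u) in *. set (b := cb u) in *. set (c := cc u) in *. set (d := cd u) in *.
assert (Hn : 0 < (c * x + d) ^ 2 + (c * y) ^ 2).
{ assert (0 <= (c * x + d) ^ 2) by apply pow2_ge_0. assert (0 <= (c * y) ^ 2) by apply pow2_ge_0.
  destruct (Req_dec ((c * x + d) ^ 2 + (c * y) ^ 2) 0) as [E|E]; [|lra].
  exfalso; apply Hq. assert (c * x + d = 0) by nra. assert (c * y = 0) by nra.
  unfold Cplus, Cmult, RtoC; simpl. f_equal; lra. }
match goal with |- ?X > 0 => replace X with ((a * d - b * c) * y / ((c * x + d) ^ 2 + (c * y) ^ 2)) end.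
{ rewrite Hdet. apply Rdiv_lt_0_compat; lra. }
field. lra.
Qed.

Lemma has_cderiv_mob (u : R) (w : C) : Hplane w ->
  has_cderiv (fun v => mob_num u v / mob_den u v)%C w (/ (mob_den u w * mob_den u w))%C.
Proof.
intros Hw. pose proof (mob_den_neq_0 u w Hw) as Hq. pose proof (mob_det_C u) as Hdet.
assert (Haff : forall a b : R, has_cderiv (fun v => RtoC a * v + RtoC b)%C w (RtoC a)).
{ intros a b. apply has_cderiv_eq with ((0 * w + RtoC a * 1) + 0)%C; [|ring].
  apply (has_cderiv_plus (fun v => RtoC a * v)%C (fun _ => RtoC b)); [|apply has_cderiv_const].
  apply (has_cderiv_mult (fun _ => RtoC a) (fun v => v)); [apply has_cderiv_const|apply has_cderiv_id]. }
pose proof (has_cderiv_inv (mob_den u) w _ Hq (Haff (cc u) (cd u))) as Di.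
pose proof (has_cderiv_mult (mob_num u) (fun v => / mob_den u v)%C w _ _ (Haff (ca u) (cb u)) Di) as Dm.
eapply has_cderiv_eq; [exact Dm|].
transitivity ((RtoC (ca u) * RtoC (cd u) - RtoC (cb u) * RtoC (cc u)) * / (mob_den u w * mob_den u w))%C.
2:{ rewrite Hdet. ring. }
unfold mob_num. unfold mob_den in *. field; auto.
Qed.

(** Uniqueness is proved by applying to [m r] the inverse of the Moebius map of time [r]. Numerator
    [P] and denominator [Q] of the result satisfy the same linear equation, with coefficient [- k],
    so their quotient keeps its initial value [m 0]. *)
Lemma mobius_flow_unique (m : R -> C) :
  (forall r, Hplane (m r)) ->
  (forall r, has_tderiv m r (- (1 + RtoC s0 * m r + RtoC s1 * (m r * m r)))%C) ->
  forall u, m u = (mob_num u (m 0%R) / mob_den u (m 0%R))%C.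
Proof.
intros HmH Hm u.
set (P := fun r => (RtoC (cd r) * m r - RtoC (cb r))%C).
set (Q := fun r => (RtoC (ca r) - RtoC (cc r) * m r)%C).
set (k := fun r => (RtoC s1 * m r + RtoC (s0 / 2))%C).
assert (DP : forall r, has_tderiv P r (- (k r * P r))%C).
{ intros r. eapply has_tderiv_eq.
  - apply has_tderiv_minus; [apply has_tderiv_mult; [apply has_tderiv_RtoC, is_derive_cd|apply Hm]|].
    apply has_tderiv_RtoC, is_derive_cb.
  - unfold P, k. replace (- s0 / 2) with (- (s0 / 2)) by field.
    replace (RtoC s0) with (RtoC (s0 / 2) + RtoC (s0 / 2))%C by (rewrite <- RtoC_plus; f_equal; field).
    rewrite RtoC_minus, RtoC_plus, !RtoC_mult, RtoC_opp. ring. }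
assert (DQ : forall r, has_tderiv Q r (- (k r * Q r))%C).
{ intros r. eapply has_tderiv_eq.
  - apply has_tderiv_minus; [apply has_tderiv_RtoC, is_derive_ca|].
    apply has_tderiv_mult; [apply has_tderiv_RtoC, is_derive_cc|apply Hm].
  - unfold Q, k. replace (- s0 / 2) with (- (s0 / 2)) by field.
    replace (RtoC s0) with (RtoC (s0 / 2) + RtoC (s0 / 2))%C by (rewrite <- RtoC_plus; f_equal; field).
    rewrite RtoC_minus, RtoC_plus, !RtoC_mult, RtoC_opp. ring. }
assert (HQ : forall r, Q r <> 0).
{ intros r. replace (Q r) with (RtoC (- cc r) * m r + RtoC (ca r))%C
   by (unfold Q; rewrite RtoC_opp; ring).
  apply real_affine_neq_0; auto. pose proof (mob_det r).
  destruct (Req_dec (ca r) 0) as [E|]; auto. left; intro E'.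
  assert (E2 : cc r = 0) by lra. rewrite E, E2 in H. lra. }
assert (DN : forall r, has_tderiv (fun r => P r * / Q r)%C r (RtoC 0)).
{ intros r. eapply has_tderiv_eq.
  - apply has_tderiv_mult; [apply DP|].
    apply (has_tderiv_comp (fun z => / z)%C Q); [apply DQ|].
    apply (has_cderiv_inv (fun z => z)); [apply HQ|apply has_cderiv_id].
  - simpl. field. apply HQ. }
pose proof (has_tderiv_zero_constant _ DN u 0) as E. simpl in E.
assert (E0 : (P 0%R * / Q 0%R)%C = m 0%R).
{ unfold P, Q. destruct mob_at_0 as (-> & -> & -> & ->). field. }
rewrite E0 in E.
pose proof (mob_det_C u) as Hdet. pose proof (mob_den_neq_0 u (m 0%R) (HmH 0)) as Hd.
assert (EP : (P u = m 0%R * Q u)%C). { rewrite <- E. field. apply HQ. }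
assert (E1 : (m u * mob_den u (m 0%R) = mob_num u (m 0%R))%C).
{ unfold mob_den, mob_num. unfold P, Q in EP.
  replace (m u * (cc u * m 0%R + cd u))%C with
   ((RtoC (cd u) * m u - RtoC (cb u)) + RtoC (cb u) + RtoC (cc u) * m u * m 0%R)%C by ring.
  rewrite EP. ring. }
rewrite <- E1. field; auto.
Qed.

End MobiusFlow.

(** * The Loewner equation in the half-plane *)

Ltac eq_in_C := match goal with |- @eq _ ?a ?b => change (@eq C a b) end.

Section HalfPlane.
Context (D : C -> Prop) (phi psi dphi : C -> C) (Hphi : conformal_param D phi psi dphi).
Context (bm1 b0 b1 s0 s1 : R) (Cf Sf : R -> R) (HCS : exp_coeffs (s0 ^ 2 / 4 - s1) Cf Sf).
Context (h : R -> C -> C) (Hh : is_flow D (sigma_field psi dphi s0 s1) h).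

Notation num := (mob_num s0 Cf Sf).
Notation den := (mob_den s0 s1 Cf Sf).

(* The Loewner vector field read in the half-plane: the pull-back of
   [2 / w + bm1 + b0 w + b1 w^2] by the Moebius flow at time [u]. *)
Definition slit_field (u : R) (w : C) : C :=
  (2 * (den u w * den u w * den u w * / num u w) + RtoC bm1 * (den u w * den u w)
   + RtoC b0 * (num u w * den u w) + RtoC b1 * (num u w * num u w))%C.

Lemma sigma_field_eq (z : C) : sigma_field psi dphi s0 s1 z =
  (- dphi (psi z) * (1 + RtoC s0 * psi z + RtoC s1 * (psi z * psi z)))%C.
Proof.
unfold sigma_field, ell_m1, ell_0, ell_1, push, lH_m1, lH_0, lH_1.
change Cadd with Cplus. change Cmul with Cmult. change Defs.Copp with Copp.
change Defs.RtoC with RtoC. change Defs.C1 with (RtoC 1). eq_in_C. ring.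
Qed.

Lemma b_field_eq (z : C) : b_field psi dphi bm1 b0 b1 z =
  (- dphi (psi z) * (2 * / psi z + RtoC bm1 + RtoC b0 * psi z + RtoC b1 * (psi z * psi z)))%C.
Proof.
unfold b_field, ell_m2, ell_m1, ell_0, ell_1, push, lH_m2, lH_m1, lH_0, lH_1.
change Cadd with Cplus. change Cmul with Cmult. change Defs.Copp with Copp.
change Defs.RtoC with RtoC. change Defs.C1 with (RtoC 1). change Defs.Cinv with Cinv. eq_in_C. ring.
Qed.

Lemma flow_half_plane (z : C) (u : R) : D z -> psi (h u z) = (num u (psi z) / den u (psi z))%C.
Proof.
intros Hz. destruct (Hh z Hz) as (E0 & HD & Hder).
rewrite (mobius_flow_unique s0 s1 Cf Sf HCS (fun r => psi (h r z))).
- rewrite E0. reflexivity.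
- intros r. apply (proj2 Hphi), HD.
- intros r. eapply has_tderiv_eq.
  + apply (has_tderiv_comp psi (fun r => h r z)); [apply Hder|].
    apply (has_cderiv_psi D phi psi dphi Hphi), HD.
  + rewrite sigma_field_eq. field. apply (dphi_neq_0 D phi psi dphi Hphi), (proj2 Hphi), HD.
Qed.

Lemma loewner_rhs_half_plane (u : R -> R) (s : R) (y v : C) :
  D y -> loewner_rhs (b_field psi dphi bm1 b0 b1) h u s y v ->
  v = (dphi (psi y) * slit_field (u s) (psi y))%C.
Proof.
intros Hy (d & Hd & ->).
set (w := psi y). set (m := (num (u s) w / den (u s) w)%C).
assert (Hw : Hplane w) by apply (proj2 Hphi y Hy).
assert (Hm : Hplane m) by (apply mob_Hplane; auto).
(* [d] is known only as some derivative of [h (u s)] at [y]. Near [y] this map is [phi] after a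
   Moebius map after [psi], so uniqueness of derivatives and the chain rule identify it. *)
assert (E : d = (dphi m * (/ (den (u s) w * den (u s) w) * / dphi w))%C).
{ apply (has_cderiv_unique (h (u s)) y); [exact Hd|].
  apply (has_cderiv_ext (fun z => phi ((fun v => num (u s) v / den (u s) v)%C (psi z)))).
  - generalize (param_domain_open D phi psi dphi Hphi y Hy). apply filter_imp. intros z Hz.
    cbv beta. rewrite <- flow_half_plane by auto. apply (proj2 Hphi), (Hh z Hz).
  - apply (has_cderiv_comp phi (fun z => (fun v => num (u s) v / den (u s) v)%C (psi z))).
    + apply (has_cderiv_comp (fun v => num (u s) v / den (u s) v)%C psi).
      * apply (has_cderiv_psi D phi psi dphi Hphi); auto.
      * apply has_cderiv_mob; auto.
    + apply (proj1 Hphi m Hm). }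
rewrite E, b_field_eq.
change Defs.Copp with Copp. change Defs.Cdiv with Cdiv.
rewrite flow_half_plane by auto. fold w. fold m.
pose proof (mob_num_neq_0 s0 s1 Cf Sf HCS (u s) w Hw).
pose proof (mob_den_neq_0 s0 s1 Cf Sf HCS (u s) w Hw).
pose proof (dphi_neq_0 D phi psi dphi Hphi w Hw).
pose proof (dphi_neq_0 D phi psi dphi Hphi m Hm).
unfold slit_field. set (dm := dphi m) in *. unfold m. field. auto.
Qed.

Definition half_plane_traj (u : R -> R) (t : R) (w : R -> C) : Prop :=
  (forall s, 0 <= s <= t -> Hplane (w s)) /\
  (forall s, 0 <= s <= t -> forall eps, eps > 0 -> exists delta, delta > 0 /\
     forall r, 0 <= r <= t -> Rabs (r - s) < delta -> Cmod (w r - w s) < eps) /\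
  (forall s, 0 < s < t -> has_tderiv w s (slit_field (u s) (w s))).

Lemma half_plane_traj_of_sol (u : R -> R) (z : C) (t : R) (y : R -> C) :
  is_sol D (b_field psi dphi bm1 b0 b1) h u z t y -> half_plane_traj u t (fun s => psi (y s)).
Proof.
intros (_ & HD & Hc & Hd). split; [|split].
- intros s Hs. apply (proj2 Hphi), HD; auto.
- intros s Hs eps Heps.
  pose proof (has_cderiv_tends _ _ _ (has_cderiv_psi D phi psi dphi Hphi _ (HD s Hs))) as T.
    destruct (T eps Heps) as (d1 & Hd1 & K1).
  destruct (Hc s Hs d1 Hd1) as (d2 & Hd2 & K2).
  exists d2; auto.
- intros s Hs. destruct (Hd s Hs) as (v & Hv & Hy).
  assert (Ds : D (y s)) by (apply HD; lra).
  eapply has_tderiv_eq.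
  + apply (has_tderiv_comp psi y); [exact Hy|apply (has_cderiv_psi D phi psi dphi Hphi), Ds].
  + rewrite (loewner_rhs_half_plane u s (y s) v Ds Hv). field.
    apply (dphi_neq_0 D phi psi dphi Hphi), (proj2 Hphi), Ds.
Qed.

Lemma is_sol_restrict (b : C -> C) (u : R -> R) (z : C) (t s : R) (y : R -> C) :
  0 <= s <= t -> is_sol D b h u z t y -> is_sol D b h u z s y.
Proof.
intros Hs (H0 & HD & Hc & Hd). split; [exact H0|]. split; [|split].
- intros r Hr; apply HD; lra.
- intros r Hr eps Heps. destruct (Hc r ltac:(lra) eps Heps) as (d & Hdp & K).
  exists d; split; [exact Hdp|]. intros x Hx; apply K; lra.
- intros r Hr. apply Hd; lra.
Qed.

(** * A single Loewner chain read in the half-plane *)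

Section Chain.
Context (u : R -> R) (g : R -> C -> C).
Notation b := (b_field psi dphi bm1 b0 b1).
Context (Hg : loewner_chain D b h u g).

Lemma exist_dom_restrict (s t : R) (z : C) :
  0 <= s <= t -> exist_dom D b h u t z -> exist_dom D b h u s z.
Proof.
intros Hs (Dz & y & Hy). split; auto. exists y. apply (is_sol_restrict b u z t s y); auto.
Qed.

Lemma chain_traj (t : R) (z : C) : 0 <= t -> exist_dom D b h u t z ->
  half_plane_traj u t (fun s => psi (g s z)) /\ psi (g 0 z) = psi z.
Proof.
intros Ht (Dz & y & Hy).
assert (E : forall s, 0 <= s <= t -> g s z = y s).
{ intros s Hs. apply (proj1 (proj2 (proj2 Hg))); [lra|]. apply (is_sol_restrict b u z t s y); auto. }
destruct (half_plane_traj_of_sol u z t y Hy) as (K1 & K2 & K3).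
split; [split; [|split]|].
- intros s Hs. rewrite E by auto. apply K1; auto.
- intros s Hs eps Heps. destruct (K2 s Hs eps Heps) as (d & Hd & K). exists d; split; [exact Hd|].
  intros r Hr Hrs. rewrite !E by auto. apply K; auto.
- intros s Hs. rewrite E by lra.
  intros eps Heps. destruct (K3 s Hs eps Heps) as (d & Hd & K).
  exists (Rmin d (Rmin s (t - s))). split.
  { apply Rmin_glb_lt; auto. apply Rmin_glb_lt; lra. }
  intros r Hr. pose proof (Rmin_l d (Rmin s (t - s))). pose proof (Rmin_r d (Rmin s (t - s))).
  pose proof (Rmin_l s (t - s)). pose proof (Rmin_r s (t - s)).
  assert (Hr' : - s < r - s < t - s) by (apply Rabs_def2 in Hr; lra).
  rewrite !E by lra. apply K; lra.
- rewrite E by lra. destruct Hy as [<- _]. reflexivity.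
Qed.

Lemma chain_half_plane (t : R) (z : C) : 0 <= t -> exist_dom D b h u t z -> Hplane (psi (g t z)).
Proof. intros Ht Hz. apply (proj1 (chain_traj t z Ht Hz)). lra. Qed.

Lemma chain_inj (t : R) (z1 z2 : C) : 0 <= t ->
  exist_dom D b h u t z1 -> exist_dom D b h u t z2 -> psi (g t z1) = psi (g t z2) -> z1 = z2.
Proof.
intros Ht H1 H2 E. destruct (proj2 (proj2 (proj2 Hg)) t Ht) as (_ & Hi & HD & _).
apply Hi; auto. rewrite <- (proj2 (proj2 Hphi _ (HD z1 H1))), E. apply (proj2 Hphi), HD; auto.
Qed.

Lemma chain_surj (t : R) (w : C) : 0 <= t -> Hplane w ->
  exists z, exist_dom D b h u t z /\ psi (g t z) = w.
Proof.
intros Ht Hw. destruct (proj2 (proj2 (proj2 Hg)) t Ht) as (_ & _ & _ & Hs).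
destruct (Hs (phi w)) as (z & Hz & E); [apply (proj1 Hphi w Hw)|].
exists z; split; auto. rewrite E. apply (proj1 Hphi w Hw).
Qed.

Lemma chain_cderiv (t : R) (z : C) : 0 <= t -> exist_dom D b h u t z ->
  exists d, has_cderiv (fun z => psi (g t z)) z d.
Proof.
intros Ht Hz. destruct (proj2 (proj2 (proj2 Hg)) t Ht) as (Hd & _ & HD & _).
destruct (Hd z Hz) as [d Dd]. eexists. apply (has_cderiv_comp psi (g t)); [exact Dd|].
apply (has_cderiv_psi D phi psi dphi Hphi), HD; auto.
Qed.

End Chain.

End HalfPlane.

(** * The Schwarz-Pick lemma *)

(* [hyp_dist w1 w2 = 4 sinh (d / 2) ^ 2] for the hyperbolic distance [d]. *)
Definition hyp_dist (w1 w2 : C) : R :=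
  ((fst w1 - fst w2) ^ 2 + (snd w1 - snd w2) ^ 2) / (snd w1 * snd w2).

Lemma Cmod_sq (z : C) : Cmod z ^ 2 = fst z ^ 2 + snd z ^ 2.
Proof. exact (Cmod2_alt z). Qed.

Lemma hyp_dist_Cmod (w1 w2 : C) : hyp_dist w1 w2 = Cmod (w1 - w2) ^ 2 / (snd w1 * snd w2).
Proof. unfold hyp_dist. rewrite Cmod_sq. reflexivity. Qed.

Lemma hyp_dist_ge_0 (w1 w2 : C) : Hplane w1 -> Hplane w2 -> 0 <= hyp_dist w1 w2.
Proof.
unfold Hplane, Defs.Im. intros H1 H2. rewrite hyp_dist_Cmod.
apply Rdiv_le_0_compat; [apply pow2_ge_0|apply Rmult_lt_0_compat; auto].
Qed.

Lemma hyp_dist_gt_0 (w1 w2 : C) : Hplane w1 -> Hplane w2 -> w1 <> w2 -> 0 < hyp_dist w1 w2.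
Proof.
unfold Hplane, Defs.Im. intros H1 H2 Hn. rewrite hyp_dist_Cmod.
apply Rdiv_lt_0_compat; [|apply Rmult_lt_0_compat; auto].
apply pow_lt, Cmod_gt_0, Cminus_neq_0; auto.
Qed.

(** The identity gives [Cmod (w - a) < Cmod (w - Cconj a)]: the quotient of [w - a] by [w - Cconj a]
    lies in the unit disc. *)
Lemma pseudo_hyperbolic (w a : C) : Hplane w -> Hplane a ->
  (w - Cconj a)%C <> 0 /\
  Cmod (w - a) ^ 2 = Cmod (w - Cconj a) ^ 2 - 4 * snd w * snd a.
Proof.
unfold Hplane, Defs.Im. intros Hw Ha. split.
- intro E. apply (f_equal snd) in E. simpl in E. lra.
- rewrite !Cmod_sq. simpl. ring.
Qed.

(** The hypothesis compares pseudo-hyperbolic distances, with denominators cleared. In terms of such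
    a distance r, [hyp_dist] is 4 r^2 / (1 - r^2), which increases with r. *)
Lemma hyp_dist_le (v1 v2 w1 w2 : C) :
  Hplane v1 -> Hplane v2 -> Hplane w1 -> Hplane w2 ->
  Cmod (v2 - v1) * Cmod (w2 - Cconj w1) <= Cmod (w2 - w1) * Cmod (v2 - Cconj v1) ->
  hyp_dist v1 v2 <= hyp_dist w1 w2.
Proof.
intros Hv1 Hv2 Hw1 Hw2 H.
destruct (pseudo_hyperbolic v2 v1 Hv2 Hv1) as [_ Ev].
destruct (pseudo_hyperbolic w2 w1 Hw2 Hw1) as [_ Ew].
rewrite !hyp_dist_Cmod, (Cmod_minus_sym v1), (Cmod_minus_sym w1).
unfold Hplane, Defs.Im in *.
assert (Pv : 0 < snd v1 * snd v2) by (apply Rmult_lt_0_compat; auto).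
assert (Pw : 0 < snd w1 * snd w2) by (apply Rmult_lt_0_compat; auto).
apply (conj (Rmult_le_pos _ _ (Cmod_ge_0 (v2 - v1)) (Cmod_ge_0 (w2 - Cconj w1)))) in H.
apply (pow_incr _ _ 2) in H.
rewrite !Rpow_mult_distr in H.
replace (Cmod (w2 - Cconj w1) ^ 2) with (Cmod (w2 - w1) ^ 2 + 4 * snd w2 * snd w1) in H by lra.
replace (Cmod (v2 - Cconj v1) ^ 2) with (Cmod (v2 - v1) ^ 2 + 4 * snd v2 * snd v1) in H by lra.
apply Rmult_le_reg_r with ((snd v1 * snd v2) * (snd w1 * snd w2)).
{ apply Rmult_lt_0_compat; auto. }
replace (Cmod (v2 - v1) ^ 2 / (snd v1 * snd v2) * (snd v1 * snd v2 * (snd w1 * snd w2)))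
  with (Cmod (v2 - v1) ^ 2 * (snd w1 * snd w2)) by (field; lra).
replace (Cmod (w2 - w1) ^ 2 / (snd w1 * snd w2) * (snd v1 * snd v2 * (snd w1 * snd w2)))
  with (Cmod (w2 - w1) ^ 2 * (snd v1 * snd v2)) by (field; lra).
lra.
Qed.

(* [zeta |-> (w2 - conj w2 * zeta) / (1 - zeta)] maps the unit disc into the half-plane
   and [0] to [w2]; near the unit circle its values are hyperbolically far from [w1]. *)
Definition cayley (w2 zeta : C) : C := ((w2 - Cconj w2 * zeta) / (1 - zeta))%C.

Lemma one_minus_neq_0 (zeta : C) : Cmod zeta < 1 -> (1 - zeta)%C <> 0.
Proof.
intros H. apply Cminus_neq_0. intro E. rewrite <- E, Cmod_1 in H. lra.
Qed.

Lemma cayley_im (w2 zeta : C) : Cmod zeta < 1 ->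
  snd (cayley w2 zeta) * Cmod (1 - zeta) ^ 2 = snd w2 * (1 - Cmod zeta ^ 2).
Proof.
intros H. apply one_minus_neq_0, Cmod_gt_0 in H.
assert (Hp : 0 < Cmod (1 - zeta) ^ 2) by (apply pow_lt; auto).
rewrite !Cmod_sq in *. unfold cayley. destruct w2 as [x y], zeta as [p q]. simpl in *. field. lra.
Qed.

Lemma cayley_Hplane (w2 zeta : C) : Hplane w2 -> Cmod zeta < 1 -> Hplane (cayley w2 zeta).
Proof.
intros Hw H. pose proof (cayley_im w2 zeta H) as E.
pose proof (proj1 (Cmod_gt_0 _) (one_minus_neq_0 zeta H)) as Hp. unfold Hplane, Defs.Im in *.
change (0 < snd (cayley w2 zeta)).
assert (0 < Cmod (1 - zeta) ^ 2) by (apply pow_lt; auto).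
apply Rmult_lt_reg_r with (Cmod (1 - zeta) ^ 2); auto. rewrite E, Rmult_0_l.
apply Rmult_lt_0_compat; auto. pose proof (Cmod_ge_0 zeta). nra.
Qed.

Lemma has_cderiv_cayley (w2 zeta : C) : Cmod zeta < 1 -> exists d, has_cderiv (cayley w2) zeta d.
Proof.
intros H. eexists. unfold cayley.
apply (has_cderiv_mult (fun z => w2 - Cconj w2 * z)%C (fun z => / (1 - z))%C).
- apply (has_cderiv_minus (fun _ => w2) (fun z => Cconj w2 * z)%C); [apply has_cderiv_const|].
  apply (has_cderiv_mult (fun _ => Cconj w2) (fun z => z)); [apply has_cderiv_const|apply has_cderiv_id].
- apply (has_cderiv_inv (fun z => 1 - z)%C); [apply one_minus_neq_0; auto|].
  apply (has_cderiv_minus (fun _ => RtoC 1) (fun z => z)); [apply has_cderiv_const|apply has_cderiv_id].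
Qed.

(** As [zeta] tends to the unit circle, [snd w * Cmod (1 - zeta) ^ 2] tends to zero by [cayley_im],
    whereas [Cmod (w - Cconj w1) * Cmod (1 - zeta)] stays above [c0]. By [pseudo_hyperbolic] the
    ratio of the two moduli then tends to 1. The number [d] is the gap to the unit circle. *)
Lemma cayley_far (w1 w2 : C) (theta : R) : Hplane w1 -> Hplane w2 -> 0 < theta ->
  exists r, 0 < r < 1 /\ forall zeta, Cmod zeta = r ->
    (1 - theta) * Cmod (cayley w2 zeta - Cconj w1) <= Cmod (cayley w2 zeta - w1).
Proof.
intros H1 H2 Ht.
destruct (pseudo_hyperbolic w2 w1 H2 H1) as [Hn E].
assert (P : 0 < 4 * snd w2 * snd w1).
{ unfold Hplane, Defs.Im in *. repeat apply Rmult_lt_0_compat; lra. }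
set (c0 := Cmod (w2 - Cconj w1) - Cmod (w2 - w1)).
assert (Hc : 0 < c0).
{ unfold c0. pose proof (Cmod_ge_0 (w2 - w1)). pose proof (Cmod_ge_0 (w2 - Cconj w1)). nra. }
set (K := 4 * snd w2 * snd w1 / c0 ^ 2).
assert (HK : 0 < K) by (apply Rdiv_lt_0_compat; auto; apply pow_lt; auto).
set (d := Rmin (1 / 2) (theta / (2 * K))).
assert (Hd : 0 < d) by (apply Rmin_glb_lt; [lra|apply Rdiv_lt_0_compat; lra]).
assert (Hd1 : d <= 1 / 2) by apply Rmin_l.
assert (Hd2 : K * (2 * d) <= theta).
{ apply Rle_trans with (K * (2 * (theta / (2 * K)))).
  - apply Rmult_le_compat_l; [lra|]. apply Rmult_le_compat_l; [lra|]. apply Rmin_r.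
  - right; field; lra. }
exists (1 - d). split; [lra|]. intros zeta Hz.
assert (Hz1 : Cmod zeta < 1) by lra.
pose proof (cayley_Hplane w2 zeta H2 Hz1) as Hw.
set (w := cayley w2 zeta) in *.
destruct (pseudo_hyperbolic w w1 Hw H1) as [Hwn Ew].
pose proof (one_minus_neq_0 zeta Hz1) as Hne.
assert (Hlow : c0 <= Cmod (w - Cconj w1) * Cmod (1 - zeta)).
{ rewrite <- Cmod_mult.
  replace ((w - Cconj w1) * (1 - zeta))%C with ((w2 - Cconj w1) - (zeta * (Cconj w2 - Cconj w1)))%C
    by (unfold w, cayley; field; auto).
  eapply Rle_trans; [|apply Cmod_triangle_rev].
  rewrite Cmod_mult, <- Cminus_conj, Cmod_conj. unfold c0.
  pose proof (Cmod_ge_0 (w2 - w1)). rewrite Hz. nra. }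
assert (Him : snd w * Cmod (1 - zeta) ^ 2 = snd w2 * (1 - Cmod zeta ^ 2)) by (apply cayley_im; auto).
apply Cmod_gt_0 in Hne, Hwn.
assert (Hsq : c0 ^ 2 <= Cmod (w - Cconj w1) ^ 2 * Cmod (1 - zeta) ^ 2).
{ rewrite <- Rpow_mult_distr. apply pow_incr. lra. }
assert (Hbound : 4 * snd w * snd w1 <= theta * Cmod (w - Cconj w1) ^ 2).
{ apply Rmult_le_reg_r with (Cmod (1 - zeta) ^ 2); [apply pow_lt; auto|].
  replace (4 * snd w * snd w1 * Cmod (1 - zeta) ^ 2) with (4 * snd w1 * (snd w * Cmod (1 - zeta) ^ 2)) by ring.
  rewrite Him, Hz.
  apply Rle_trans with (theta * c0 ^ 2).
  - replace (4 * snd w1 * (snd w2 * (1 - (1 - d) ^ 2))) with (K * (1 - (1 - d) ^ 2) * c0 ^ 2)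
      by (unfold K; field; lra).
    apply Rmult_le_compat_r; [apply pow2_ge_0|].
    apply Rle_trans with (K * (2 * d)); auto. apply Rmult_le_compat_l; [lra|]. simpl. nra.
  - rewrite Rmult_assoc. apply Rmult_le_compat_l; lra. }
set (X := Cmod (w - Cconj w1)) in *. set (Y := Cmod (w - w1)) in *.
assert (HY : 0 <= Y) by apply Cmod_ge_0.
assert (P1 : 0 < 4 * snd w * snd w1).
{ unfold Hplane, Defs.Im in *. repeat apply Rmult_lt_0_compat; lra. }
(* From [Y <= X] and the lower bound [(1 - theta) * X ^ 2] for [Y ^ 2], the product [Y * X] inherits
   that lower bound, and [X] cancels. *)
assert (Y <= X) by nra.
apply Rmult_le_reg_r with X; auto. nra.
Qed.

Lemma cayley_0 (w : C) : cayley w (RtoC 0) = w.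
Proof. unfold cayley. field. Qed.

(** [B] is [f] followed by the Cayley map centred at [f w1], so it vanishes at [w1] and is bounded
    by 1. The classical proof bounds [G], the quotient of [B] by the Cayley map centred at [w1],
    through the maximum principle on large discs; here discs centred at [w2] are transported by
    [cayley w2], and [G] enters only through [G ^ n * B]. *)
Theorem schwarz_pick (f : C -> C) (w1 w2 : C) :
  (forall w, Hplane w -> Hplane (f w) /\ exists d, has_cderiv f w d) ->
  Hplane w1 -> Hplane w2 -> hyp_dist (f w1) (f w2) <= hyp_dist w1 w2.
Proof.
intros Hf H1 H2.
destruct (Hf w1 H1) as [Hf1 _]. destruct (Hf w2 H2) as [Hf2 _].
apply hyp_dist_le; auto.
set (B := fun w => ((f w - f w1) * / (f w - Cconj (f w1)))%C).
assert (HBn : forall w, Hplane w -> (f w - Cconj (f w1))%C <> 0).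
{ intros w Hw. apply pseudo_hyperbolic; auto. apply Hf; auto. }
assert (DB : forall w, Hplane w -> exists d, has_cderiv B w d).
{ intros w Hw. destruct (Hf w Hw) as [_ [d Hd]]. eexists.
  apply (has_cderiv_mult (fun w => f w - f w1)%C (fun w => / (f w - Cconj (f w1)))%C).
  - apply (has_cderiv_minus f (fun _ => f w1)); [exact Hd|apply has_cderiv_const].
  - apply (has_cderiv_inv (fun w => f w - Cconj (f w1))%C); [auto|].
    apply (has_cderiv_minus f (fun _ => Cconj (f w1))); [exact Hd|apply has_cderiv_const]. }
assert (HB1 : forall w, Hplane w -> Cmod (B w) <= 1).
{ intros w Hw. destruct (Hf w Hw) as [Hfw _]. unfold B. pose proof (HBn w Hw) as Hn.
  destruct (pseudo_hyperbolic (f w) (f w1) Hfw Hf1) as [_ E].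
  rewrite Cmod_mult, Cmod_inv by auto. apply Cmod_gt_0 in Hn.
  apply Rmult_le_reg_r with (Cmod (f w - Cconj (f w1))); auto.
  rewrite Rmult_assoc, Rinv_l, Rmult_1_r, Rmult_1_l by lra.
  pose proof (Cmod_ge_0 (f w - f w1)).
  assert (0 < 4 * snd (f w) * snd (f w1)).
  { unfold Hplane, Defs.Im in *. repeat apply Rmult_lt_0_compat; lra. }
  nra. }
assert (EB1 : B w1 = 0) by (unfold B; ring).
destruct (DB w1 H1) as [d1 Hd1]. apply has_cderiv_slope in Hd1.
destruct Hd1 as (s & Hs & Es & Ts).
assert (Hs' : forall w, B w = (s w * (w - w1))%C).
{ intros w. rewrite (Hs w), EB1. ring. }
set (G := fun w => (s w * (w - Cconj w1))%C).
(* At [w1] the function [G] is only known to be continuous; the factor [B], which vanishes there,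
   makes the product differentiable. *)
assert (DG : forall n w, Hplane w -> exists d, has_cderiv (fun w => G w ^ n * B w)%C w d).
{ intros n w Hw. destruct (classic (w = w1)) as [->|Hne].
  - exists ((d1 * (w1 - Cconj w1)) ^ n * d1)%C.
    apply (has_cderiv_of_slope _ (fun w => G w ^ n * s w)%C).
    + apply filter_forall. intros w. rewrite EB1, (Hs' w). ring.
    + apply tends_mult; [apply _| |exact Ts]. apply tends_pow; [apply _|].
      apply tends_mult; [apply _|exact Ts|].
      apply tends_minus; [apply _|apply tends_id|apply tends_const, _].
  - assert (DGw : exists e, has_cderiv G w e).
    { destruct (DB w Hw) as [d Hd]. eexists.
      apply (has_cderiv_ext (fun v => B v * ((v - Cconj w1) * / (v - w1)))%C).
      - generalize (nbhdC_neq _ _ Hne). apply filter_imp. intros v Hv.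
        unfold G. rewrite (Hs' v). field. apply Cminus_neq_0; auto.
      - apply (has_cderiv_mult B (fun v => ((v - Cconj w1) * / (v - w1))%C)); [exact Hd|].
        apply (has_cderiv_mult (fun v => v - Cconj w1)%C (fun v => / (v - w1))%C).
        + apply (has_cderiv_minus (fun v => v) (fun _ => Cconj w1)); [apply has_cderiv_id|apply has_cderiv_const].
        + apply (has_cderiv_inv (fun v => v - w1)%C); [apply Cminus_neq_0; auto|].
          apply (has_cderiv_minus (fun v => v) (fun _ => w1)); [apply has_cderiv_id|apply has_cderiv_const]. }
    destruct DGw as [e De]. destruct (has_cderiv_pow G w e n De) as [e' De'].
    destruct (DB w Hw) as [d Hd].
    eexists. apply (has_cderiv_mult (fun v => G v ^ n)%C B); eauto. }
assert (HG : forall theta, 0 < theta < 1 -> B w2 <> 0 -> (1 - theta) * Cmod (G w2) <= 1).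
{ intros theta Ht HB2. destruct (cayley_far w1 w2 theta H1 H2 (proj1 Ht)) as (r & Hr & Hfar).
  cut (Cmod (G w2) <= / (1 - theta)).
  { intros h. apply Rmult_le_compat_l with (r := 1 - theta) in h; [|lra]. rewrite Rinv_r in h; lra. }
  apply root_of_power_bounds with (c := Cmod (B w2)) (B := 1).
  { apply Rinv_0_lt_compat; lra. }
  { apply Cmod_gt_0; auto. }
  intros n. rewrite <- Cmod_pow, <- Cmod_mult.
  set (Fn := fun zeta => (G (cayley w2 zeta) ^ n * B (cayley w2 zeta))%C).
  replace (G w2 ^ n * B w2)%C with (Fn (RtoC 0)) by (unfold Fn; rewrite cayley_0; reflexivity).
  apply (maximum_at_center Fn (RtoC 0) 1 r); auto.
  - intros z Hz. replace (z - 0)%C with z in Hz by ring.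
    destruct (has_cderiv_cayley w2 z Hz) as [d Hd].
    destruct (DG n (cayley w2 z) (cayley_Hplane w2 z H2 Hz)) as [e He].
    eexists. apply (has_cderiv_comp (fun w => G w ^ n * B w)%C (cayley w2)); eauto.
  - intros t _. replace (0 + polar r t)%C with (polar r t) by ring.
    set (w := cayley w2 (polar r t)).
    assert (Hp : Cmod (polar r t) = r) by (apply Cmod_polar; lra).
    assert (Hw : Hplane w) by (apply cayley_Hplane; auto; lra).
    specialize (Hfar _ Hp). fold w in Hfar.
    destruct (pseudo_hyperbolic w w1 Hw H1) as [Hwn _]. apply Cmod_gt_0 in Hwn.
    assert (Hpos : 0 < Cmod (w - w1)).
    { eapply Rlt_le_trans; [|exact Hfar]. apply Rmult_lt_0_compat; lra. }
    unfold Fn. fold w. rewrite Cmod_mult, Cmod_pow.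
    apply Rmult_le_compat; auto; try apply Cmod_ge_0.
    { apply pow_le, Cmod_ge_0. }
    apply pow_incr. split; [apply Cmod_ge_0|].
    assert (E : (G w * (w - w1) = B w * (w - Cconj w1))%C) by (unfold G; rewrite Hs'; ring).
    apply (f_equal Cmod) in E. rewrite !Cmod_mult in E. specialize (HB1 w Hw).
    pose proof (Cmod_ge_0 (G w)).
    apply Rmult_le_reg_r with (1 - theta); [lra|]. rewrite Rinv_l by lra.
    apply Rmult_le_reg_r with (Cmod (w - Cconj w1)); auto.
    apply Rle_trans with (Cmod (G w) * Cmod (w - w1)).
    + rewrite Rmult_assoc. apply Rmult_le_compat_l; auto.
    + rewrite E. apply Rmult_le_compat_r; lra. }
pose proof (HBn w2 H2) as Hn2.
assert (EB2 : Cmod (f w2 - f w1) = Cmod (B w2) * Cmod (f w2 - Cconj (f w1))).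
{ rewrite <- Cmod_mult. f_equal. unfold B. field; auto. }
rewrite EB2.
(* [root_of_power_bounds] needs a positive [Cmod (B w2)]; if [B w2] vanishes, the claim is
   immediate. *)
destruct (classic (B w2 = 0)) as [E|HB2].
{ rewrite E, Cmod_0, !Rmult_0_l. apply Rmult_le_pos; apply Cmod_ge_0. }
assert (HG1 : Cmod (G w2) <= 1).
{ destruct (Rle_lt_dec (Cmod (G w2)) 1) as [l|l]; auto. exfalso.
  set (X := Cmod (G w2)) in *.
  (* This [theta] turns [(1 - theta) * X] into [(X + 1) / 2], which exceeds 1. *)
  assert (Ht : 0 < (X - 1) / (2 * X) < 1).
  { split; [apply Rdiv_lt_0_compat; lra|]. apply Rmult_lt_reg_r with (2 * X); [lra|].
    unfold Rdiv; rewrite Rmult_assoc, Rinv_l; lra. }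
  specialize (HG _ Ht HB2). replace ((1 - (X - 1) / (2 * X)) * X) with (X - (X - 1) / 2) in HG by (field; lra).
  lra. }
assert (E : (G w2 * (w2 - w1) = B w2 * (w2 - Cconj w1))%C) by (unfold G; rewrite Hs'; ring).
apply (f_equal Cmod) in E. rewrite !Cmod_mult in E.
rewrite Rmult_assoc, (Rmult_comm (Cmod (f w2 - Cconj (f w1)))), <- Rmult_assoc.
apply Rmult_le_compat_r; [apply Cmod_ge_0|]. rewrite <- E.
pose proof (Cmod_ge_0 (w2 - w1)). nra.
Qed.

(** * Variation of the hyperbolic distance *)

(** Neighbourhoods relative to an interval: they express one-sided continuity at end points, and
    with [s = a] they are the right neighbourhoods used for the local estimate in time. *)
Definition nbhdI (a b s : R) (P : R -> Prop) : Prop :=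
  exists delta, delta > 0 /\ forall r, a <= r <= b -> Rabs (r - s) < delta -> P r.

#[local] Instance nbhdI_filter (a b s : R) : Filter (nbhdI a b s).
Proof.
constructor.
- exists 1; split; [lra|auto].
- intros P Q (d1 & H1 & K1) (d2 & H2 & K2). exists (Rmin d1 d2). split.
  { apply Rmin_glb_lt; auto. }
  intros w Hab Hw. pose proof (Rmin_l d1 d2). pose proof (Rmin_r d1 d2).
  split; [apply K1|apply K2]; auto; lra.
- intros P Q H (d & Hd & K). exists d; auto.
Qed.

Lemma tends_RtoC_snd {T : Type} (F : (T -> Prop) -> Prop) {FF : Filter F} (f : T -> C) (l : C) :
  tends F f l -> tends F (fun x => RtoC (snd (f x))) (RtoC (snd l)).
Proof.
intros Hf eps Heps. generalize (Hf eps Heps). apply filter_imp. intros x h.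
eapply Rle_lt_trans; [|exact h].
rewrite <- RtoC_minus, Cmod_R. exact (im_le_Cmod (f x - l)).
Qed.

(** [MVT_gen] wants two-sided continuity at the end points and may locate its point there. The
    default slope [k0] covers the end points, which is why [P k0] is assumed. *)
Lemma mean_value_within (f df : R -> R) (a b k0 : R) (P : R -> Prop) :
  a < b -> (forall s, a <= s <= b -> tends (nbhdI a b s) (fun r => RtoC (f r)) (RtoC (f s))) ->
  (forall x, a < x < b -> is_derive f x (df x)) ->
  (forall x, a < x < b -> P (df x)) -> P k0 ->
  exists k, P k /\ f b - f a = k * (b - a).
Proof.
intros Hab Hc Hd HP H0.
(* Precomposition with the projection onto the interval extends [f] continuously to the line. *)
set (cl := fun r => Rmax a (Rmin r b)).
assert (Hcl : forall r, a <= cl r <= b).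
{ intros r. unfold cl. split; [apply Rmax_l|]. apply Rmax_lub; [lra|apply Rmin_r]. }
assert (Hid : forall r, a <= r <= b -> cl r = r).
{ intros r Hr. unfold cl. rewrite Rmin_left, Rmax_right; lra. }
assert (Hlip : forall r s, Rabs (cl r - cl s) <= Rabs (r - s)).
{ intros r s. unfold cl, Rmax, Rmin. repeat destruct (Rle_dec _ _);
  unfold Rabs; repeat destruct (Rcase_abs _); lra. }
destruct (MVT_gen (fun r => f (cl r)) a b
  (fun x => if excluded_middle_informative (a < x < b) then df x else k0)) as (c & Hcc & E).
- rewrite Rmin_left, Rmax_right by lra. intros x Hx.
  destruct (excluded_middle_informative (a < x < b)) as [_|n]; [|tauto].
  apply (is_derive_ext_loc f); [|apply Hd; auto].
  assert (He : 0 < Rmin (x - a) (b - x)) by (apply Rmin_glb_lt; lra).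
  exists (mkposreal _ He). intros y Hy. rewrite Hid; auto.
  pose proof (Rmin_l (x - a) (b - x)). pose proof (Rmin_r (x - a) (b - x)).
  change (Rabs (y - x) < Rmin (x - a) (b - x)) in Hy. apply Rabs_def2 in Hy. lra.
- rewrite Rmin_left, Rmax_right by lra. intros x Hx eps Heps.
  destruct (Hc (cl x) (Hcl x) eps Heps) as (delta & Hdel & K).
  exists delta. split; auto. intros y [_ Hy]. simpl in *. unfold Rdist in *.
  specialize (K (cl y) (Hcl y)). rewrite <- RtoC_minus, Cmod_R in K. apply K.
  eapply Rle_lt_trans; [apply Hlip|exact Hy].
- cbv beta in E. rewrite !Hid in E by lra.
  eexists; split; [|exact E].
  destruct (excluded_middle_informative (a < c < b)); auto.
Qed.

Lemma RtoC_quotient (x y : R) : y <> 0 -> RtoC (x / y) = (RtoC x * / RtoC y)%C.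
Proof. intros H. rewrite RtoC_div; auto. Qed.

Lemma tends_hyp_dist {T : Type} (F : (T -> Prop) -> Prop) {FF : Filter F} (w1 w2 : T -> C) (l1 l2 : C) :
  tends F w1 l1 -> tends F w2 l2 -> Hplane l1 -> Hplane l2 ->
  tends F (fun x => RtoC (hyp_dist (w1 x) (w2 x))) (RtoC (hyp_dist l1 l2)).
Proof.
intros T1 T2 H1 H2. unfold Hplane, Defs.Im in *.
assert (Hn : (RtoC (snd l1) * RtoC (snd l2) <> 0)%C).
{ rewrite <- RtoC_mult. intro h. apply RtoC_inj in h. apply Rmult_integral in h. lra. }
assert (Tp : tends F (fun x => RtoC (snd (w1 x)) * RtoC (snd (w2 x)))%C (RtoC (snd l1) * RtoC (snd l2))%C).
{ apply tends_mult; auto; apply tends_RtoC_snd; auto. }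
assert (Td : tends F (fun x => (w1 x - w2 x)%C) (l1 - l2)%C) by (apply tends_minus; auto).
assert (E : forall v1 v2 : C, (RtoC (snd v1) * RtoC (snd v2) <> 0)%C -> RtoC (hyp_dist v1 v2) =
  ((RtoC (fst (v1 - v2)%C) * RtoC (fst (v1 - v2)%C) + RtoC (snd (v1 - v2)%C) * RtoC (snd (v1 - v2)%C))
   * / (RtoC (snd v1) * RtoC (snd v2)))%C).
{ intros v1 v2 Hv. rewrite <- RtoC_mult in Hv. unfold hyp_dist.
  rewrite RtoC_quotient.
  2:{ intro h. apply Hv. rewrite h. reflexivity. }
  rewrite <- !RtoC_mult, <- RtoC_plus. f_equal. f_equal. simpl. ring. }
rewrite E by auto.
apply (tends_ext F (fun x => ((RtoC (fst (w1 x - w2 x)%C) * RtoC (fst (w1 x - w2 x)%C)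
   + RtoC (snd (w1 x - w2 x)%C) * RtoC (snd (w1 x - w2 x)%C))
   * / (RtoC (snd (w1 x)) * RtoC (snd (w2 x))))%C)).
{ generalize (tends_away F _ _ Hn Tp). apply filter_imp. intros x Hx. symmetry. apply E.
  apply Cmod_gt_0. pose proof (Cmod_ge_0 (snd l1 * snd l2)). lra. }
apply tends_mult; auto.
- pose proof (tends_RtoC_fst F _ _ Td). pose proof (tends_RtoC_snd F _ _ Td).
  apply tends_plus; auto; apply tends_mult; auto.
- apply tends_inv; auto.
Qed.

Section Variation.
Context (bm1 b0 b1 s0 s1 : R) (Cf Sf : R -> R) (HCS : exp_coeffs (s0 ^ 2 / 4 - s1) Cf Sf).
Notation a := (ca s0 Cf Sf).
Notation b := (cb Sf).
Notation c := (cc s1 Sf).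
Notation d := (cd s0 Cf Sf).
Notation field_ := (slit_field bm1 b0 b1 s0 s1 Cf Sf).

(* The Poisson kernel of the half-plane at the preimage of [0] under the Moebius flow. *)
Definition poisson (u : R) (w : C) : R :=
  snd w / ((a u * fst w + b u) ^ 2 + (a u * snd w) ^ 2).

Lemma num_sq_gt_0 (u : R) (w : C) : Hplane w -> 0 < (a u * fst w + b u) ^ 2 + (a u * snd w) ^ 2.
Proof.
intros Hw. pose proof (mob_num_neq_0 s0 s1 Cf Sf HCS u w Hw) as Hn.
apply Cmod_gt_0 in Hn. assert (0 < Cmod (mob_num s0 Cf Sf u w) ^ 2) by (apply pow_lt; auto).
rewrite Cmod_sq in H. unfold mob_num in H. simpl in H. simpl. lra.
Qed.

Lemma poisson_gt_0 (u : R) (w : C) : Hplane w -> 0 < poisson u w.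
Proof. intros Hw. apply Rdiv_lt_0_compat; [exact Hw|apply num_sq_gt_0; auto]. Qed.

(** With [cubic_im], the real and imaginary parts of den^3 / num, written as den^3 times the
    conjugate of num over the squared modulus of num. *)
Definition cubic_re (u x y : R) : R :=
  ((c u * x + d u) * ((c u * x + d u) ^ 2 - 3 * (c u * y) ^ 2) * (a u * x + b u)
   + (3 * (c u * x + d u) ^ 2 * (c u * y) - (c u * y) ^ 3) * (a u * y))
  / ((a u * x + b u) ^ 2 + (a u * y) ^ 2).

Definition cubic_im (u x y : R) : R :=
  ((3 * (c u * x + d u) ^ 2 * (c u * y) - (c u * y) ^ 3) * (a u * x + b u)
   - (c u * x + d u) * ((c u * x + d u) ^ 2 - 3 * (c u * y) ^ 2) * (a u * y))
  / ((a u * x + b u) ^ 2 + (a u * y) ^ 2).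

(** The terms with [bm1], [b0], [b1] add up to a quadratic polynomial in [w] with real coefficients
    [al], [be], [ga]; the only singular term is twice den^3 / num. *)
Lemma slit_field_parts (u : R) : exists al be ga, forall w, Hplane w ->
  fst (field_ u w) = 2 * cubic_re u (fst w) (snd w)
     + (al + be * fst w + ga * (fst w * fst w - snd w * snd w)) /\
  snd (field_ u w) = 2 * cubic_im u (fst w) (snd w)
     + (be * snd w + ga * (2 * fst w * snd w)).
Proof.
exists (bm1 * d u * d u + b0 * b u * d u + b1 * b u * b u),
  (2 * bm1 * c u * d u + b0 * (a u * d u + b u * c u) + 2 * b1 * a u * b u),
  (bm1 * c u * c u + b0 * a u * c u + b1 * a u * a u).
intros w Hw. pose proof (num_sq_gt_0 u w Hw) as Hn.
unfold slit_field, mob_num, mob_den, cubic_re, cubic_im.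
destruct w as [x y]. simpl in *. split; field; lra.
Qed.

(** The derivative of [hyp_dist] when the points move with velocities (f1, g1) and (f2, g2). It is
    linear in the velocities, so the summands of the vector field can be treated separately. *)
Definition dist_variation (x1 y1 x2 y2 f1 g1 f2 g2 : R) : R :=
  2 * ((x1 - x2) * (f1 - f2) + (y1 - y2) * (g1 - g2)) / (y1 * y2)
  - ((x1 - x2) ^ 2 + (y1 - y2) ^ 2) * (g1 * y2 + y1 * g2) / (y1 * y2) ^ 2.

(** Real quadratic vector fields generate Moebius automorphisms of the half-plane, which are
    hyperbolic isometries. *)
Lemma dist_variation_quadratic (x1 y1 x2 y2 al be ga : R) : y1 > 0 -> y2 > 0 ->
  dist_variation x1 y1 x2 y2 (al + be * x1 + ga * (x1 * x1 - y1 * y1)) (be * y1 + ga * (2 * x1 * y1))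
    (al + be * x2 + ga * (x2 * x2 - y2 * y2)) (be * y2 + ga * (2 * x2 * y2)) = 0.
Proof. intros. unfold dist_variation. field. lra. Qed.

(** With the determinant kept symbolic this is an identity of rational functions. The factor [E + 4]
    comes from the squared distance between one point and the conjugate of the other. *)
Lemma dist_variation_cubic (u x1 y1 x2 y2 : R) : y1 > 0 -> y2 > 0 ->
  (a u * x1 + b u) ^ 2 + (a u * y1) ^ 2 <> 0 -> (a u * x2 + b u) ^ 2 + (a u * y2) ^ 2 <> 0 ->
  let N := (x1 - x2) ^ 2 + (y1 - y2) ^ 2 in let E := N / (y1 * y2) in
  dist_variation x1 y1 x2 y2 (2 * cubic_re u x1 y1) (2 * cubic_im u x1 y1)
    (2 * cubic_re u x2 y2) (2 * cubic_im u x2 y2)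
  = 2 * E * (E + 4) * (a u * d u - b u * c u) ^ 3 * (y1 / ((a u * x1 + b u) ^ 2 + (a u * y1) ^ 2))
    * (y2 / ((a u * x2 + b u) ^ 2 + (a u * y2) ^ 2)).
Proof.
intros H1 H2 H3 H4 N E. unfold dist_variation, E, N, cubic_re, cubic_im.
generalize dependent (a u). generalize dependent (b u). intros bu au H3 H4.
field. repeat split; try lra; intro h; nra.
Qed.

(* Hadamard's variational formula: up to normalization [hyp_dist] is a function of
   Green's function, whose derivative along the Loewner flow is the product of two
   Poisson kernels. *)
Theorem hyp_dist_variation (u : R) (w1 w2 : R -> C) (t : R) :
  Hplane (w1 t) -> Hplane (w2 t) ->
  has_tderiv w1 t (field_ u (w1 t)) -> has_tderiv w2 t (field_ u (w2 t)) ->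
  is_derive (fun r => hyp_dist (w1 r) (w2 r)) t
    (2 * hyp_dist (w1 t) (w2 t) * (hyp_dist (w1 t) (w2 t) + 4)
     * (poisson u (w1 t) * poisson u (w2 t))).
Proof.
intros H1 H2 D1 D2.
destruct (slit_field_parts u) as (al & be & ga & HF).
destruct (HF _ H1) as [R1 I1]. destruct (HF _ H2) as [R2 I2].
apply has_tderiv_is_derive in D1, D2. destruct D1 as [X1 Y1], D2 as [X2 Y2].
pose proof (num_sq_gt_0 u _ H1) as N1. pose proof (num_sq_gt_0 u _ H2) as N2.
unfold Hplane, Defs.Im in H1, H2. change (snd (w1 t) > 0) in H1. change (snd (w2 t) > 0) in H2.
set (x1 := fun r => fst (w1 r)) in *. set (y1 := fun r => snd (w1 r)) in *.
set (x2 := fun r => fst (w2 r)) in *. set (y2 := fun r => snd (w2 r)) in *.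
assert (DX1 : Derive (fun x : R => x1 x) t = fst (field_ u (w1 t))) by (apply is_derive_unique; auto).
assert (DY1 : Derive (fun x : R => y1 x) t = snd (field_ u (w1 t))) by (apply is_derive_unique; auto).
assert (DX2 : Derive (fun x : R => x2 x) t = fst (field_ u (w2 t))) by (apply is_derive_unique; auto).
assert (DY2 : Derive (fun x : R => y2 x) t = snd (field_ u (w2 t))) by (apply is_derive_unique; auto).
change (is_derive (fun r => ((x1 r - x2 r) ^ 2 + (y1 r - y2 r) ^ 2) / (y1 r * y2 r)) t
   (2 * hyp_dist (w1 t) (w2 t) * (hyp_dist (w1 t) (w2 t) + 4)
     * (poisson u (w1 t) * poisson u (w2 t)))).
assert (Hy1 : y1 t > 0) by exact H1. assert (Hy2 : y2 t > 0) by exact H2.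
auto_derive.
{ repeat split; try (eexists; eauto; fail). intro h. apply Rmult_integral in h. lra. }
rewrite DX1, DX2, DY1, DY2.
transitivity (dist_variation (x1 t) (y1 t) (x2 t) (y2 t) (fst (field_ u (w1 t))) (snd (field_ u (w1 t)))
  (fst (field_ u (w2 t))) (snd (field_ u (w2 t)))).
{ unfold dist_variation. eq_in_R. field. lra. }
rewrite R1, I1, R2, I2.
change (fst (w1 t)) with (x1 t) in *. change (snd (w1 t)) with (y1 t) in *.
change (fst (w2 t)) with (x2 t) in *. change (snd (w2 t)) with (y2 t) in *.
transitivity (dist_variation (x1 t) (y1 t) (x2 t) (y2 t)
    (2 * cubic_re u (x1 t) (y1 t)) (2 * cubic_im u (x1 t) (y1 t))
    (2 * cubic_re u (x2 t) (y2 t)) (2 * cubic_im u (x2 t) (y2 t)) +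
  dist_variation (x1 t) (y1 t) (x2 t) (y2 t)
    (al + be * x1 t + ga * (x1 t * x1 t - y1 t * y1 t)) (be * y1 t + ga * (2 * x1 t * y1 t))
    (al + be * x2 t + ga * (x2 t * x2 t - y2 t * y2 t)) (be * y2 t + ga * (2 * x2 t * y2 t))).
{ unfold dist_variation. eq_in_R. field. lra. }
rewrite dist_variation_quadratic, dist_variation_cubic by (auto; lra).
rewrite (mob_det s0 s1 Cf Sf HCS u).
unfold hyp_dist, poisson.
change (fst (w1 t)) with (x1 t) in *. change (snd (w1 t)) with (y1 t) in *.
change (fst (w2 t)) with (x2 t) in *. change (snd (w2 t)) with (y2 t) in *.
eq_in_R. ring.
Qed.

End Variation.

(** * Loewner maps and their inverses *)

Section Chains.
Context (D : C -> Prop) (phi psi dphi : C -> C) (Hphi : conformal_param D phi psi dphi).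
Context (bm1 b0 b1 s0 s1 : R) (Cf Sf : R -> R) (HCS : exp_coeffs (s0 ^ 2 / 4 - s1) Cf Sf).
Context (h : R -> C -> C) (Hh : is_flow D (sigma_field psi dphi s0 s1) h).
Notation b := (b_field psi dphi bm1 b0 b1).
Notation Q := (poisson s0 Cf Sf).
Notation field_ := (slit_field bm1 b0 b1 s0 s1 Cf Sf).
Notation traj := (half_plane_traj bm1 b0 b1 s0 s1 Cf Sf).

Lemma traj_tends (u : R -> R) (t s : R) (w : R -> C) :
  traj u t w -> 0 <= s <= t -> tends (nbhdI 0 t s) w (w s).
Proof. intros (_ & K & _) Hs eps Heps. destruct (K s Hs eps Heps) as (d & Hd & K'). exists d; auto. Qed.

Lemma nbhdI_subset (a a' b' c s : R) (P : R -> Prop) :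
  a <= a' -> b' <= c -> nbhdI a c s P -> nbhdI a' b' s P.
Proof. intros H1 H2 (d & Hd & K). exists d; split; auto. intros r Hr; apply K; lra. Qed.

Lemma traj_dist_increasing (u : R -> R) (t : R) (w1 w2 : R -> C) (r s : R) :
  traj u t w1 -> traj u t w2 -> 0 <= r < s -> s <= t ->
  hyp_dist (w1 r) (w2 r) <= hyp_dist (w1 s) (w2 s) /\
  ((forall x, 0 <= x <= t -> w1 x <> w2 x) -> hyp_dist (w1 r) (w2 r) < hyp_dist (w1 s) (w2 s)).
Proof.
intros T1 T2 Hrs Hst.
assert (Hc : forall x, r <= x <= s ->
  tends (nbhdI r s x) (fun y => RtoC (hyp_dist (w1 y) (w2 y))) (RtoC (hyp_dist (w1 x) (w2 x)))).
{ intros x Hx. intros eps Heps. apply nbhdI_subset with 0 t; [lra|lra|].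
  apply (tends_hyp_dist (nbhdI 0 t x)); auto; try (apply traj_tends with u; auto; lra).
  - apply T1; lra.
  - apply T2; lra. }
assert (Hd : forall x, r < x < s -> is_derive (fun y => hyp_dist (w1 y) (w2 y)) x
  (2 * hyp_dist (w1 x) (w2 x) * (hyp_dist (w1 x) (w2 x) + 4) * (Q (u x) (w1 x) * Q (u x) (w2 x)))).
{ intros x Hx. apply (hyp_dist_variation bm1 b0 b1 s0 s1 Cf Sf HCS).
  - apply T1; lra.
  - apply T2; lra.
  - apply T1; lra.
  - apply T2; lra. }
assert (HQ : forall x, r < x < s -> 0 < Q (u x) (w1 x) * Q (u x) (w2 x)).
{ intros x Hx. apply Rmult_lt_0_compat; apply (poisson_gt_0 s0 s1 Cf Sf HCS); [apply T1|apply T2]; lra. }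
assert (HE : forall x, r < x < s -> 0 <= hyp_dist (w1 x) (w2 x)).
{ intros x Hx. apply hyp_dist_ge_0; [apply T1|apply T2]; lra. }
split.
- destruct (mean_value_within _ _ r s 0 (fun k => 0 <= k) ltac:(lra) Hc Hd) as (k & Hk & E).
  + intros x Hx. specialize (HQ x Hx). specialize (HE x Hx).
    apply Rmult_le_pos; [|lra]. apply Rmult_le_pos; lra.
  + lra.
  + nra.
- intros Hne.
  destruct (mean_value_within _ _ r s 1 (fun k => 0 < k) ltac:(lra) Hc Hd) as (k & Hk & E).
  + intros x Hx. specialize (HQ x Hx).
    assert (0 < hyp_dist (w1 x) (w2 x)).
    { apply hyp_dist_gt_0; [apply T1|apply T2|apply Hne]; lra. }
    apply Rmult_lt_0_compat; auto. apply Rmult_lt_0_compat; lra.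
  + lra.
  + nra.
Qed.

Section OneChain.
Context (u : R -> R) (g : R -> C -> C) (Hg : loewner_chain D b h u g).

Lemma chain_traj_half_plane (t : R) (z : C) : 0 <= t -> exist_dom D b h u t z ->
  traj u t (fun s => psi (g s z)).
Proof.
intros Ht Hz.
apply (chain_traj D phi psi dphi Hphi bm1 b0 b1 s0 s1 Cf Sf HCS h Hh u g Hg t z Ht Hz).
Qed.

Lemma chain_contraction (t : R) (z1 z2 : C) : 0 <= t ->
  exist_dom D b h u t z1 -> exist_dom D b h u t z2 ->
  hyp_dist (psi z1) (psi z2) <= hyp_dist (psi (g t z1)) (psi (g t z2)).
Proof.
intros Ht H1 H2.
destruct (chain_traj D phi psi dphi Hphi bm1 b0 b1 s0 s1 Cf Sf HCS h Hh u g Hg t z1 Ht H1) as [T1 E1].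
destruct (chain_traj D phi psi dphi Hphi bm1 b0 b1 s0 s1 Cf Sf HCS h Hh u g Hg t z2 Ht H2) as [T2 E2].
destruct Ht as [Ht| <-].
- rewrite <- E1, <- E2. apply (traj_dist_increasing u t _ _ 0 t T1 T2); lra.
- rewrite E1, E2. lra.
Qed.

(** The imaginary part of the moving point is known only up to [delta], so [delta] occurs on both
    sides. Its linear occurrence is absorbed into half of [delta ^ 2], and a square root is avoided
    because [K <= (1 + K) ^ 2]. *)
Lemma bound_of_quadratic_bound (delta k y0 rho : R) :
  0 <= delta -> 0 < k -> 0 < y0 -> 0 <= rho <= 1 -> delta ^ 2 <= k * (y0 + delta) * rho ^ 2 ->
  delta <= (1 + 2 * k * y0 + k ^ 2) * rho.
Proof.
intros Hd Hk Hy Hr H.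
assert (E1 : k * rho ^ 2 * delta <= delta ^ 2 / 2 + k ^ 2 * rho ^ 4 / 2).
{ assert (0 <= (delta - k * rho ^ 2) ^ 2) by apply pow2_ge_0. nra. }
assert (E2 : delta ^ 2 <= rho ^ 2 * (2 * k * y0 + k ^ 2)).
{ assert (rho ^ 4 <= rho ^ 2).
  { replace (rho ^ 4) with (rho ^ 2 * rho ^ 2) by ring. assert (0 <= rho ^ 2 <= 1) by (split; nra). nra. }
  assert (0 <= k ^ 2) by apply pow2_ge_0. nra. }
set (K := 2 * k * y0 + k ^ 2) in *.
assert (HK : 0 <= K). { unfold K. assert (0 <= k ^ 2) by apply pow2_ge_0. nra. }
replace (1 + 2 * k * y0 + k ^ 2) with (1 + K) by (unfold K; ring).
apply Rnot_lt_le. intro Hlt.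
assert (0 <= (1 + K) * rho) by nra.
assert (((1 + K) * rho) ^ 2 < delta ^ 2) by nra.
assert (rho ^ 2 * K <= ((1 + K) * rho) ^ 2).
{ replace (((1 + K) * rho) ^ 2) with (rho ^ 2 * (1 + K) ^ 2) by ring.
  apply Rmult_le_compat_l; [apply pow2_ge_0|]. nra. }
lra.
Qed.

(* The flow expands the hyperbolic distance, so its inverse is Lipschitz; this stands in
   for continuous dependence on the initial point. *)
Lemma chain_inverse_lipschitz (t : R) (z0 : C) : 0 <= t -> exist_dom D b h u t z0 ->
  exists K r, 0 < K /\ 0 < r /\ forall z, exist_dom D b h u t z ->
    Cmod (psi (g t z) - psi (g t z0)) < r ->
    Cmod (z - z0) <= K * Cmod (psi (g t z) - psi (g t z0)).
Proof.
intros Ht Hz0.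
set (w0 := psi (g t z0)). set (v0 := psi z0).
assert (Hw0 : Hplane w0).
{ apply (chain_half_plane D phi psi dphi Hphi bm1 b0 b1 s0 s1 Cf Sf HCS h Hh u g Hg); auto. }
assert (Hv0 : Hplane v0) by (apply (proj2 Hphi); apply Hz0).
assert (Ev0 : phi v0 = z0) by (apply (proj2 Hphi); apply Hz0).
set (y0 := snd v0). set (Y0 := snd w0).
assert (Hy0 : 0 < y0) by exact Hv0. assert (HY0 : 0 < Y0) by exact Hw0.
(* An upper bound for [y0 / (snd w * Y0)] as soon as [snd w] is at least [Y0 / 2]. *)
set (k := 2 * y0 / Y0 ^ 2).
assert (Hk : 0 < k) by (apply Rdiv_lt_0_compat; [lra|apply pow_lt; auto]).
set (K1 := 1 + 2 * k * y0 + k ^ 2).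
assert (HK1 : 0 < K1). { unfold K1. assert (0 <= k ^ 2) by apply pow2_ge_0. nra. }
destruct (proj1 Hphi v0 Hv0) as (_ & _ & Dv).
destruct (Dv 1 Rlt_0_1) as (d1 & Hd1 & HD1).
set (L := Cmod (dphi v0) + 1).
assert (HL : 0 < L) by (unfold L; pose proof (Cmod_ge_0 (dphi v0)); lra).
(* The three bounds give [rho <= 1], keep [snd w] above [Y0 / 2], and bring [v] into the disc where
   [phi] obeys its linear approximation. *)
set (r := Rmin (Rmin 1 (Y0 / 2)) (d1 / (2 * K1))).
assert (Hr : 0 < r) by (unfold r; repeat apply Rmin_glb_lt; try lra; apply Rdiv_lt_0_compat; lra).
assert (Hr1 : r <= 1 /\ r <= Y0 / 2 /\ r <= d1 / (2 * K1)).
{ unfold r. pose proof (Rmin_l (Rmin 1 (Y0 / 2)) (d1 / (2 * K1))).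
  pose proof (Rmin_r (Rmin 1 (Y0 / 2)) (d1 / (2 * K1))).
  pose proof (Rmin_l 1 (Y0 / 2)). pose proof (Rmin_r 1 (Y0 / 2)). lra. }
exists (L * K1), r. split; [apply Rmult_lt_0_compat; auto|]. split; [auto|].
intros z Hz Hw. set (w := psi (g t z)) in *. set (v := psi z).
assert (Hwp : Hplane w).
{ apply (chain_half_plane D phi psi dphi Hphi bm1 b0 b1 s0 s1 Cf Sf HCS h Hh u g Hg); auto. }
assert (Hv : Hplane v) by (apply (proj2 Hphi); apply Hz).
assert (Ev : phi v = z) by (apply (proj2 Hphi); apply Hz).
set (rho := Cmod (w - w0)) in *. set (delta := Cmod (v - v0)).
assert (Hrho : 0 <= rho) by apply Cmod_ge_0. assert (Hdelta : 0 <= delta) by apply Cmod_ge_0.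
pose proof (chain_contraction t z z0 Ht Hz Hz0) as Hcon.
rewrite !hyp_dist_Cmod in Hcon. fold w w0 v v0 rho delta y0 Y0 in Hcon.
pose proof (im_le_Cmod (w - w0)) as Hi. pose proof (im_le_Cmod (v - v0)) as Hi2. simpl in Hi, Hi2.
fold rho Y0 in Hi. fold delta y0 in Hi2.
apply Rabs_le_between in Hi. apply Rabs_le_between in Hi2.
assert (Pv : 0 < snd v) by exact Hv. assert (Pw : 0 < snd w) by exact Hwp.
assert (Hmain : delta ^ 2 <= k * (y0 + delta) * rho ^ 2).
{ apply Rmult_le_compat_r with (r := snd v * y0) in Hcon; [|nra].
  replace (delta ^ 2 / (snd v * y0) * (snd v * y0)) with (delta ^ 2) in Hcon by (field; lra).
  eapply Rle_trans; [exact Hcon|].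
  replace (rho ^ 2 / (snd w * Y0) * (snd v * y0)) with (rho ^ 2 * (snd v * (y0 / (snd w * Y0)))) by (field; lra).
  replace (k * (y0 + delta) * rho ^ 2) with (rho ^ 2 * ((y0 + delta) * k)) by ring.
  apply Rmult_le_compat_l; [apply pow2_ge_0|].
  assert (y0 / (snd w * Y0) <= k).
  { unfold k. replace (2 * y0 / Y0 ^ 2) with (y0 * / (Y0 / 2 * Y0)) by (field; lra).
    apply Rmult_le_compat_l; [lra|]. apply Rinv_le_contravar; [nra|]. nra. }
  assert (0 <= y0 / (snd w * Y0)) by (left; apply Rdiv_lt_0_compat; nra).
  apply Rmult_le_compat; lra. }
apply bound_of_quadratic_bound in Hmain; auto; [|lra]. fold K1 in Hmain.
assert (Hsmall : delta < d1).
{ eapply Rle_lt_trans; [exact Hmain|]. apply Rle_lt_trans with (K1 * (d1 / (2 * K1))).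
  - apply Rmult_le_compat_l; lra.
  - replace (K1 * (d1 / (2 * K1))) with (d1 / 2) by (field; lra). lra. }
specialize (HD1 v Hsmall).
change (Cmod (phi v - phi v0 - dphi v0 * (v - v0)) <= 1 * delta) in HD1.
rewrite Ev, Ev0 in HD1.
replace (z - z0)%C with ((z - z0 - dphi v0 * (v - v0)) + dphi v0 * (v - v0))%C by ring.
eapply Rle_trans; [apply Cmod_triangle|]. rewrite Cmod_mult. fold delta.
apply Rle_trans with (L * delta); [unfold L; lra|].
rewrite Rmult_assoc. apply Rmult_le_compat_l; lra.
Qed.

(** [injective_cderiv_neq_0] would need a disc inside [exist_dom], which is not at hand. Instead a
    zero derivative contradicts the Lipschitz bound: for [w] near [w0], [Cmod (w - w0)] would be at
    most half of itself. *)
Lemma chain_cderiv_neq_0 (t : R) (z0 d : C) : 0 <= t -> exist_dom D b h u t z0 ->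
  has_cderiv (fun z => psi (g t z)) z0 d -> d <> 0.
Proof.
intros Ht Hz0 Hd ->.
destruct (chain_inverse_lipschitz t z0 Ht Hz0) as (K & r & HK & Hr & Hlip).
set (w0 := psi (g t z0)) in *.
assert (Hw0 : Hplane w0).
{ apply (chain_half_plane D phi psi dphi Hphi bm1 b0 b1 s0 s1 Cf Sf HCS h Hh u g Hg); auto. }
assert (Heps : / (2 * K) > 0) by (apply Rinv_0_lt_compat; lra).
destruct (Hd _ Heps) as (d1 & Hd1 & K1).
destruct (nbhdC_Hplane w0 Hw0) as (d2 & Hd2 & K2).
set (m := Rmin (Rmin r d2) (d1 / (2 * K))).
assert (Hm : m > 0) by (unfold m; repeat apply Rmin_glb_lt; try lra; apply Rdiv_lt_0_compat; lra).
destruct (nbhdC_punctured w0 m Hm) as (w & Hw & Hne).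
assert (Lm : m <= r /\ m <= d2 /\ m <= d1 / (2 * K)).
{ unfold m. pose proof (Rmin_l (Rmin r d2) (d1 / (2 * K))). pose proof (Rmin_r (Rmin r d2) (d1 / (2 * K))).
  pose proof (Rmin_l r d2). pose proof (Rmin_r r d2). lra. }
destruct (chain_surj D phi psi dphi Hphi bm1 b0 b1 h u g Hg t w Ht (K2 w ltac:(lra))) as (z & Hz & Ez).
specialize (Hlip z Hz). rewrite Ez in Hlip. specialize (Hlip ltac:(lra)).
assert (Hzz : Cmod (z - z0) < d1).
{ eapply Rle_lt_trans; [exact Hlip|]. apply Rle_lt_trans with (K * (d1 / (2 * K))).
  - apply Rmult_le_compat_l; lra.
  - replace (K * (d1 / (2 * K))) with (d1 / 2) by (field; lra). lra. }
specialize (K1 z Hzz).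
change (Cmod (psi (g t z) - w0 - RtoC 0 * (z - z0)) <= / (2 * K) * Cmod (z - z0)) in K1.
rewrite Ez in K1. replace (w - w0 - RtoC 0 * (z - z0))%C with (w - w0)%C in K1 by ring.
assert (0 < Cmod (w - w0)) by (apply Cmod_gt_0, Cminus_neq_0; auto).
apply Rmult_le_compat_l with (r := / (2 * K)) in Hlip; [|lra].
replace (/ (2 * K) * (K * Cmod (w - w0))) with (Cmod (w - w0) / 2) in Hlip by (field; lra).
lra.
Qed.

Lemma chain_inverse_exists (t : R) : 0 <= t -> exists inv : C -> C,
  forall w, Hplane w -> exist_dom D b h u t (inv w) /\ psi (g t (inv w)) = w.
Proof.
intros Ht.
exists (fun w => epsilon (inhabits w) (fun z => exist_dom D b h u t z /\ psi (g t z) = w)).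
intros w Hw. apply epsilon_spec.
apply (chain_surj D phi psi dphi Hphi bm1 b0 b1 h u g Hg); auto.
Qed.

(** The Lipschitz bound supplies the continuity of [inv], after which the slope can be inverted. The
    nonzero value of the derivative serves later to separate test points. *)
Lemma has_cderiv_chain_inverse (t : R) (inv : C -> C) (w0 : C) : 0 <= t ->
  (forall w, Hplane w -> exist_dom D b h u t (inv w) /\ psi (g t (inv w)) = w) ->
  Hplane w0 -> exists e : C, e <> 0 /\ has_cderiv inv w0 e.
Proof.
intros Ht Hinv Hw0. destruct (Hinv w0 Hw0) as [Hz0 Ew0]. set (z0 := inv w0) in *.
destruct (chain_inverse_lipschitz t z0 Ht Hz0) as (K & r & HK & Hr & Hlip).
rewrite Ew0 in Hlip.
destruct (chain_cderiv D phi psi dphi Hphi bm1 b0 b1 h u g Hg t z0 Ht Hz0) as [d Hd].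
pose proof (chain_cderiv_neq_0 t z0 d Ht Hz0 Hd) as Hdn.
assert (Tinv : tends (nbhdC w0) inv z0).
{ intros eps Heps.
  assert (Hm : Rmin r (eps / K) > 0) by (apply Rmin_glb_lt; [lra|apply Rdiv_lt_0_compat; lra]).
  generalize (filter_and _ _ (nbhdC_Hplane w0 Hw0) (tends_id w0 _ Hm)).
  apply filter_imp. intros w [Hw Hww].
  pose proof (Rmin_l r (eps / K)). pose proof (Rmin_r r (eps / K)).
  destruct (Hinv w Hw) as [Hz Ez]. specialize (Hlip _ Hz). rewrite Ez in Hlip.
  eapply Rle_lt_trans; [apply Hlip; lra|].
  apply Rlt_le_trans with (K * (eps / K)); [apply Rmult_lt_compat_l; lra|]. right; field; lra. }
apply has_cderiv_slope in Hd. destruct Hd as (s & Hs & Es & Ts). rewrite Ew0 in Hs.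
assert (Ts' : tends (nbhdC w0) (fun w => s (inv w)) d) by (apply (tends_comp _ inv s z0); auto).
exists (/ d)%C. split.
{ intro E. assert (E1 : (d * / d = 1)%C) by (field; auto). rewrite E in E1.
  replace (d * 0)%C with (RtoC 0) in E1 by ring. apply RtoC_inj in E1. lra. }
apply (has_cderiv_of_slope _ (fun w => / s (inv w))%C); [|apply tends_inv; auto; apply _].
generalize (filter_and _ _ (nbhdC_Hplane w0 Hw0) (tends_away _ _ _ Hdn Ts')).
apply filter_imp. intros w [Hw Hsw].
assert (s (inv w) <> 0) by (apply Cmod_gt_0; pose proof (Cmod_ge_0 d); lra).
destruct (Hinv w Hw) as [Hz Ez].
pose proof (Hs (inv w)) as E. rewrite Ez in E. fold z0.
transitivity (z0 + / s (inv w) * (w0 + s (inv w) * (inv w - z0) - w0))%C; [field; auto|].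
rewrite <- E. reflexivity.
Qed.

End OneChain.

(** One inclusion of domains makes [gt t'] composed with the inverse of [g t] a holomorphic self-map
    of the half-plane. Exchanging the chains gives the reverse inequality. *)
Lemma chains_dist_le (u ut : R -> R) (g gt : R -> C -> C) (t t' : R) (z1 z2 : C) :
  loewner_chain D b h u g -> loewner_chain D b h ut gt -> 0 <= t -> 0 <= t' ->
  (forall z, exist_dom D b h u t z -> exist_dom D b h ut t' z) ->
  exist_dom D b h u t z1 -> exist_dom D b h u t z2 ->
  hyp_dist (psi (gt t' z1)) (psi (gt t' z2)) <= hyp_dist (psi (g t z1)) (psi (g t z2)).
Proof.
intros Hg Hgt Ht Ht' Hdom H1 H2.
destruct (chain_inverse_exists u g Hg t Ht) as (inv & Hinv).
pose proof (chain_half_plane D phi psi dphi Hphi bm1 b0 b1 s0 s1 Cf Sf HCS h Hh) as Hp.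
assert (E : forall z, exist_dom D b h u t z -> inv (psi (g t z)) = z).
{ intros z Hz. destruct (Hinv (psi (g t z)) (Hp u g Hg t z Ht Hz)) as [Hi Ei].
  apply (chain_inj D phi psi dphi Hphi bm1 b0 b1 h u g Hg t); auto. }
pose proof (schwarz_pick (fun w => psi (gt t' (inv w))) (psi (g t z1)) (psi (g t z2))) as SP.
cbv beta in SP. rewrite (E z1 H1), (E z2 H2) in SP. apply SP.
- intros w Hw. destruct (Hinv w Hw) as [Hi Ei]. split; [apply (Hp ut gt Hgt); auto|].
  destruct (has_cderiv_chain_inverse u g Hg t inv w Ht Hinv Hw) as (e & _ & He).
  destruct (chain_cderiv D phi psi dphi Hphi bm1 b0 b1 h ut gt Hgt t' (inv w) Ht' (Hdom _ Hi)) as [d Hd].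
  eexists. apply (has_cderiv_comp (fun z => psi (gt t' z)) inv); eauto.
- apply (Hp u g Hg); auto.
- apply (Hp u g Hg); auto.
Qed.

End Chains.

(** * Congruences modulo a remainder *)

(* [cong N f g] means [f = g + O(N)] along the filter [F]. *)
Section Congruence.
Context {T : Type} (F : (T -> Prop) -> Prop) {FF : Filter F} (N : T -> R) (HN : forall x, 0 <= N x).

Definition cong (f g : T -> C) : Prop :=
  exists K, 0 <= K /\ F (fun x => Cmod (f x - g x) <= K * N x).

Lemma cong_of_eq (f g : T -> C) : F (fun x => f x = g x) -> cong f g.
Proof.
intros H. exists 0. split; [lra|]. revert H. apply filter_imp. intros x ->.
replace (g x - g x)%C with (RtoC 0) by ring. rewrite Cmod_0. lra.
Qed.

Lemma cong_refl (f : T -> C) : cong f f.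
Proof. apply cong_of_eq, filter_forall. reflexivity. Qed.

Lemma cong_sym (f g : T -> C) : cong f g -> cong g f.
Proof.
intros (K & HK & H). exists K. split; auto. revert H. apply filter_imp. intros x.
rewrite Cmod_minus_sym. auto.
Qed.

Lemma cong_trans (f g k : T -> C) : cong f g -> cong g k -> cong f k.
Proof.
intros (K & HK & H) (K' & HK' & H'). exists (K + K'). split; [lra|].
generalize (filter_and _ _ H H'). apply filter_imp. intros x [h1 h2].
replace (f x - k x)%C with ((f x - g x) + (g x - k x))%C by ring.
eapply Rle_trans; [apply Cmod_triangle|]. lra.
Qed.

Lemma cong_plus (f f' g g' : T -> C) : cong f f' -> cong g g' ->
  cong (fun x => f x + g x)%C (fun x => f' x + g' x)%C.
Proof.
intros (K & HK & H) (K' & HK' & H'). exists (K + K'). split; [lra|].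
generalize (filter_and _ _ H H'). apply filter_imp. intros x [h1 h2].
replace (f x + g x - (f' x + g' x))%C with ((f x - f' x) + (g x - g' x))%C by ring.
eapply Rle_trans; [apply Cmod_triangle|]. lra.
Qed.

Lemma cong_mult (f f' g g' : T -> C) (l m : C) : tends F f l -> tends F g' m ->
  cong f f' -> cong g g' -> cong (fun x => f x * g x)%C (fun x => f' x * g' x)%C.
Proof.
intros Tf Tg (K & HK & H) (K' & HK' & H').
pose proof (Cmod_ge_0 l). pose proof (Cmod_ge_0 m).
exists (K * (Cmod m + 1) + (Cmod l + 1) * K'). split.
{ apply Rplus_le_le_0_compat; apply Rmult_le_pos; lra. }
generalize (filter_and _ _ (filter_and _ _ H H')
  (filter_and _ _ (tends_bounded F _ _ Tf) (tends_bounded F _ _ Tg))).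
apply filter_imp. intros x [[h1 h2] [h3 h4]].
replace (f x * g x - f' x * g' x)%C with ((f x - f' x) * g' x + f x * (g x - g' x))%C by ring.
eapply Rle_trans; [apply Cmod_triangle|]. rewrite !Cmod_mult.
specialize (HN x).
replace ((K * (Cmod m + 1) + (Cmod l + 1) * K') * N x)
  with (K * N x * (Cmod m + 1) + (Cmod l + 1) * (K' * N x)) by ring.
apply Rplus_le_compat; apply Rmult_le_compat; auto; apply Cmod_ge_0.
Qed.

Lemma cong_inv (f f' : T -> C) (l l' : C) : l <> 0 -> l' <> 0 -> tends F f l -> tends F f' l' ->
  cong f f' -> cong (fun x => / f x)%C (fun x => / f' x)%C.
Proof.
intros Hl Hl' Tf Tf' (K & HK & H).
apply Cmod_gt_0 in Hl as Pl. apply Cmod_gt_0 in Hl' as Pl'.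
set (k := Cmod l / 2). set (k' := Cmod l' / 2).
assert (Hk : 0 < k) by (unfold k; lra). assert (Hk' : 0 < k') by (unfold k'; lra).
exists (K * (/ k * / k')). split.
{ apply Rmult_le_pos; auto. left; apply Rmult_lt_0_compat; apply Rinv_0_lt_compat; auto. }
generalize (filter_and _ _ H (filter_and _ _ (tends_away F _ _ Hl Tf) (tends_away F _ _ Hl' Tf'))).
apply filter_imp. intros x [h1 [h2 h3]]. fold k in h2. fold k' in h3.
assert (n1 : f x <> 0) by (apply Cmod_gt_0; lra).
assert (n2 : f' x <> 0) by (apply Cmod_gt_0; lra).
replace (/ f x - / f' x)%C with ((f' x - f x) * (/ f x * / f' x))%C by (field; auto).
rewrite !Cmod_mult, !Cmod_inv, Cmod_minus_sym by auto.
replace (K * (/ k * / k') * N x) with (K * N x * (/ k * / k')) by ring.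
apply Rmult_le_compat; auto; try apply Cmod_ge_0.
{ left; apply Rmult_lt_0_compat; apply Rinv_0_lt_compat; lra. }
apply Rmult_le_compat; try (left; apply Rinv_0_lt_compat; lra); apply Rinv_le_contravar; lra.
Qed.

Lemma cong_conj (f g : T -> C) : cong f g -> cong (fun x => Cconj (f x)) (fun x => Cconj (g x)).
Proof.
intros (K & HK & H). exists K. split; auto. revert H. apply filter_imp. intros x.
rewrite <- Cminus_conj, Cmod_conj. auto.
Qed.

Lemma cong_RtoC_snd (f g : T -> C) :
  cong f g -> cong (fun x => RtoC (snd (f x))) (fun x => RtoC (snd (g x))).
Proof.
intros (K & HK & H). exists K. split; auto. revert H. apply filter_imp. intros x h.
eapply Rle_trans; [|exact h]. rewrite <- RtoC_minus, Cmod_R. exact (im_le_Cmod (f x - g x)).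
Qed.

Lemma tends_nbhdR_comp (f : R -> R) (v : T -> R) (v0 l : R) :
  is_derive f v0 l -> tends F (fun x => RtoC (v x)) (RtoC v0) ->
  tends F (fun x => RtoC (f (v x))) (RtoC (f v0)).
Proof.
intros Hf Hv eps Heps.
destruct (has_tderiv_tends _ _ _ (has_tderiv_RtoC f v0 l Hf) eps Heps) as (d & Hd & K).
generalize (Hv d Hd). apply filter_imp. intros x Hx. apply K.
rewrite <- RtoC_minus, Cmod_R in Hx. exact Hx.
Qed.

Lemma cong_derivable_comp (f : R -> R) (v : T -> R) (l : R) :
  is_derive f 0 l -> tends F (fun x => RtoC (v x)) (RtoC 0) ->
  cong (fun x => RtoC (v x)) (fun _ => RtoC 0) ->
  cong (fun x => RtoC (f (v x))) (fun _ => RtoC (f 0)).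
Proof.
intros Hf Hv (K & HK & H).
destruct (linear_approx f l (proj1 (is_derive_Reals _ _ _) Hf) 1 Rlt_0_1) as (d & Hd & Hlin).
pose proof (Rabs_pos l).
exists ((Rabs l + 1) * K). split; [apply Rmult_le_pos; lra|].
generalize (filter_and _ _ H (Hv d Hd)). apply filter_imp. intros x [h1 h2].
replace (v x - 0)%C with (RtoC (v x)) in h1, h2 by ring. rewrite Cmod_R in h1, h2.
rewrite <- RtoC_minus, Cmod_R. specialize (Hlin _ h2).
replace (f (v x) - f 0) with ((f (v x) - f 0 - l * v x) + l * v x) by ring.
eapply Rle_trans; [apply Rabs_triang|]. rewrite Rabs_mult.
apply Rle_trans with ((Rabs l + 1) * Rabs (v x)); [lra|].
rewrite Rmult_assoc. apply Rmult_le_compat_l; lra.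
Qed.

(** For small arguments the modulus of [f] is at least half that of its argument, so a bound O(N)
    passes back from [f (v x)] to [v x]. It is meant for [Sf], whose slope at 0 is 1. *)
Lemma cong_derivable_inv (f : R -> R) (v : T -> R) :
  is_derive f 0 1 -> f 0 = 0 -> tends F (fun x => RtoC (v x)) (RtoC 0) ->
  cong (fun x => RtoC (f (v x))) (fun _ => RtoC 0) ->
  cong (fun x => RtoC (v x)) (fun _ => RtoC 0).
Proof.
intros Hf E0 Hv (K & HK & H).
assert (Hhalf : 1 / 2 > 0) by lra.
destruct (linear_approx f 1 (proj1 (is_derive_Reals _ _ _) Hf) (1 / 2) Hhalf) as (d & Hd & Hlin).
exists (2 * K). split; [lra|].
generalize (filter_and _ _ H (Hv d Hd)). apply filter_imp. intros x [h1 h2].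
replace (v x - 0)%C with (RtoC (v x)) in h2 |- * by ring.
replace (f (v x) - 0)%C with (RtoC (f (v x))) in h1 by ring.
rewrite Cmod_R in *. specialize (Hlin _ h2). rewrite E0 in Hlin.
pose proof (Rabs_triang (f (v x)) (- (f (v x) - 0 - 1 * v x))) as h3.
rewrite Rabs_Ropp in h3.
replace (f (v x) + - (f (v x) - 0 - 1 * v x)) with (v x) in h3 by ring. lra.
Qed.

End Congruence.

(** * Time changes and Gronwall's lemma *)

Lemma has_tderiv_of_slope (y s : R -> C) (t : R) (v : C) :
  nbhdR t (fun r => y r = y t + RtoC (r - t) * s r)%C -> tends (nbhdR t) s v -> has_tderiv y t v.
Proof.
intros He Hs eps Heps.
destruct (filter_and _ _ He (Hs eps Heps)) as (delta & Hd & K). exists delta; split; auto.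
intros r Hr. destruct (K r Hr) as [E h].
change (Cmod (y r - y t - RtoC (r - t) * v) <= eps * Rabs (r - t)).
rewrite E. replace (y t + RtoC (r - t) * s r - y t - RtoC (r - t) * v)%C
    with ((s r - v) * RtoC (r - t))%C by ring.
rewrite Cmod_mult, Cmod_R. apply Rmult_le_compat_r; [apply Rabs_pos|]. left; auto.
Qed.

(** [lam] is only continuous beforehand. The slope of [Et] along [lam] tends to [et], which is not
    zero, so near [t] one may divide by it and read off the slope of [lam]. *)
Lemma is_derive_of_comp (E Et lam : R -> R) (t e et : R) :
  et <> 0 -> is_derive E t e -> is_derive Et (lam t) et ->
  tends (nbhdR t) (fun r => RtoC (lam r)) (RtoC (lam t)) ->
  nbhdR t (fun r => E r = Et (lam r)) -> is_derive lam t (e / et).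
Proof.
intros Hn DE DEt Tl Heq.
pose proof (nbhdR_center _ _ Heq) as E0.
apply has_tderiv_RtoC, has_tderiv_slope in DE. apply has_tderiv_RtoC, has_tderiv_slope in DEt.
destruct DE as (s & Hs & _ & Ts), DEt as (st & Hst & _ & Tst).
assert (Tst' : tends (nbhdR t) (fun r => st (lam r)) (RtoC et)).
{ intros eps Heps. destruct (Tst eps Heps) as (d & Hd & K).
  generalize (Tl d Hd). apply filter_imp. intros r Hr. apply K.
  rewrite <- RtoC_minus, Cmod_R in Hr. exact Hr. }
assert (Hn' : RtoC et <> 0) by (intro h; apply RtoC_inj in h; auto).
assert (H : has_tderiv (fun r => RtoC (lam r)) t (RtoC e * / RtoC et)%C).
{ apply (has_tderiv_of_slope _ (fun r => s r * / st (lam r))%C).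
  - generalize (filter_and _ _ Heq (tends_away _ _ _ Hn' Tst')). apply filter_imp. intros r [h1 h2].
    assert (Hz : st (lam r) <> 0) by (apply Cmod_gt_0; pose proof (Cmod_ge_0 et); lra).
    pose proof (Hs r) as k1. pose proof (Hst (lam r)) as k2. rewrite h1, E0 in k1. rewrite k1 in k2.
    assert (k3 : (RtoC (r - t) * s r = RtoC (lam r - lam t) * st (lam r))%C).
    { transitivity (Et (lam t) + RtoC (r - t) * s r - Et (lam t))%C; [ring|]. rewrite k2. ring. }
    transitivity (lam t + (RtoC (r - t) * s r) * / st (lam r))%C; [|ring].
    rewrite k3, RtoC_minus. field; auto.
  - apply tends_mult; [apply _|exact Ts|]. apply tends_inv; auto; apply _. }
apply has_tderiv_is_derive in H. destruct H as [H _]. simpl in H.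
eapply is_derive_ext; [|eapply (eq_ind _ (is_derive _ t) H)].
- intros r; reflexivity.
- eq_in_R. field. auto.
Qed.

Lemma has_tderiv_reparam (w : R -> C) (lam : R -> R) (t l : R) (v : C) :
  is_derive lam t l -> has_tderiv w (lam t) v -> has_tderiv (fun r => w (lam r)) t (RtoC l * v)%C.
Proof.
intros Hl Hw. apply has_tderiv_is_derive in Hw. destruct Hw as [H1 H2].
apply has_tderiv_is_derive. split.
- eapply (eq_ind _ (is_derive _ t)); [apply (is_derive_comp (fun r => fst (w r)) lam t _ _ H1 Hl)|].
  simpl. unfold scal; simpl. unfold mult; simpl. ring.
- eapply (eq_ind _ (is_derive _ t)); [apply (is_derive_comp (fun r => snd (w r)) lam t _ _ H2 Hl)|].
  simpl. unfold scal; simpl. unfold mult; simpl. ring.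
Qed.

Lemma gronwall_zero (M dM : R -> R) (a b K : R) :
  (forall s, a <= s <= b -> tends (nbhdI a b s) (fun r => RtoC (M r)) (RtoC (M s))) ->
  (forall s, a < s < b -> is_derive M s (dM s)) ->
  (forall s, a < s < b -> dM s <= K * M s) ->
  (forall s, a <= s <= b -> 0 <= M s) -> M a = 0 ->
  forall s, a <= s <= b -> M s = 0.
Proof.
intros Hc Hd HK Hpos H0 s Hs. destruct (proj1 Hs) as [Has| <-]; auto.
set (f := fun r => M r * exp (- K * r)).
assert (Dexp : forall x, is_derive (fun r => exp (- K * r)) x (- K * exp (- K * x))).
{ intros x. auto_derive; auto; ring. }
destruct (mean_value_within f (fun x => (dM x - K * M x) * exp (- K * x)) a s 0 (fun k => k <= 0) Has)
  as (k & Hk & E).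
- intros x Hx. unfold f.
  apply (tends_ext _ (fun r => RtoC (M r) * RtoC (exp (- K * r)))%C).
  { apply filter_forall. intros r. rewrite RtoC_mult. reflexivity. }
  rewrite RtoC_mult. apply tends_mult; [apply _| |].
  + intros eps Heps. apply nbhdI_subset with a b; [lra|lra|]. apply Hc; lra.
  + intros eps Heps.
    destruct (has_tderiv_tends _ _ _ (has_tderiv_RtoC _ _ _ (Dexp x)) eps Heps) as (d & Hdp & K').
    exists d; auto.
- intros x Hx. unfold f.
  eapply (eq_ind _ (is_derive _ x)).
  + apply (is_derive_mult M (fun r => exp (- K * r)) x (dM x) (- K * exp (- K * x))); [apply Hd; lra|apply Dexp|].
    intros; apply Rmult_comm.
  + unfold plus, mult; simpl. ring.
- intros x Hx. specialize (HK x ltac:(lra)). pose proof (exp_pos (- K * x)). nra.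
- lra.
- unfold f in E. rewrite H0 in E. pose proof (exp_pos (- K * s)). specialize (Hpos s Hs).
  assert (k * (s - a) <= 0) by nra.
  assert (M s * exp (- K * s) <= 0) by lra.
  nra.
Qed.

(** * Dependence on the driving term *)

Section MatrixFlow.
Context (bm1 b0 b1 s0 s1 : R) (Cf Sf : R -> R) (HCS : exp_coeffs (s0 ^ 2 / 4 - s1) Cf Sf).
Notation a := (ca s0 Cf Sf).
Notation b := (cb Sf).
Notation c := (cc s1 Sf).
Notation d := (cd s0 Cf Sf).
Notation num := (mob_num s0 Cf Sf).
Notation den := (mob_den s0 s1 Cf Sf).
Notation Q := (poisson s0 Cf Sf).
Notation field_ := (slit_field bm1 b0 b1 s0 s1 Cf Sf).

Lemma mob_num_add (u v : R) (w : C) :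
  num (v + u) w = (RtoC (a v) * num u w + RtoC (b v) * den u w)%C.
Proof.
destruct (exp_coeffs_add _ _ _ v u HCS) as [EC ES].
unfold mob_num, mob_den, ca, cb, cc, cd. rewrite EC, ES.
destruct w as [x y]. unfold RtoC, Cplus, Cmult; simpl. f_equal; field.
Qed.

Lemma mob_den_add (u v : R) (w : C) :
  den (v + u) w = (RtoC (c v) * num u w + RtoC (d v) * den u w)%C.
Proof.
destruct (exp_coeffs_add _ _ _ v u HCS) as [EC ES].
unfold mob_num, mob_den, ca, cb, cc, cd. rewrite EC, ES.
destruct w as [x y]. unfold RtoC, Cplus, Cmult; simpl. f_equal; field.
Qed.

Lemma poisson_C (u : R) (w : C) : Hplane w ->
  RtoC (Q u w) = (RtoC (snd w) * / (num u w * Cconj (num u w)))%C.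
Proof.
intros Hw. pose proof (num_sq_gt_0 s0 s1 Cf Sf HCS u w Hw) as Hn.
unfold poisson. rewrite RtoC_quotient by lra. f_equal. f_equal.
unfold mob_num. destruct w as [x y]. unfold RtoC, Cplus, Cmult, Cconj; simpl. f_equal; ring.
Qed.

(* [-1 / M_u(w)], whose imaginary part is the Poisson kernel. *)
Definition inv_mob (u : R) (w : C) : C := (- (den u w * / num u w))%C.

(** An exact finite form of the logarithmic derivative in the driving value: since [cb] is the
    opposite of [Sf], [num (v + u) w] is [num u w] times [a v + Sf v * inv_mob u w], and the kernels
    compare through the squared modulus of this factor. *)
Lemma poisson_shift (u v : R) (w : C) : Hplane w ->
  Q u w = Q (v + u) w *
    ((a v + Sf v * fst (inv_mob u w)) ^ 2 + (Sf v * snd (inv_mob u w)) ^ 2).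
Proof.
intros Hw.
pose proof (mob_num_neq_0 s0 s1 Cf Sf HCS u w Hw) as Hn.
assert (E : num (v + u) w = (num u w * (RtoC (a v) + RtoC (Sf v) * inv_mob u w))%C).
{ rewrite mob_num_add. unfold inv_mob, cb. rewrite RtoC_opp. field; auto. }
assert (Ep : forall x, Q x w = snd w / Cmod (num x w) ^ 2).
{ intros x. unfold poisson. rewrite Cmod_sq. unfold mob_num. simpl. f_equal. ring. }
rewrite !Ep, E, Cmod_mult, Rpow_mult_distr.
assert (Hz : (RtoC (a v) + RtoC (Sf v) * inv_mob u w)%C <> 0).
{ intro h. apply (mob_num_neq_0 s0 s1 Cf Sf HCS (v + u) w Hw). rewrite E, h. ring. }
apply Cmod_gt_0 in Hz, Hn.
replace ((a v + Sf v * fst (inv_mob u w)) ^ 2 + (Sf v * snd (inv_mob u w)) ^ 2)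
  with (Cmod (RtoC (a v) + RtoC (Sf v) * inv_mob u w) ^ 2).
2:{ rewrite Cmod_sq. simpl. ring. }
field. lra.
Qed.

Section Limits.
Context {T : Type} (F : (T -> Prop) -> Prop) {FF : Filter F}.
Context (U : T -> R) (W : T -> C) (u0 : R) (w0 : C) (Hw0 : Hplane w0).
Context (HU : tends F (fun t => RtoC (U t)) (RtoC u0)) (HW : tends F W w0).

Lemma tends_mob_num : tends F (fun t => num (U t) (W t)) (num u0 w0).
Proof.
apply tends_plus; auto; [apply tends_mult; auto|].
- apply (tends_nbhdR_comp F _ U u0 _ (is_derive_ca s0 s1 Cf Sf HCS u0)); auto.
- apply (tends_nbhdR_comp F _ U u0 _ (is_derive_cb s0 s1 Cf Sf HCS u0)); auto.
Qed.

Lemma tends_mob_den : tends F (fun t => den (U t) (W t)) (den u0 w0).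
Proof.
apply tends_plus; auto; [apply tends_mult; auto|].
- apply (tends_nbhdR_comp F _ U u0 _ (is_derive_cc s0 s1 Cf Sf HCS u0)); auto.
- apply (tends_nbhdR_comp F _ U u0 _ (is_derive_cd s0 s1 Cf Sf HCS u0)); auto.
Qed.

Lemma tends_inv_mob : tends F (fun t => inv_mob (U t) (W t)) (inv_mob u0 w0).
Proof.
apply tends_opp; auto. apply tends_mult; auto; [apply tends_mob_den|].
apply tends_inv; auto; [apply (mob_num_neq_0 s0 s1 Cf Sf HCS); auto|apply tends_mob_num].
Qed.

Lemma tends_Hplane : F (fun t => Hplane (W t)).
Proof. apply (tends_nbhd F W w0); auto. apply nbhdC_Hplane; auto. Qed.

Lemma num_conj_neq_0 : (num u0 w0 * Cconj (num u0 w0))%C <> 0.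
Proof.
pose proof (mob_num_neq_0 s0 s1 Cf Sf HCS u0 w0 Hw0) as H.
apply Cmod_gt_0. rewrite Cmod_mult, Cmod_conj. apply Cmod_gt_0 in H. apply Rmult_lt_0_compat; auto.
Qed.

Lemma tends_poisson : tends F (fun t => RtoC (Q (U t) (W t))) (RtoC (Q u0 w0)).
Proof.
rewrite poisson_C by auto.
apply (tends_ext F (fun t => (RtoC (snd (W t)) * / (num (U t) (W t) * Cconj (num (U t) (W t))))%C)).
{ generalize tends_Hplane. apply filter_imp. intros t Ht. symmetry. apply poisson_C; auto. }
apply tends_mult; auto; [apply tends_RtoC_snd; auto|].
apply tends_inv; auto; [apply num_conj_neq_0|].
apply tends_mult; auto; [apply tends_mob_num|]. apply tends_conj; auto. apply tends_mob_num.
Qed.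

End Limits.

Section CongLimits.
Context {T : Type} (F : (T -> Prop) -> Prop) {FF : Filter F} (N : T -> R) (HN : forall x, 0 <= N x).
Context (U U' : T -> R) (W W' : T -> C) (u0 : R) (w0 : C) (Hw0 : Hplane w0).
Context (HU : tends F (fun t => RtoC (U t)) (RtoC u0)) (HW : tends F W w0).
Context (HU' : tends F (fun t => RtoC (U' t)) (RtoC u0)) (HW' : tends F W' w0).
Context (HUU : cong F N (fun t => RtoC (U t)) (fun t => RtoC (U' t))) (HWW : cong F N W W').

Lemma tends_shift : tends F (fun t => RtoC (U t - U' t)%R) (RtoC 0).
Proof.
apply (tends_ext F (fun t => RtoC (U t) - RtoC (U' t))%C).
{ apply filter_forall. intros t. rewrite RtoC_minus. reflexivity. }
apply tends_eq with (RtoC u0 - RtoC u0)%C; [|ring]. apply tends_minus; auto.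
Qed.

Lemma cong_shift : cong F N (fun t => RtoC (U t - U' t)%R) (fun _ => RtoC 0).
Proof.
apply (cong_trans F N _ (fun t => RtoC (U' t) + RtoC (- U' t)%R)%C).
- apply (cong_trans F N _ (fun t => RtoC (U t) + RtoC (- U' t)%R)%C).
  + apply cong_of_eq; auto. apply filter_forall. intros t. rewrite <- RtoC_plus. reflexivity.
  + apply cong_plus; auto. apply cong_refl; auto.
- apply cong_of_eq; auto. apply filter_forall. intros t. rewrite <- RtoC_plus. f_equal. ring.
Qed.

Lemma cong_coeff (f : R -> R) (l : R) : is_derive f 0 l ->
  cong F N (fun t => RtoC (f (U t - U' t)%R)) (fun _ => RtoC (f 0)).
Proof.
intros Hf. apply cong_derivable_comp with l; auto; [apply tends_shift|apply cong_shift].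
Qed.

Lemma tends_coeff (f : R -> R) (l : R) : is_derive f 0 l ->
  tends F (fun t => RtoC (f (U t - U' t)%R)) (RtoC (f 0)).
Proof. intros Hf. apply (tends_nbhdR_comp F f _ 0 l Hf tends_shift). Qed.

Lemma cong_affine_shift (f k : R -> R) (lf lk : R) (X Y : T -> C) (x0 y0 : C) :
  is_derive f 0 lf -> is_derive k 0 lk -> tends F X x0 -> tends F Y y0 ->
  cong F N (fun t => RtoC (f (U t - U' t)%R) * X t + RtoC (k (U t - U' t)%R) * Y t)%C
           (fun t => RtoC (f 0) * X t + RtoC (k 0) * Y t)%C.
Proof.
intros Df Dk TX TY. apply cong_plus; auto.
- apply (cong_mult F N HN _ _ _ _ (RtoC (f 0)) x0); auto.
  + apply tends_coeff with lf; auto.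
  + apply cong_coeff with lf; auto.
  + apply cong_refl; auto.
- apply (cong_mult F N HN _ _ _ _ (RtoC (k 0)) y0); auto.
  + apply tends_coeff with lk; auto.
  + apply cong_coeff with lk; auto.
  + apply cong_refl; auto.
Qed.

Lemma cong_affine_arg (f k : R -> R) (lf lk : R) :
  is_derive f u0 lf -> is_derive k u0 lk ->
  cong F N (fun t => RtoC (f (U t)) * W t + RtoC (k (U t)))%C
           (fun t => RtoC (f (U t)) * W' t + RtoC (k (U t)))%C.
Proof.
intros Df Dk. apply cong_plus; auto; [|apply cong_refl; auto].
apply (cong_mult F N HN _ _ _ _ (RtoC (f u0)) w0); auto.
- apply (tends_nbhdR_comp F f _ u0 lf); auto.
- apply cong_refl; auto.
Qed.

(** The point is moved first, at fixed driving value. Then the group law expresses [num] at [U t]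
    through the matrix of time [U t - U' t], so that differentiability of the coefficients at the
    single time 0 controls the difference although both driving values vary. *)
Lemma cong_mob_num : cong F N (fun t => num (U t) (W t)) (fun t => num (U' t) (W' t)).
Proof.
apply (cong_trans F N _ (fun t => num (U t) (W' t))).
{ exact (cong_affine_arg _ _ _ _ (is_derive_ca s0 s1 Cf Sf HCS u0) (is_derive_cb s0 s1 Cf Sf HCS u0)). }
apply (cong_trans F N _ (fun t => RtoC (a (U t - U' t)%R) * num (U' t) (W' t)
   + RtoC (b (U t - U' t)%R) * den (U' t) (W' t))%C).
{ apply cong_of_eq; auto. apply filter_forall. intros t. rewrite <- mob_num_add. f_equal. ring. }
apply (cong_trans F N _ (fun t => RtoC (a 0) * num (U' t) (W' t) + RtoC (b 0) * den (U' t) (W' t))%C).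
{ eapply cong_affine_shift.
  - apply (is_derive_ca s0 s1 Cf Sf HCS).
  - apply (is_derive_cb s0 s1 Cf Sf HCS).
  - apply tends_mob_num with (u0 := u0) (w0 := w0); auto.
  - apply tends_mob_den with (u0 := u0) (w0 := w0); auto. }
apply cong_of_eq; auto. apply filter_forall. intros t.
destruct (mob_at_0 s0 s1 Cf Sf HCS) as (-> & -> & _ & _). ring.
Qed.

Lemma cong_mob_den : cong F N (fun t => den (U t) (W t)) (fun t => den (U' t) (W' t)).
Proof.
apply (cong_trans F N _ (fun t => den (U t) (W' t))).
{ exact (cong_affine_arg _ _ _ _ (is_derive_cc s0 s1 Cf Sf HCS u0) (is_derive_cd s0 s1 Cf Sf HCS u0)). }
apply (cong_trans F N _ (fun t => RtoC (c (U t - U' t)%R) * num (U' t) (W' t)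
   + RtoC (d (U t - U' t)%R) * den (U' t) (W' t))%C).
{ apply cong_of_eq; auto. apply filter_forall. intros t. rewrite <- mob_den_add. f_equal. ring. }
apply (cong_trans F N _ (fun t => RtoC (c 0) * num (U' t) (W' t) + RtoC (d 0) * den (U' t) (W' t))%C).
{ eapply cong_affine_shift.
  - apply (is_derive_cc s0 s1 Cf Sf HCS).
  - apply (is_derive_cd s0 s1 Cf Sf HCS).
  - apply tends_mob_num with (u0 := u0) (w0 := w0); auto.
  - apply tends_mob_den with (u0 := u0) (w0 := w0); auto. }
apply cong_of_eq; auto. apply filter_forall. intros t.
destruct (mob_at_0 s0 s1 Cf Sf HCS) as (_ & _ & -> & ->). ring.
Qed.

Lemma cong_poisson : cong F N (fun t => RtoC (Q (U t) (W t))) (fun t => RtoC (Q (U' t) (W' t))).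
Proof.
pose proof (tends_mob_num F U W u0 w0 HU HW) as Tn.
pose proof (tends_mob_num F U' W' u0 w0 HU' HW') as Tn'.
assert (E : forall (V : T -> R) (X : T -> C), tends F X w0 ->
  cong F N (fun t => RtoC (Q (V t) (X t)))
    (fun t => RtoC (snd (X t)) * / (num (V t) (X t) * Cconj (num (V t) (X t))))%C).
{ intros V X TX. apply cong_of_eq; auto. generalize (tends_Hplane F X w0 Hw0 TX).
  apply filter_imp. intros t Ht. apply poisson_C; auto. }
refine (cong_trans F N _ _ _ (E U W HW) _).
refine (cong_trans F N _ _ _ _ (cong_sym F N _ _ (E U' W' HW'))).
assert (Tp : tends F (fun t => num (U t) (W t) * Cconj (num (U t) (W t)))%C (num u0 w0 * Cconj (num u0 w0))%C).
{ apply tends_mult; auto. apply tends_conj; auto. }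
assert (Tp' : tends F (fun t => num (U' t) (W' t) * Cconj (num (U' t) (W' t)))%C (num u0 w0 * Cconj (num u0 w0))%C).
{ apply tends_mult; auto. apply tends_conj; auto. }
pose proof (num_conj_neq_0 u0 w0 Hw0) as Hne.
apply (cong_mult F N HN _ _ _ _ (RtoC (snd w0)) (/ (num u0 w0 * Cconj (num u0 w0)))%C).
- apply tends_RtoC_snd; auto.
- apply tends_inv; auto.
- apply cong_RtoC_snd; auto.
- apply (cong_inv F N _ _ _ _ Hne Hne Tp Tp').
  apply (cong_mult F N HN _ _ _ _ (num u0 w0) (Cconj (num u0 w0))); auto.
  + apply tends_conj; auto.
  + apply cong_mob_num.
  + apply cong_conj; auto. apply cong_mob_num.
Qed.

Lemma cong_slit_field : cong F N (fun t => field_ (U t) (W t)) (fun t => field_ (U' t) (W' t)).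
Proof.
pose proof (tends_mob_num F U W u0 w0 HU HW) as Tn.
pose proof (tends_mob_num F U' W' u0 w0 HU' HW') as Tn'.
pose proof (tends_mob_den F U W u0 w0 HU HW) as Td.
pose proof (tends_mob_den F U' W' u0 w0 HU' HW') as Td'.
pose proof cong_mob_num as Cn. pose proof cong_mob_den as Cd.
pose proof (mob_num_neq_0 s0 s1 Cf Sf HCS u0 w0 Hw0) as Hne.
pose proof (tends_inv F _ _ Hne Tn) as Ti. pose proof (tends_inv F _ _ Hne Tn') as Ti'.
pose proof (cong_inv F N _ _ _ _ Hne Hne Tn Tn' Cn) as Ci.
pose proof (tends_mult F _ _ _ _ Td Td) as Tdd. pose proof (tends_mult F _ _ _ _ Td' Td') as Tdd'.
pose proof (cong_mult F N HN _ _ _ _ _ _ Td Td' Cd Cd) as Cdd.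
pose proof (cong_mult F N HN _ _ _ _ _ _ Tdd Td' Cdd Cd) as Cddd.
pose proof (tends_mult F _ _ _ _ Tdd Td) as Tddd. pose proof (tends_mult F _ _ _ _ Tdd' Td') as Tddd'.
pose proof (cong_mult F N HN _ _ _ _ _ _ Tddd Ti' Cddd Ci) as C3.
pose proof (tends_mult F _ _ _ _ Tddd' Ti') as T3'.
pose proof (tends_mult F _ _ _ _ Tn' Td') as Tnd'. pose proof (tends_mult F _ _ _ _ Tn' Tn') as Tnn'.
pose proof (cong_mult F N HN _ _ _ _ _ _ Tn Td' Cn Cd) as Cnd.
pose proof (cong_mult F N HN _ _ _ _ _ _ Tn Tn' Cn Cn) as Cnn.
assert (S : forall (k : C) f f' m, tends F f' m -> cong F N f f' -> cong F N (fun t => k * f t)%C (fun t => k * f' t)%C).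
{ intros k f f' m Tf' Cff. apply (cong_mult F N HN (fun _ => k) (fun _ => k) f f' k m); auto.
  - apply tends_const; auto.
  - apply cong_refl; auto. }
unfold slit_field.
apply (cong_plus F N); [apply (cong_plus F N); [apply (cong_plus F N)|]|].
- exact (S _ _ _ _ T3' C3).
- exact (S _ _ _ _ Tdd' Cdd).
- exact (S _ _ _ _ Tnd' Cnd).
- exact (S _ _ _ _ Tnn' Cnn).
Qed.

End CongLimits.

End MatrixFlow.

(** * Rigidity *)

(** A displacement along the conjugate of the derivative [del] produces the increment
    [k * Cmod del ^ 2], which is real and positive; an error of at most half its size cannot cancel
    it. *)
Lemma re_separation (z w del : C) (k : R) : 0 < k -> 0 < Cmod del ->
  Cmod (z - w - del * (RtoC k * Cconj del)) <= Cmod del / 2 * (k * Cmod del) -> fst z <> fst w.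
Proof.
intros Hk Hdel K E.
pose proof (re_le_Cmod (z - w - del * (RtoC k * Cconj del))) as hr.
assert (Ex : Re (z - w - del * (RtoC k * Cconj del)) = - (k * Cmod del ^ 2)).
{ rewrite Cmod_sq. unfold Re. simpl. rewrite E. ring. }
rewrite Ex, Rabs_Ropp, Rabs_pos_eq in hr.
2:{ apply Rmult_le_pos; [lra|apply pow2_ge_0]. }
assert (0 < k * Cmod del ^ 2) by (apply Rmult_lt_0_compat; auto; apply pow_lt; auto).
simpl in *. lra.
Qed.

Section Rigidity.
Context (D : C -> Prop) (phi psi dphi : C -> C) (Hphi : conformal_param D phi psi dphi).
Context (bm1 b0 b1 s0 s1 : R) (Cf Sf : R -> R) (HCS : exp_coeffs (s0 ^ 2 / 4 - s1) Cf Sf).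
Context (h : R -> C -> C) (Hh : is_flow D (sigma_field psi dphi s0 s1) h).
Notation b := (b_field psi dphi bm1 b0 b1).
Notation Q := (poisson s0 Cf Sf).
Notation field_ := (slit_field bm1 b0 b1 s0 s1 Cf Sf).
Notation traj := (half_plane_traj bm1 b0 b1 s0 s1 Cf Sf).
Notation im_ := (inv_mob s0 s1 Cf Sf).
Context (u ut : R -> R) (g gt : R -> C -> C).
Context (Hg : loewner_chain D b h u g) (Hgt : loewner_chain D b h ut gt).
Context (lam : R -> R) (Hlam_cont : cont_nonneg lam) (Hlam_mono : monotone_nonneg lam).
Context (Hlam0 : lam 0 = 0) (Hlam_nonneg : forall t, 0 <= t -> 0 <= lam t).
Context (Hdom : forall t, 0 <= t -> forall z, exist_dom D b h ut (lam t) z <-> exist_dom D b h u t z).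

Lemma lam_le (r s : R) : 0 <= r <= s -> lam r <= lam s.
Proof.
intros Hrs. destruct Hlam_mono as [H|H]; [apply H; lra|].
(* A nonincreasing [lam] that starts at 0 and is nonnegative vanishes identically, so the inequality
   holds in this case too. *)
pose proof (H 0 s ltac:(lra) ltac:(lra)). pose proof (Hlam_nonneg r ltac:(lra)).
pose proof (H 0 r ltac:(lra) ltac:(lra)). pose proof (Hlam_nonneg s ltac:(lra)). lra.
Qed.

Lemma chain_traj_u (t : R) (z : C) : 0 <= t -> exist_dom D b h u t z ->
  traj u t (fun s => psi (g s z)).
Proof.
intros Ht Hz.
exact (chain_traj_half_plane D phi psi dphi Hphi bm1 b0 b1 s0 s1 Cf Sf HCS h Hh u g Hg t z Ht Hz).
Qed.

Lemma chain_traj_ut (t : R) (z : C) : 0 <= t -> exist_dom D b h u t z ->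
  traj ut (lam t) (fun s => psi (gt s z)).
Proof.
intros Ht Hz.
apply (chain_traj_half_plane D phi psi dphi Hphi bm1 b0 b1 s0 s1 Cf Sf HCS h Hh ut gt Hgt); auto.
apply Hdom; auto.
Qed.

Lemma dist_preserved (t : R) (z1 z2 : C) : 0 <= t ->
  exist_dom D b h u t z1 -> exist_dom D b h u t z2 ->
  hyp_dist (psi (g t z1)) (psi (g t z2)) = hyp_dist (psi (gt (lam t) z1)) (psi (gt (lam t) z2)).
Proof.
intros Ht H1 H2. pose proof (Hlam_nonneg t Ht) as Hl.
pose proof (chains_dist_le D phi psi dphi Hphi bm1 b0 b1 s0 s1 Cf Sf HCS h Hh) as Hle.
apply Rle_antisym.
- apply (Hle ut u gt g (lam t) t); auto; try (intros z; apply Hdom; auto); apply Hdom; auto.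
- apply (Hle u ut g gt t (lam t)); auto. intros z; apply Hdom; auto.
Qed.

Lemma exist_dom_u_le (s t : R) (z : C) : 0 <= s <= t ->
  exist_dom D b h u t z -> exist_dom D b h u s z.
Proof.
intros Hs. exact (exist_dom_restrict D psi dphi bm1 b0 b1 h u s t z Hs).
Qed.

Lemma traj_distinct (t : R) (z1 z2 : C) : 0 <= t -> z1 <> z2 ->
  exist_dom D b h u t z1 -> exist_dom D b h u t z2 ->
  forall x, 0 <= x <= t -> psi (g x z1) <> psi (g x z2).
Proof.
intros Ht Hne H1 H2 x Hx E. apply Hne.
apply (chain_inj D phi psi dphi Hphi bm1 b0 b1 h u g Hg x); try lra;
  try (apply exist_dom_u_le with t; auto); auto.
Qed.

(** The distance of two distinct trajectories increases strictly, yet it would be the same at [r]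
    and [s] if [lam] were. Strictness puts [lam t] in the open interval where the trajectories of
    [gt] have a derivative. *)
Lemma lam_lt (r s : R) : 0 <= r < s -> lam r < lam s.
Proof.
intros Hrs. destruct (Rle_lt_or_eq_dec _ _ (lam_le r s ltac:(lra))) as [|E]; auto. exfalso.
assert (Hs : 0 <= s) by lra.
destruct (chain_surj D phi psi dphi Hphi bm1 b0 b1 h u g Hg s (0, 1) Hs) as (z1 & H1 & E1).
{ unfold Hplane; simpl; lra. }
destruct (chain_surj D phi psi dphi Hphi bm1 b0 b1 h u g Hg s (0, 2) Hs) as (z2 & H2 & E2).
{ unfold Hplane; simpl; lra. }
assert (Hne : z1 <> z2).
{ intros ->. rewrite E1 in E2. injection E2. lra. }
destruct (traj_dist_increasing bm1 b0 b1 s0 s1 Cf Sf HCS u s _ _ r s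
  (chain_traj_u s z1 Hs H1) (chain_traj_u s z2 Hs H2) Hrs (Rle_refl s)) as [_ Hlt].
specialize (Hlt (traj_distinct s z1 z2 Hs Hne H1 H2)). cbv beta in Hlt.
rewrite !dist_preserved in Hlt by (auto; try lra; apply exist_dom_u_le with s; auto; lra).
rewrite E in Hlt. lra.
Qed.

Lemma lam_tends (t : R) : 0 < t -> tends (nbhdR t) (fun r => RtoC (lam r)) (RtoC (lam t)).
Proof.
intros Ht eps Heps. destruct (Hlam_cont t ltac:(lra) eps Heps) as (d & Hd & K).
exists (Rmin d t). split; [apply Rmin_glb_lt; lra|]. intros r Hr.
pose proof (Rmin_l d t). pose proof (Rmin_r d t).
rewrite <- RtoC_minus, Cmod_R. apply Rabs_def2 in Hr as Hr'. apply K; lra.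
Qed.

Lemma lam_derive (T t : R) (z1 z2 : C) : 0 < t < T -> z1 <> z2 ->
  exist_dom D b h u T z1 -> exist_dom D b h u T z2 ->
  is_derive lam t (Q (u t) (psi (g t z1)) * Q (u t) (psi (g t z2)) /
    (Q (ut (lam t)) (psi (gt (lam t) z1)) * Q (ut (lam t)) (psi (gt (lam t) z2)))).
Proof.
intros Ht Hne H1 H2. assert (HT : 0 <= T) by lra.
pose proof (chain_traj_u T z1 HT H1) as T1. pose proof (chain_traj_u T z2 HT H2) as T2.
pose proof (chain_traj_ut T z1 HT H1) as T1'. pose proof (chain_traj_ut T z2 HT H2) as T2'.
assert (Hl0 : 0 < lam t) by (rewrite <- Hlam0; apply lam_lt; lra).
assert (Hl1 : lam t < lam T) by (apply lam_lt; lra).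
assert (P1 := proj1 T1 t ltac:(lra)). assert (P2 := proj1 T2 t ltac:(lra)).
assert (P1' := proj1 T1' (lam t) ltac:(lra)). assert (P2' := proj1 T2' (lam t) ltac:(lra)).
cbv beta in P1, P2, P1', P2'.
pose proof (poisson_gt_0 s0 s1 Cf Sf HCS (u t) _ P1) as Q1.
pose proof (poisson_gt_0 s0 s1 Cf Sf HCS (u t) _ P2) as Q2.
pose proof (poisson_gt_0 s0 s1 Cf Sf HCS (ut (lam t)) _ P1') as Q1'.
pose proof (poisson_gt_0 s0 s1 Cf Sf HCS (ut (lam t)) _ P2') as Q2'.
pose proof (hyp_dist_variation bm1 b0 b1 s0 s1 Cf Sf HCS (u t) _ _ t P1 P2
  (proj2 (proj2 T1) t Ht) (proj2 (proj2 T2) t Ht)) as DE.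
pose proof (hyp_dist_variation bm1 b0 b1 s0 s1 Cf Sf HCS (ut (lam t)) _ _ (lam t) P1' P2'
  (proj2 (proj2 T1') (lam t) (conj Hl0 Hl1)) (proj2 (proj2 T2') (lam t) (conj Hl0 Hl1))) as DEt.
cbv beta in DE, DEt.
assert (Heq : forall r, 0 <= r <= T -> hyp_dist (psi (g r z1)) (psi (g r z2)) =
   hyp_dist (psi (gt (lam r) z1)) (psi (gt (lam r) z2))).
{ intros r Hr. apply dist_preserved; try lra; apply exist_dom_u_le with T; auto. }
assert (HE : 0 < hyp_dist (psi (gt (lam t) z1)) (psi (gt (lam t) z2))).
{ rewrite <- Heq by lra. apply hyp_dist_gt_0; auto. apply traj_distinct with T; auto; lra. }
assert (Het : 0 < 2 * hyp_dist (psi (gt (lam t) z1)) (psi (gt (lam t) z2)) *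
   (hyp_dist (psi (gt (lam t) z1)) (psi (gt (lam t) z2)) + 4) *
   (Q (ut (lam t)) (psi (gt (lam t) z1)) * Q (ut (lam t)) (psi (gt (lam t) z2)))).
{ apply Rmult_lt_0_compat; [apply Rmult_lt_0_compat; lra|]. apply Rmult_lt_0_compat; assumption. }
eapply (eq_ind _ (is_derive lam t)).
- eapply is_derive_of_comp; [|exact DE|exact DEt|apply lam_tends; lra|].
  + apply Rgt_not_eq. exact Het.
  + exists (Rmin t (T - t)). split; [apply Rmin_glb_lt; lra|]. intros r Hr.
    pose proof (Rmin_l t (T - t)). pose proof (Rmin_r t (T - t)). apply Rabs_def2 in Hr.
    apply Heq. lra.
- rewrite (Heq t) by lra. eq_in_R. field. lra.
Qed.

(** The points have to survive until [T] and be separated at the earlier time [t]. They are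
    preimages under the map of time [T] of the point (0, 1), of a neighbour shifted in the direction
    required by [re_separation], and of a third point needed to form pairs. *)
Lemma test_points (t T : R) : 0 <= t <= T -> exists z1 z2 z3,
  exist_dom D b h u T z1 /\ exist_dom D b h u T z2 /\ exist_dom D b h u T z3 /\
  z1 <> z2 /\ z1 <> z3 /\ z2 <> z3 /\
  fst (im_ (u t) (psi (g t z1))) <> fst (im_ (u t) (psi (g t z2))).
Proof.
intros Ht. assert (HT : 0 <= T) by lra.
destruct (chain_inverse_exists D phi psi dphi Hphi bm1 b0 b1 h u g Hg T HT) as (inv & Hinv).
assert (Hi : Hplane (0, 1)) by (unfold Hplane; simpl; lra).
destruct (has_cderiv_chain_inverse D phi psi dphi Hphi bm1 b0 b1 s0 s1 Cf Sf HCS h Hh u g Hg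
  T inv (0, 1) HT Hinv Hi) as (e & He & De).
assert (Hz : exist_dom D b h u t (inv (0, 1))) by (apply exist_dom_u_le with T; auto; apply Hinv; auto).
destruct (chain_cderiv D phi psi dphi Hphi bm1 b0 b1 h u g Hg t (inv (0, 1)) (proj1 Ht) Hz) as (d & Dd).
pose proof (chain_cderiv_neq_0 D phi psi dphi Hphi bm1 b0 b1 s0 s1 Cf Sf HCS h Hh u g Hg
  t (inv (0, 1)) d (proj1 Ht) Hz Dd) as Hd.
set (om := psi (g t (inv (0, 1)))).
assert (Hom : Hplane om).
{ apply (chain_half_plane D phi psi dphi Hphi bm1 b0 b1 s0 s1 Cf Sf HCS h Hh u g Hg); auto. lra. }
pose proof (mob_num_neq_0 s0 s1 Cf Sf HCS (u t) om Hom) as Hnum.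
pose proof (mob_den_neq_0 s0 s1 Cf Sf HCS (u t) om Hom) as Hden.
set (M := fun v => (mob_num s0 Cf Sf (u t) v / mob_den s0 s1 Cf Sf (u t) v)%C).
assert (HM : M om <> 0).
{ unfold M. intro E. apply Hnum.
  replace (mob_num s0 Cf Sf (u t) om) with (mob_num s0 Cf Sf (u t) om / mob_den s0 s1 Cf Sf (u t) om
     * mob_den s0 s1 Cf Sf (u t) om)%C by (field; auto). rewrite E. ring. }
pose proof (has_cderiv_inv M om _ HM (has_cderiv_mob s0 s1 Cf Sf HCS (u t) om Hom)) as DJ.
set (dJ := (- / (mob_den s0 s1 Cf Sf (u t) om * mob_den s0 s1 Cf Sf (u t) om) * (/ M om * / M om))%C) in DJ.
assert (HdJ : dJ <> 0).
{ assert (Hinvn : forall x : C, x <> 0 -> 0 < Cmod (/ x)).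
  { intros x Hx. rewrite Cmod_inv by auto. apply Rinv_0_lt_compat, Cmod_gt_0; auto. }
  apply Cmod_gt_0. unfold dJ. rewrite !Cmod_mult, Cmod_opp.
  pose proof (Hinvn _ HM). repeat apply Rmult_lt_0_compat; auto.
  apply Hinvn. apply Cmod_gt_0. rewrite Cmod_mult. apply Cmod_gt_0 in Hden.
  apply Rmult_lt_0_compat; auto. }
pose proof (has_cderiv_comp (fun z => psi (g t z)) inv (0, 1) d e De Dd) as DG.
pose proof (has_cderiv_comp (fun v => / M v)%C (fun w => psi (g t (inv w))) (0, 1) dJ _ DG DJ) as DF.
set (del := (dJ * (d * e))%C) in DF.
assert (Hdel : 0 < Cmod del).
{ unfold del. rewrite !Cmod_mult. apply Cmod_gt_0 in He, Hd, HdJ. repeat apply Rmult_lt_0_compat; auto. }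
assert (Heps : Cmod del / 2 > 0) by lra.
destruct (DF _ Heps) as (r & Hr & K).
(* The shift then stays within the disc of the linear approximation and, being at most 1/2, within
   the half-plane. *)
set (k := Rmin (r / (2 * Cmod del)) (1 / (2 * Cmod del))).
assert (Hk : 0 < k) by (apply Rmin_glb_lt; apply Rdiv_lt_0_compat; lra).
assert (Hk1 : k * Cmod del <= r / 2 /\ k * Cmod del <= 1 / 2).
{ pose proof (Rmin_l (r / (2 * Cmod del)) (1 / (2 * Cmod del))).
  pose proof (Rmin_r (r / (2 * Cmod del)) (1 / (2 * Cmod del))). fold k in H, H0.
  apply Rmult_le_compat_r with (r := Cmod del) in H, H0; try lra.
  replace (r / (2 * Cmod del) * Cmod del) with (r / 2) in H by (field; lra).
  replace (1 / (2 * Cmod del) * Cmod del) with (1 / 2) in H0 by (field; lra). lra. }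
set (w := ((0, 1) + RtoC k * Cconj del)%C).
assert (Ew : (w - (0, 1))%C = (RtoC k * Cconj del)%C) by (unfold w; ring).
assert (Mw : Cmod (w - (0, 1)) = k * Cmod del).
{ rewrite Ew, Cmod_mult, Cmod_conj, Cmod_R, Rabs_pos_eq; lra. }
assert (Hwp : Hplane w).
{ pose proof (im_le_Cmod (w - (0, 1))) as hi. rewrite Mw in hi. simpl in hi.
  apply Rabs_le_between in hi. unfold Hplane, Defs.Im. change (0 < snd w). simpl. lra. }
specialize (K w). change (Cmod (w - (0, 1)) < r ->
  Cmod (/ M (psi (g t (inv w))) - / M om - del * (w - (0, 1))) <= Cmod del / 2 * Cmod (w - (0, 1))) in K.
specialize (K ltac:(lra)). rewrite Mw, Ew in K.
assert (EJ : forall v, Hplane v -> im_ (u t) v = (- / M v)%C).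
{ intros v Hv. pose proof (mob_num_neq_0 s0 s1 Cf Sf HCS (u t) v Hv).
  pose proof (mob_den_neq_0 s0 s1 Cf Sf HCS (u t) v Hv). unfold inv_mob, M. field; auto. }
assert (Hzw : exist_dom D b h u t (inv w)) by (apply exist_dom_u_le with T; auto; apply Hinv; auto).
assert (Hvw : Hplane (psi (g t (inv w)))).
{ apply (chain_half_plane D phi psi dphi Hphi bm1 b0 b1 s0 s1 Cf Sf HCS h Hh u g Hg); auto. lra. }
assert (Hre : fst (/ M (psi (g t (inv w))))%C <> fst (/ M om)%C).
{ exact (re_separation _ _ del k Hk Hdel K). }
assert (Hinj : forall v v', Hplane v -> Hplane v' -> inv v = inv v' -> v = v').
{ intros v v' Hv Hv' E. rewrite <- (proj2 (Hinv v Hv)), <- (proj2 (Hinv v' Hv')), E. reflexivity. }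
(* The height [2 + snd w] differs both from 1 and from [snd w]. *)
assert (H3 : Hplane (0, 2 + snd w)).
{ assert (Hsw : 0 < snd w) by exact Hwp. change (0 < 2 + snd w). lra. }
exists (inv (0, 1)), (inv w), (inv (0, 2 + snd w)).
assert (Hsw : 0 < snd w) by exact Hwp.
split; [apply Hinv; auto|]. split; [apply Hinv; auto|]. split; [apply Hinv; auto|].
split; [|split; [|split]].
- intro E. apply Hinj in E; auto. apply Hre. rewrite <- E. reflexivity.
- intro E. apply Hinj in E; auto. apply (f_equal snd) in E. change (1 = 2 + snd w) in E. lra.
- intro E. apply Hinj in E; auto. apply (f_equal snd) in E. change (snd w = 2 + snd w) in E. lra.
- fold om. rewrite !EJ by auto. intro E. apply Hre.
  apply (f_equal Ropp) in E.
  change (- - fst (/ M om)%C = - - fst (/ M (psi (g t (inv w))))%C) in E. lra.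
Qed.

Lemma cont_nonneg_tends (f : R -> R) (t0 T s : R) : cont_nonneg f -> 0 <= t0 -> t0 <= s <= T ->
  tends (nbhdI t0 T s) (fun r => RtoC (f r)) (RtoC (f s)).
Proof.
intros Hf H0 Hs eps Heps. destruct (Hf s ltac:(lra) eps Heps) as (d & Hd & K).
exists d. split; auto. intros r Hr Hrs. rewrite <- RtoC_minus, Cmod_R. apply K; lra.
Qed.

Lemma tends_reparam (T s : R) (w : R -> C) : 0 <= s <= T -> traj ut (lam T) w ->
  tends (nbhdI 0 T s) (fun r => w (lam r)) (w (lam s)).
Proof.
intros Hs Hw eps Heps.
assert (Hl : 0 <= lam s <= lam T) by (split; [apply Hlam_nonneg|apply lam_le]; lra).
destruct (proj1 (proj2 Hw) (lam s) Hl eps Heps) as (d & Hd & K).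
generalize (cont_nonneg_tends lam 0 T s Hlam_cont (Rle_refl 0) Hs d Hd).
intros (d' & Hd' & K'). exists d'. split; auto. intros r Hr Hrs. specialize (K' r Hr Hrs).
rewrite <- RtoC_minus, Cmod_R in K'. apply K; auto.
split; [apply Hlam_nonneg|apply lam_le]; lra.
Qed.

(** The pairs (z1, z3) and (z2, z3) yield the same derivative of [lam], and the kernels at [z3]
    cancel. *)
Lemma ratio_identity (T t : R) (z1 z2 z3 : C) : 0 < t < T ->
  z1 <> z2 -> z1 <> z3 -> z2 <> z3 ->
  exist_dom D b h u T z1 -> exist_dom D b h u T z2 -> exist_dom D b h u T z3 ->
  Q (u t) (psi (g t z1)) * Q (ut (lam t)) (psi (gt (lam t) z2)) =
  Q (u t) (psi (g t z2)) * Q (ut (lam t)) (psi (gt (lam t) z1)).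
Proof.
intros Ht N12 N13 N23 H1 H2 H3.
assert (HT : 0 <= T) by lra.
pose proof (lam_derive T t z1 z3 Ht N13 H1 H3) as D13.
pose proof (lam_derive T t z2 z3 Ht N23 H2 H3) as D23.
apply is_derive_unique in D13, D23. rewrite D13 in D23.
assert (Hl : 0 <= lam t <= lam T) by (split; [apply Hlam_nonneg|apply lam_le]; lra).
assert (HQ : forall z, exist_dom D b h u T z ->
  0 < Q (u t) (psi (g t z)) /\ 0 < Q (ut (lam t)) (psi (gt (lam t) z))).
{ intros z Hz. split; apply (poisson_gt_0 s0 s1 Cf Sf HCS).
  - apply (chain_traj_u T z HT Hz). lra.
  - apply (chain_traj_ut T z HT Hz). auto. }
destruct (HQ z1 H1) as [q1 p1]. destruct (HQ z2 H2) as [q2 p2]. destruct (HQ z3 H3) as [q3 p3].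
set (x1 := Q (u t) (psi (g t z1))) in *. set (x2 := Q (u t) (psi (g t z2))) in *.
set (x3 := Q (u t) (psi (g t z3))) in *.
set (y1 := Q (ut (lam t)) (psi (gt (lam t) z1))) in *.
set (y2 := Q (ut (lam t)) (psi (gt (lam t) z2))) in *.
set (y3 := Q (ut (lam t)) (psi (gt (lam t) z3))) in *.
clearbody x1 x2 x3 y1 y2 y3.
apply (f_equal (fun x => x * (y1 * y2 * y3 / x3))) in D23.
replace (x1 * x3 / (y1 * y3) * (y1 * y2 * y3 / x3)) with (x1 * y2) in D23 by (field; lra).
replace (x2 * x3 / (y2 * y3) * (y1 * y2 * y3 / x3)) with (x2 * y1) in D23 by (field; lra).
exact D23.
Qed.

Section DrivingTerms.
Context {T : Type} (F : (T -> Prop) -> Prop) {FF : Filter F} (N : T -> R) (HN : forall x, 0 <= N x).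
Context (U U' : T -> R) (u0 : R).
Context (HU : tends F (fun t => RtoC (U t)) (RtoC u0)) (HU' : tends F (fun t => RtoC (U' t)) (RtoC u0)).
Context (W1 W2 V1 V2 : T -> C) (o1 o2 : C) (Ho1 : Hplane o1) (Ho2 : Hplane o2).
Context (TW1 : tends F W1 o1) (TW2 : tends F W2 o2) (TV1 : tends F V1 o1) (TV2 : tends F V2 o2).
Context (C1 : cong F N V1 W1) (C2 : cong F N V2 W2).
Context (Hratio : F (fun t => Q (U t) (W1 t) * Q (U' t) (V2 t) = Q (U t) (W2 t) * Q (U' t) (V1 t))).
Context (Hre : fst (im_ u0 o1) <> fst (im_ u0 o2)).

(* The ratio of the Poisson kernels at two points with different real parts of
   [inv_mob] determines the driving term, with non-zero derivative. *)
Lemma driving_terms_cong : cong F N (fun t => RtoC (U' t)) (fun t => RtoC (U t)).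
Proof.
set (v := fun t => U' t - U t).
assert (Tv : tends F (fun t => RtoC (v t)) (RtoC 0)).
{ exact (tends_shift F U' U u0 HU' HU). }
assert (DS : is_derive Sf 0 1).
{ destruct HCS as (E & _ & _ & H). rewrite <- E. apply H. }
assert (S0 : Sf 0 = 0) by apply HCS.
pose proof (tends_nbhdR_comp F Sf v 0 1 DS Tv) as TS. rewrite S0 in TS.
pose proof (tends_nbhdR_comp F (ca s0 Cf Sf) v 0 _ (is_derive_ca s0 s1 Cf Sf HCS 0) Tv) as Ta.
rewrite (proj1 (mob_at_0 s0 s1 Cf Sf HCS)) in Ta.
pose proof (tends_poisson s0 s1 Cf Sf HCS F U W1 u0 o1 Ho1 HU TW1) as Tq1.
pose proof (tends_poisson s0 s1 Cf Sf HCS F U W2 u0 o2 Ho2 HU TW2) as Tq2.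
pose proof (tends_poisson s0 s1 Cf Sf HCS F U' W1 u0 o1 Ho1 HU' TW1) as Tp1.
pose proof (tends_poisson s0 s1 Cf Sf HCS F U' W2 u0 o2 Ho2 HU' TW2) as Tp2.
pose proof (tends_poisson s0 s1 Cf Sf HCS F U' V1 u0 o1 Ho1 HU' TV1) as Tr1.
pose proof (tends_poisson s0 s1 Cf Sf HCS F U' V2 u0 o2 Ho2 HU' TV2) as Tr2.
pose proof (cong_refl F N (fun t => RtoC (U' t))) as CU.
pose proof (cong_poisson s0 s1 Cf Sf HCS F N HN U' U' V1 W1 u0 o1 Ho1 HU' TV1 HU' TW1 CU C1) as Cp1.
pose proof (cong_poisson s0 s1 Cf Sf HCS F N HN U' U' V2 W2 u0 o2 Ho2 HU' TV2 HU' TW2 CU C2) as Cp2.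
pose proof (tends_inv_mob s0 s1 Cf Sf HCS F U W1 u0 o1 Ho1 HU TW1) as TJ1.
pose proof (tends_inv_mob s0 s1 Cf Sf HCS F U W2 u0 o2 Ho2 HU TW2) as TJ2.
set (q1 := fun t => Q (U t) (W1 t)) in *. set (q2 := fun t => Q (U t) (W2 t)) in *.
set (p1 := fun t => Q (U' t) (W1 t)) in *. set (p2 := fun t => Q (U' t) (W2 t)) in *.
set (J1 := fun t => im_ (U t) (W1 t)) in *. set (J2 := fun t => im_ (U t) (W2 t)) in *.
(* The ratio hypothesis evaluates the second kernels at [V1] and [V2]; moving them to [W1] and [W2]
   costs O(N). *)
assert (CX : cong F N (fun t => RtoC (q1 t) * RtoC (p2 t) - RtoC (q2 t) * RtoC (p1 t))%C (fun _ => RtoC 0)).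
{ apply (cong_trans F N _ (fun t => RtoC (q1 t) * RtoC (Q (U' t) (V2 t))
     + (- RtoC (q2 t)) * RtoC (Q (U' t) (V1 t)))%C).
  - apply (cong_trans F N _ (fun t => RtoC (q1 t) * RtoC (p2 t) + (- RtoC (q2 t)) * RtoC (p1 t))%C).
    { apply cong_of_eq; auto. apply filter_forall. intros t. ring. }
    apply cong_plus; auto.
    + apply (cong_mult F N HN _ _ _ _ _ _ Tq1 Tr2); [apply cong_refl; auto|apply cong_sym; auto].
    + apply (cong_mult F N HN _ _ _ _ _ _ (tends_opp F _ _ Tq2) Tr1);
        [apply cong_refl; auto|apply cong_sym; auto].
  - apply cong_of_eq; auto. revert Hratio. apply filter_imp. intros t Ht.
    change (q1 t * Q (U' t) (V2 t) = q2 t * Q (U' t) (V1 t)) in Ht.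
    rewrite <- RtoC_mult, Ht, RtoC_mult. ring. }
(* By [poisson_shift] at both points, [q1 * p2 - q2 * p1] equals [Sf v * p1 * p2 * B] exactly, and
   [B] tends to twice the difference of the real parts of [j1] and [j2], which is not zero. Division
   gives [Sf v], hence [v], as O(N). *)
set (B := fun t => (RtoC 2 * RtoC (ca s0 Cf Sf (v t)) * (RtoC (fst (J1 t)) - RtoC (fst (J2 t)))
  + RtoC (Sf (v t)) * (RtoC (fst (J1 t)) * RtoC (fst (J1 t)) + RtoC (snd (J1 t)) * RtoC (snd (J1 t))
     - (RtoC (fst (J2 t)) * RtoC (fst (J2 t)) + RtoC (snd (J2 t)) * RtoC (snd (J2 t)))))%C).
set (j1 := im_ u0 o1) in *. set (j2 := im_ u0 o2) in *.
assert (TB : tends F B (RtoC 2 * (RtoC (fst j1) - RtoC (fst j2)))%C).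
{ pose proof (tends_RtoC_fst F _ _ TJ1) as R1. pose proof (tends_RtoC_snd F _ _ TJ1) as I1.
  pose proof (tends_RtoC_fst F _ _ TJ2) as R2. pose proof (tends_RtoC_snd F _ _ TJ2) as I2.
  eapply tends_eq.
  - apply tends_plus; auto.
    + apply tends_mult; auto; [apply tends_mult; auto; [apply tends_const; auto|exact Ta]|].
      apply tends_minus; eauto.
    + apply tends_mult; auto; [exact TS|].
      apply tends_minus; auto; apply tends_plus; auto; apply tends_mult; eauto.
  - ring. }
assert (HB0 : (RtoC 2 * (RtoC (fst j1) - RtoC (fst j2)))%C <> 0).
{ rewrite <- RtoC_minus, <- RtoC_mult. intro E. apply RtoC_inj in E. lra. }
assert (Tden : tends F (fun t => RtoC (p1 t) * RtoC (p2 t) * B t)%C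
   (RtoC (Q u0 o1) * RtoC (Q u0 o2) * (RtoC 2 * (RtoC (fst j1) - RtoC (fst j2))))%C).
{ apply tends_mult; auto. apply tends_mult; auto. }
assert (Hden : (RtoC (Q u0 o1) * RtoC (Q u0 o2) * (RtoC 2 * (RtoC (fst j1) - RtoC (fst j2))))%C <> 0).
{ pose proof (poisson_gt_0 s0 s1 Cf Sf HCS u0 o1 Ho1). pose proof (poisson_gt_0 s0 s1 Cf Sf HCS u0 o2 Ho2).
  apply Cmod_gt_0. rewrite !Cmod_mult. apply Cmod_gt_0 in HB0. rewrite Cmod_mult in HB0.
  apply Rmult_lt_0_compat; auto. rewrite !Cmod_R, !Rabs_pos_eq by lra.
  apply Rmult_lt_0_compat; auto. }
assert (CS : cong F N (fun t => RtoC (Sf (v t))) (fun _ => RtoC 0)).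
{ apply (cong_trans F N _ (fun t => (RtoC (q1 t) * RtoC (p2 t) - RtoC (q2 t) * RtoC (p1 t))
     * / (RtoC (p1 t) * RtoC (p2 t) * B t))%C).
  - apply cong_of_eq; auto.
    generalize (filter_and _ _ (tends_away F _ _ Hden Tden)
      (filter_and _ _ (tends_Hplane F W1 o1 Ho1 TW1) (tends_Hplane F W2 o2 Ho2 TW2))).
    apply filter_imp. intros t (Hne & H1 & H2).
    assert (Hn : (RtoC (p1 t) * RtoC (p2 t) * B t)%C <> 0).
    { apply Cmod_gt_0. eapply Rle_lt_trans; [|exact Hne].
      apply Rdiv_le_0_compat; [apply Cmod_ge_0|lra]. }
    assert (E : (RtoC (q1 t) * RtoC (p2 t) - RtoC (q2 t) * RtoC (p1 t)
       = RtoC (Sf (v t)) * (RtoC (p1 t) * RtoC (p2 t) * B t))%C).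
    { pose proof (poisson_shift s0 s1 Cf Sf HCS (U t) (v t) (W1 t) H1) as e1.
      pose proof (poisson_shift s0 s1 Cf Sf HCS (U t) (v t) (W2 t) H2) as e2.
      replace (v t + U t) with (U' t) in e1, e2 by (unfold v; ring).
      change (q1 t = p1 t * ((ca s0 Cf Sf (v t) + Sf (v t) * fst (J1 t)) ^ 2 + (Sf (v t) * snd (J1 t)) ^ 2)) in e1.
      change (q2 t = p2 t * ((ca s0 Cf Sf (v t) + Sf (v t) * fst (J2 t)) ^ 2 + (Sf (v t) * snd (J2 t)) ^ 2)) in e2.
      unfold B. rewrite e1, e2. rewrite <- !RtoC_minus, <- !RtoC_mult, <- !RtoC_plus, <- !RtoC_minus,
        <- !RtoC_mult, <- !RtoC_plus, <- !RtoC_mult. f_equal. ring. }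
    rewrite E. field. apply Cmod_gt_0 in Hn. rewrite !Cmod_mult in Hn.
    pose proof (Cmod_ge_0 (p1 t)). pose proof (Cmod_ge_0 (p2 t)). pose proof (Cmod_ge_0 (B t)).
    repeat split; intro Ez; rewrite Ez, Cmod_0 in Hn; lra.
  - apply (cong_trans F N _ (fun t => RtoC 0 * / (RtoC (p1 t) * RtoC (p2 t) * B t))%C).
    + apply (cong_mult F N HN _ _ _ _
        (RtoC (Q u0 o1) * RtoC (Q u0 o2) - RtoC (Q u0 o2) * RtoC (Q u0 o1))%C
        (/ (RtoC (Q u0 o1) * RtoC (Q u0 o2) * (RtoC 2 * (RtoC (fst j1) - RtoC (fst j2)))))%C).
      * apply tends_minus; auto; apply tends_mult; auto.
      * apply tends_inv; auto.
      * exact CX.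
      * apply cong_refl; auto.
    + apply cong_of_eq; auto. apply filter_forall. intros t. ring. }
pose proof (cong_derivable_inv F N Sf v DS S0 Tv CS) as Cv.
apply (cong_trans F N _ (fun t => RtoC (v t) + RtoC (U t))%C).
- apply cong_of_eq; auto. apply filter_forall. intros t. rewrite <- RtoC_plus. f_equal. unfold v. ring.
- apply (cong_trans F N _ (fun t => RtoC 0 + RtoC (U t))%C).
  + apply cong_plus; auto. apply cong_refl; auto.
  + apply cong_of_eq; auto. apply filter_forall. intros t. ring.
Qed.

End DrivingTerms.

(** With [N] the displacement of two trajectories, the differences of driving terms and of vector
    fields and the deviation of [lam'] from 1 are all O(N) to the right of [t0]. The displacement
    thus satisfies a linear differential inequality with zero initial value. *)
Lemma local_rigidity (t0 : R) : 0 <= t0 -> lam t0 = t0 -> ut t0 = u t0 ->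
  (forall z, exist_dom D b h u t0 z -> gt t0 z = g t0 z) ->
  exists eta, 0 < eta /\ forall t, t0 <= t <= t0 + eta -> lam t = t /\ ut (lam t) = u t.
Proof.
intros Ht0 El Eu Eg.
set (T := t0 + 1). assert (HT : 0 <= T) by (unfold T; lra).
assert (Ht0T : 0 <= t0 <= T) by (unfold T; lra).
destruct (test_points t0 T Ht0T) as (z1 & z2 & z3 & H1 & H2 & H3 & N12 & N13 & N23 & Hre).
set (W1 := fun t => psi (g t z1)). set (W2 := fun t => psi (g t z2)).
set (V1 := fun t => psi (gt (lam t) z1)). set (V2 := fun t => psi (gt (lam t) z2)).
(* Right neighbourhoods of [t0]: this covers [t0 = 0] and uses no information from earlier times. *)
set (F := nbhdI t0 T t0).
assert (FF : Filter F) by apply nbhdI_filter.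
set (N := fun t => Cmod (V1 t - W1 t) + Cmod (V2 t - W2 t)).
assert (HN : forall t, 0 <= N t).
{ intros t. unfold N. pose proof (Cmod_ge_0 (V1 t - W1 t)). pose proof (Cmod_ge_0 (V2 t - W2 t)). lra. }
pose proof (chain_traj_u T z1 HT H1) as K1. pose proof (chain_traj_u T z2 HT H2) as K2.
pose proof (chain_traj_ut T z1 HT H1) as K1'. pose proof (chain_traj_ut T z2 HT H2) as K2'.
assert (CW1 : forall s, 0 <= s <= T -> tends (nbhdI 0 T s) W1 (W1 s)).
{ intros s Hs. exact (traj_tends bm1 b0 b1 s0 s1 Cf Sf u T s _ K1 Hs). }
assert (CW2 : forall s, 0 <= s <= T -> tends (nbhdI 0 T s) W2 (W2 s)).
{ intros s Hs. exact (traj_tends bm1 b0 b1 s0 s1 Cf Sf u T s _ K2 Hs). }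
assert (CV1 : forall s, 0 <= s <= T -> tends (nbhdI 0 T s) V1 (V1 s)).
{ intros s Hs. exact (tends_reparam T s _ Hs K1'). }
assert (CV2 : forall s, 0 <= s <= T -> tends (nbhdI 0 T s) V2 (V2 s)).
{ intros s Hs. exact (tends_reparam T s _ Hs K2'). }
assert (Hsub : forall (f : R -> C) (l : C) s c, 0 <= c <= T -> t0 <= s ->
   tends (nbhdI 0 T s) f l -> tends (nbhdI t0 c s) f l).
{ intros f l s c Hc Hs Tf eps Heps. apply nbhdI_subset with 0 T; [lra|lra|]. apply Tf; auto. }
set (o1 := W1 t0). set (o2 := W2 t0).
assert (E1 : V1 t0 = o1).
{ unfold V1, o1, W1. rewrite El, Eg; auto. apply exist_dom_u_le with T; auto. }
assert (E2 : V2 t0 = o2).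
{ unfold V2, o2, W2. rewrite El, Eg; auto. apply exist_dom_u_le with T; auto. }
assert (Ho1 : Hplane o1) by (apply (proj1 K1); auto).
assert (Ho2 : Hplane o2) by (apply (proj1 K2); auto).
assert (TW1 : tends F W1 o1) by (apply Hsub; [lra|lra|]; apply CW1; auto).
assert (TW2 : tends F W2 o2) by (apply Hsub; [lra|lra|]; apply CW2; auto).
assert (TV1 : tends F V1 o1) by (rewrite <- E1; apply Hsub; [lra|lra|]; apply CV1; auto).
assert (TV2 : tends F V2 o2) by (rewrite <- E2; apply Hsub; [lra|lra|]; apply CV2; auto).
set (U := u). set (U' := fun t => ut (lam t)).
assert (HU : tends F (fun t => RtoC (U t)) (RtoC (u t0))).
{ apply (cont_nonneg_tends u t0 T t0); auto; [apply Hg|lra]. }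
assert (HU' : tends F (fun t => RtoC (U' t)) (RtoC (u t0))).
{ intros eps Heps. destruct (proj1 Hgt t0 Ht0 eps Heps) as (d & Hd & K).
  destruct (cont_nonneg_tends lam t0 T t0 Hlam_cont Ht0 ltac:(lra) d Hd) as (d' & Hd' & K').
  exists d'. split; auto. intros r Hr Hrs. specialize (K' r Hr Hrs).
  rewrite <- RtoC_minus, Cmod_R, El in K'. rewrite <- RtoC_minus, Cmod_R.
  unfold U'. rewrite <- Eu. apply K; auto. apply Hlam_nonneg; lra. }
assert (C1 : cong F N V1 W1).
{ exists 1. split; [lra|]. apply filter_forall. intros t. unfold N.
  pose proof (Cmod_ge_0 (V2 t - W2 t)). lra. }
assert (C2 : cong F N V2 W2).
{ exists 1. split; [lra|]. apply filter_forall. intros t. unfold N.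
  pose proof (Cmod_ge_0 (V1 t - W1 t)). lra. }
(* At [t0] itself, possibly 0, [ratio_identity] is replaced by the assumed agreement of points and
   driving terms. *)
assert (Hratio : F (fun t => Q (U t) (W1 t) * Q (U' t) (V2 t) = Q (U t) (W2 t) * Q (U' t) (V1 t))).
{ exists 1. split; [lra|]. intros t Ht Htt. destruct (Req_dec t t0) as [->|n].
  - rewrite E1, E2. unfold U', U. rewrite El, Eu. fold o1 o2. ring.
  - apply Rabs_def2 in Htt. apply (ratio_identity T t z1 z2 z3); auto. unfold T; lra. }
pose proof (driving_terms_cong F N HN U U' (u t0) HU HU' W1 W2 V1 V2 o1 o2 Ho1 Ho2
  TW1 TW2 TV1 TV2 C1 C2 Hratio Hre) as CU.
pose proof (cong_slit_field bm1 b0 b1 s0 s1 Cf Sf HCS F N HN U' U V1 W1 (u t0) o1 Ho1 HU' TV1 HU TW1 CU C1) as CF1.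
pose proof (cong_slit_field bm1 b0 b1 s0 s1 Cf Sf HCS F N HN U' U V2 W2 (u t0) o2 Ho2 HU' TV2 HU TW2 CU C2) as CF2.
pose proof (cong_poisson s0 s1 Cf Sf HCS F N HN U' U V1 W1 (u t0) o1 Ho1 HU' TV1 HU TW1 CU C1) as CQ1.
pose proof (cong_poisson s0 s1 Cf Sf HCS F N HN U' U V2 W2 (u t0) o2 Ho2 HU' TV2 HU TW2 CU C2) as CQ2.
pose proof (tends_poisson s0 s1 Cf Sf HCS F U W1 (u t0) o1 Ho1 HU TW1) as Tq1.
pose proof (tends_poisson s0 s1 Cf Sf HCS F U W2 (u t0) o2 Ho2 HU TW2) as Tq2.
pose proof (tends_poisson s0 s1 Cf Sf HCS F U' V1 (u t0) o1 Ho1 HU' TV1) as Tp1.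
pose proof (tends_poisson s0 s1 Cf Sf HCS F U' V2 (u t0) o2 Ho2 HU' TV2) as Tp2.
(* The derivative of [lam] for [t > t0]. Numerator and denominator have the same limit and differ by
   O(N), so [L] is 1 up to O(N). *)
set (L := fun t => Q (U t) (W1 t) * Q (U t) (W2 t) / (Q (U' t) (V1 t) * Q (U' t) (V2 t))).
set (q0 := RtoC (Q (u t0) o1 * Q (u t0) o2)).
assert (Hq0 : q0 <> 0).
{ unfold q0. intro E. apply RtoC_inj in E.
  pose proof (poisson_gt_0 s0 s1 Cf Sf HCS (u t0) o1 Ho1). pose proof (poisson_gt_0 s0 s1 Cf Sf HCS (u t0) o2 Ho2).
  assert (0 < Q (u t0) o1 * Q (u t0) o2) by (apply Rmult_lt_0_compat; auto). lra. }
assert (Tq : tends F (fun t => RtoC (Q (U t) (W1 t)) * RtoC (Q (U t) (W2 t)))%C q0).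
{ unfold q0. rewrite RtoC_mult. apply tends_mult; auto. }
assert (Tp : tends F (fun t => RtoC (Q (U' t) (V1 t)) * RtoC (Q (U' t) (V2 t)))%C q0).
{ unfold q0. rewrite RtoC_mult. apply tends_mult; auto. }
assert (Cqp : cong F N (fun t => RtoC (Q (U' t) (V1 t)) * RtoC (Q (U' t) (V2 t)))%C
   (fun t => RtoC (Q (U t) (W1 t)) * RtoC (Q (U t) (W2 t)))%C).
{ exact (cong_mult F N HN _ _ _ _ _ _ Tp1 Tq2 CQ1 CQ2). }
assert (EL : F (fun t => RtoC (L t) = (RtoC (Q (U t) (W1 t)) * RtoC (Q (U t) (W2 t))
   * / (RtoC (Q (U' t) (V1 t)) * RtoC (Q (U' t) (V2 t))))%C)).
{ generalize (tends_away F _ _ Hq0 Tp). apply filter_imp. intros t Ht.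
  unfold L. rewrite <- !RtoC_mult in *. rewrite RtoC_quotient; auto.
  intro E. rewrite E, Cmod_0 in Ht. pose proof (Cmod_ge_0 q0). lra. }
assert (TL : tends F (fun t => RtoC (L t)) (q0 * / q0)%C).
{ eapply tends_ext; [auto| |apply tends_mult; [auto|exact Tq|apply tends_inv; [auto|exact Hq0|exact Tp]]].
  revert EL. apply filter_imp. intros t ->. reflexivity. }
assert (CL : cong F N (fun t => RtoC (L t)) (fun _ => RtoC 1)).
{ apply (cong_trans F N _ (fun t => RtoC (Q (U t) (W1 t)) * RtoC (Q (U t) (W2 t))
   * / (RtoC (Q (U' t) (V1 t)) * RtoC (Q (U' t) (V2 t))))%C); [apply cong_of_eq; auto|].
  apply (cong_trans F N _ (fun t => RtoC (Q (U' t) (V1 t)) * RtoC (Q (U' t) (V2 t))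
   * / (RtoC (Q (U' t) (V1 t)) * RtoC (Q (U' t) (V2 t))))%C).
  - apply (cong_mult F N HN _ _ _ _ q0 (/ q0)%C); auto.
    + apply tends_inv; auto.
    + apply cong_sym; auto.
    + apply cong_refl; auto.
  - apply cong_of_eq; auto. generalize (tends_away F _ _ Hq0 Tp). apply filter_imp. intros t Ht.
    assert (Hne : (RtoC (Q (U' t) (V1 t)) * RtoC (Q (U' t) (V2 t)))%C <> 0).
    { apply Cmod_gt_0. pose proof (Cmod_ge_0 q0). lra. }
    apply Cinv_r; auto. }
pose proof (tends_mob_num s0 s1 Cf Sf HCS F U W1 (u t0) o1 HU TW1) as Tn1.
assert (Hfield : forall V W o, Hplane o -> tends F W o ->
  cong F N (fun t => field_ (U' t) (V t)) (fun t => field_ (U t) (W t)) ->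
  cong F N (fun t => RtoC (L t) * field_ (U' t) (V t))%C (fun t => field_ (U t) (W t))).
{ intros V W o Ho TW CF.
  assert (Tf : tends F (fun t => field_ (U t) (W t)) (field_ (u t0) o)).
  { pose proof (tends_mob_num s0 s1 Cf Sf HCS F U W (u t0) o HU TW) as Tn.
    pose proof (tends_mob_den s0 s1 Cf Sf HCS F U W (u t0) o HU TW) as Td.
    pose proof (mob_num_neq_0 s0 s1 Cf Sf HCS (u t0) o Ho) as Hne.
    pose proof (tends_inv F _ _ Hne Tn) as Ti.
    assert (Tk : forall k : C, tends F (fun _ => k) k) by (intros; apply tends_const; auto).
    unfold slit_field.
    apply (tends_plus F); [apply (tends_plus F); [apply (tends_plus F)|]|].
    - apply (tends_mult F); [apply Tk|].
      exact (tends_mult F _ _ _ _ (tends_mult F _ _ _ _ (tends_mult F _ _ _ _ Td Td) Td) Ti).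
    - exact (tends_mult F _ _ _ _ (Tk _) (tends_mult F _ _ _ _ Td Td)).
    - exact (tends_mult F _ _ _ _ (Tk _) (tends_mult F _ _ _ _ Tn Td)).
    - exact (tends_mult F _ _ _ _ (Tk _) (tends_mult F _ _ _ _ Tn Tn)). }
  apply (cong_trans F N _ (fun t => RtoC 1 * field_ (U t) (W t))%C).
  - exact (cong_mult F N HN _ _ _ _ _ _ TL Tf CL CF).
  - apply cong_of_eq; auto. apply filter_forall. intros t. ring. }
destruct (Hfield V1 W1 o1 Ho1 TW1 CF1) as (k1 & Hk1 & B1).
destruct (Hfield V2 W2 o2 Ho2 TW2 CF2) as (k2 & Hk2 & B2).
destruct CU as (k3 & Hk3 & B3). destruct CL as (k4 & Hk4 & B4).
(* One radius [del] is extracted for all four O(N) bounds; from here on the argument takes place on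
   an honest interval of length [eta]. *)
destruct (filter_and _ _ (filter_and _ _ B1 B2) (filter_and _ _ B3 B4)) as (del & Hdel & Hall).
set (eta := Rmin (del / 2) (1 / 2)).
assert (Heta : 0 < eta) by (apply Rmin_glb_lt; lra).
assert (Heta1 : eta <= del / 2) by apply Rmin_l. assert (Heta2 : eta <= 1 / 2) by apply Rmin_r.
assert (Hb : forall t, t0 <= t <= t0 + eta -> t0 <= t <= T /\ Rabs (t - t0) < del).
{ intros t Ht. split; [unfold T; lra|]. rewrite Rabs_pos_eq; lra. }
set (D1 := fun t => (V1 t - W1 t)%C). set (D2 := fun t => (V2 t - W2 t)%C).
set (d1 := fun t => (RtoC (L t) * field_ (U' t) (V1 t) - field_ (U t) (W1 t))%C).
set (d2 := fun t => (RtoC (L t) * field_ (U' t) (V2 t) - field_ (U t) (W2 t))%C).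
assert (Hlam' : forall t, t0 < t < t0 + eta -> is_derive lam t (L t)).
{ intros t Ht. apply (lam_derive T t z1 z2); auto. unfold T; lra. }
assert (Hlt : forall t, t0 < t < t0 + eta -> 0 < lam t < lam T).
{ intros t Ht. split; [rewrite <- Hlam0|]; apply lam_lt; unfold T; lra. }
assert (DD1 : forall t, t0 < t < t0 + eta -> has_tderiv D1 t (d1 t)).
{ intros t Ht. apply has_tderiv_minus.
  - apply (has_tderiv_reparam (fun s => psi (gt s z1)) lam t (L t)); auto.
    apply (proj2 (proj2 K1') (lam t) (Hlt t Ht)).
  - apply (proj2 (proj2 K1) t). unfold T; lra. }
assert (DD2 : forall t, t0 < t < t0 + eta -> has_tderiv D2 t (d2 t)).
{ intros t Ht. apply has_tderiv_minus.
  - apply (has_tderiv_reparam (fun s => psi (gt s z2)) lam t (L t)); auto.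
    apply (proj2 (proj2 K2') (lam t) (Hlt t Ht)).
  - apply (proj2 (proj2 K2) t). unfold T; lra. }
set (M := fun t => fst (D1 t) ^ 2 + snd (D1 t) ^ 2 + (fst (D2 t) ^ 2 + snd (D2 t) ^ 2)).
set (dM := fun t => 2 * (fst (D1 t) * fst (d1 t) + snd (D1 t) * snd (d1 t))
   + 2 * (fst (D2 t) * fst (d2 t) + snd (D2 t) * snd (d2 t))).
assert (EM : forall t, M t = Cmod (D1 t) ^ 2 + Cmod (D2 t) ^ 2) by (intros t; rewrite !Cmod_sq; reflexivity).
assert (M0 : forall t, t0 <= t <= t0 + eta -> M t = 0).
(* By Cauchy-Schwarz [dM] is at most [2 * (k1 * A1 + k2 * A2) * (A1 + A2)], and each
   [Ai * (A1 + A2)] is at most [2 * M]; this is the origin of [4 * (k1 + k2)]. *)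
{ apply (gronwall_zero M dM t0 (t0 + eta) (4 * (k1 + k2))).
  - intros s Hs.
    assert (TD : tends (nbhdI t0 (t0 + eta) s) D1 (D1 s) /\ tends (nbhdI t0 (t0 + eta) s) D2 (D2 s)).
    { split; apply tends_minus; try apply _; (apply Hsub; [unfold T; lra|lra|]);
        [apply CV1|apply CW1|apply CV2|apply CW2]; unfold T; lra. }
    destruct TD as [TD1 TD2].
    assert (Epush : forall t, RtoC (M t) = (RtoC (fst (D1 t)) * RtoC (fst (D1 t)) + RtoC (snd (D1 t)) * RtoC (snd (D1 t))
      + (RtoC (fst (D2 t)) * RtoC (fst (D2 t)) + RtoC (snd (D2 t)) * RtoC (snd (D2 t))))%C).
    { intros t. rewrite <- !RtoC_mult, <- !RtoC_plus. f_equal. unfold M. ring. }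
    eapply tends_ext; [apply _| |].
    { apply filter_forall. intros t. symmetry. apply Epush. }
    rewrite Epush.
    pose proof (tends_RtoC_fst _ _ _ TD1). pose proof (tends_RtoC_snd _ _ _ TD1).
    pose proof (tends_RtoC_fst _ _ _ TD2). pose proof (tends_RtoC_snd _ _ _ TD2).
    apply tends_plus; try apply _; apply tends_plus; try apply _; apply tends_mult; auto; apply _.
  - intros s Hs.
    pose proof (proj1 (has_tderiv_is_derive _ _ _) (DD1 s Hs)) as [X1 Y1].
    pose proof (proj1 (has_tderiv_is_derive _ _ _) (DD2 s Hs)) as [X2 Y2].
    set (x1 := fun r => fst (D1 r)) in *. set (y1 := fun r => snd (D1 r)) in *.
    set (x2 := fun r => fst (D2 r)) in *. set (y2 := fun r => snd (D2 r)) in *.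
    assert (DX1 : Derive (fun x : R => x1 x) s = fst (d1 s)) by (apply is_derive_unique; auto).
    assert (DY1 : Derive (fun x : R => y1 x) s = snd (d1 s)) by (apply is_derive_unique; auto).
    assert (DX2 : Derive (fun x : R => x2 x) s = fst (d2 s)) by (apply is_derive_unique; auto).
    assert (DY2 : Derive (fun x : R => y2 x) s = snd (d2 s)) by (apply is_derive_unique; auto).
    change (is_derive (fun r => x1 r ^ 2 + y1 r ^ 2 + (x2 r ^ 2 + y2 r ^ 2)) s (dM s)).
    auto_derive. { repeat split; eexists; eauto. }
    rewrite DX1, DX2, DY1, DY2. unfold dM.
    change (fst (D1 s)) with (x1 s). change (snd (D1 s)) with (y1 s).
    change (fst (D2 s)) with (x2 s). change (snd (D2 s)) with (y2 s). eq_in_R. ring.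
  - intros s Hs. destruct (Hb s ltac:(lra)) as [Hs1 Hs2].
    destruct (Hall s Hs1 Hs2) as [[b1' b2'] _].
    change (Cmod (d1 s) <= k1 * N s) in b1'. change (Cmod (d2 s) <= k2 * N s) in b2'.
    assert (CS : forall z w : C, fst z * fst w + snd z * snd w <= Cmod z * Cmod w).
    { intros z w. rewrite <- (Cmod_conj w), <- Cmod_mult. eapply Rle_trans; [|apply re_le_Cmod].
      eapply Rle_trans; [|apply Rle_abs]. right. unfold Re. simpl. ring. }
    pose proof (CS (D1 s) (d1 s)) as c1. pose proof (CS (D2 s) (d2 s)) as c2.
    rewrite EM. unfold dM. change (N s) with (Cmod (D1 s) + Cmod (D2 s)) in b1', b2'.
    pose proof (Cmod_ge_0 (D1 s)) as p1. pose proof (Cmod_ge_0 (D2 s)) as p2.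
    set (A1 := Cmod (D1 s)) in *. set (A2 := Cmod (D2 s)) in *. clearbody A1 A2.
    assert (e1 : A1 * Cmod (d1 s) <= A1 * (k1 * (A1 + A2))) by (apply Rmult_le_compat_l; auto).
    assert (e2 : A2 * Cmod (d2 s) <= A2 * (k2 * (A1 + A2))) by (apply Rmult_le_compat_l; auto).
    assert (f1 : A1 * (A1 + A2) <= 2 * (A1 ^ 2 + A2 ^ 2)) by nra.
    assert (f2 : A2 * (A1 + A2) <= 2 * (A1 ^ 2 + A2 ^ 2)) by nra.
    apply Rmult_le_compat_l with (r := k1) in f1; auto.
    apply Rmult_le_compat_l with (r := k2) in f2; auto.
    lra.
  - intros s Hs. rewrite EM. apply Rplus_le_le_0_compat; apply pow2_ge_0.
  - rewrite EM. unfold D1, D2. rewrite E1, E2. fold o1 o2.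
    replace (o1 - o1)%C with (RtoC 0) by ring. replace (o2 - o2)%C with (RtoC 0) by ring.
    rewrite Cmod_0. ring. }
assert (N0 : forall t, t0 <= t <= t0 + eta -> N t = 0).
{ intros t Ht. specialize (M0 t Ht). rewrite EM in M0. change (N t) with (Cmod (D1 t) + Cmod (D2 t)).
  assert (Z : Rsqr (Cmod (D1 t)) + Rsqr (Cmod (D2 t)) = 0) by (unfold Rsqr; lra).
  destruct (Rplus_sqr_eq_0 _ _ Z) as [-> ->]. ring. }
exists eta. split; auto. intros t Ht.
assert (Hlamt : lam t = t).
{ destruct (proj1 Ht) as [Hlt'|<-]; auto.
  (* Where [N] vanishes the O(N) bound on [L - 1] forces [L = 1], so [lam] has slope 1 starting from
     [lam t0 = t0]. *)
  destruct (mean_value_within lam L t0 t 1 (fun k => k = 1) Hlt') as (k & -> & E).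
  - intros s Hs. apply cont_nonneg_tends; auto.
  - intros x Hx. apply Hlam'. lra.
  - intros x Hx. destruct (Hb x ltac:(lra)) as [Hx1 Hx2].
    destruct (Hall x Hx1 Hx2) as [_ [_ b4]]. rewrite (N0 x) in b4 by lra.
    rewrite <- RtoC_minus, Cmod_R, Rmult_0_r in b4.
    pose proof (Rabs_pos (L x - 1)). assert (Ez : Rabs (L x - 1) = 0) by lra.
    apply Rabs_eq_0 in Ez. lra.
  - reflexivity.
  - lra. }
split; auto.
destruct (Hb t Ht) as [Hx1 Hx2]. destruct (Hall t Hx1 Hx2) as [_ [b3 _]].
rewrite (N0 t Ht) in b3. rewrite <- RtoC_minus, Cmod_R, Rmult_0_r in b3.
pose proof (Rabs_pos (U' t - U t)). assert (Ez : Rabs (U' t - U t) = 0) by lra.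
apply Rabs_eq_0 in Ez. apply Rminus_diag_uniq. exact Ez.
Qed.

(** * Continuation from local agreement to all times *)

Lemma is_sol_driving_ext (v v' : R -> R) (f : C -> C) (z : C) (t : R) (y : R -> C) :
  (forall s, 0 < s < t -> v s = v' s) -> is_sol D f h v z t y -> is_sol D f h v' z t y.
Proof.
intros Hv (H0 & HD & Hc & Hd). split; [exact H0|]. split; [exact HD|]. split; [exact Hc|].
intros s Hs. destruct (Hd s Hs) as (w & (d & Hw) & Hy). exists w. split; auto.
exists d. rewrite <- Hv; auto.
Qed.

(** Uniqueness is contained in [loewner_chain], where [g t z] is the end value of every solution. A
    solution driven by [u] up to time [t] is also one driven by [ut], so both chains take its end
    value. *)
Lemma chains_agree (t : R) : 0 <= t -> (forall s, 0 <= s <= t -> lam s = s /\ ut (lam s) = u s) ->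
  forall z, exist_dom D b h u t z -> gt t z = g t z.
Proof.
intros Ht Hs z (Dz & y & Hy).
transitivity (y t).
- apply (proj1 (proj2 (proj2 Hgt))); auto. apply (is_sol_driving_ext u ut); auto.
  intros s Hss. destruct (Hs s ltac:(lra)) as [E1 E2]. rewrite E1 in E2. auto.
- symmetry. apply (proj1 (proj2 (proj2 Hg))); auto.
Qed.

Lemma small_eq (x y : R) : (forall eps, 0 < eps -> Rabs (x - y) <= eps) -> x = y.
Proof.
intros H. apply Rminus_diag_uniq, Rabs_eq_0. apply Rle_antisym; [|apply Rabs_pos].
apply le_epsilon. intros eps Heps. rewrite Rplus_0_l. auto.
Qed.

Lemma agreement_closed (m : R) : 0 <= m -> (forall s, 0 <= s < m -> lam s = s /\ ut (lam s) = u s) ->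
  lam m = m /\ ut (lam m) = u m.
Proof.
intros Hm Hs. destruct Hm as [Hm|<-].
2:{ rewrite Hlam0. split; auto. rewrite (proj1 (proj2 Hgt)), (proj1 (proj2 Hg)). reflexivity. }
assert (Happ : forall d, 0 < d -> exists r, 0 <= r < m /\ Rabs (r - m) < d).
{ intros d Hd. set (e := Rmin d m).
  assert (0 < e) by (apply Rmin_glb_lt; auto). assert (e <= d) by apply Rmin_l. assert (e <= m) by apply Rmin_r.
  exists (m - e / 2). split; [lra|]. rewrite Rabs_left; lra. }
assert (El : lam m = m).
{ apply small_eq. intros eps Heps.
  destruct (Hlam_cont m ltac:(lra) (eps / 2) ltac:(lra)) as (d & Hd & K).
  destruct (Happ (Rmin d (eps / 2))) as (r & Hr & Hrm); [apply Rmin_glb_lt; lra|].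
  pose proof (Rmin_l d (eps / 2)). pose proof (Rmin_r d (eps / 2)).
  specialize (K r ltac:(lra) ltac:(lra)). rewrite (proj1 (Hs r Hr)) in K.
  replace (lam m - m) with ((r - m) - (r - lam m)) by ring.
  eapply Rle_trans; [apply Rabs_triang|]. rewrite Rabs_Ropp. lra. }
rewrite El. split; auto. apply small_eq. intros eps Heps.
destruct (proj1 Hgt m ltac:(lra) (eps / 2) ltac:(lra)) as (d & Hd & K).
destruct (proj1 Hg m ltac:(lra) (eps / 2) ltac:(lra)) as (d' & Hd' & K').
destruct (Happ (Rmin d d')) as (r & Hr & Hrm); [apply Rmin_glb_lt; lra|].
pose proof (Rmin_l d d'). pose proof (Rmin_r d d').
specialize (K r ltac:(lra) ltac:(lra)). specialize (K' r ltac:(lra) ltac:(lra)).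
destruct (Hs r Hr) as [e1 e2]. rewrite e1 in e2. rewrite e2 in K.
replace (ut m - u m) with ((u r - u m) - (u r - ut m)) by ring.
eapply Rle_trans; [apply Rabs_triang|]. rewrite Rabs_Ropp. lra.
Qed.

(** Connectedness: [m] is the supremum of the times up to which agreement holds throughout.
    Agreement reaches [m] by continuity, [chains_agree] then makes the maps coincide at [m], and
    [local_rigidity] would carry agreement beyond [m] if [m < t]. *)
Lemma agreement (t : R) : 0 <= t -> lam t = t /\ ut (lam t) = u t.
Proof.
intros Ht.
set (E := fun s => 0 <= s <= t /\ forall r, 0 <= r <= s -> lam r = r /\ ut (lam r) = u r).
destruct (completeness E) as [m [Hub Hlub]].
{ exists t. intros s [Hs _]. lra. }
{ exists 0. split; [lra|]. intros r Hr. replace r with 0 by lra.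
  apply agreement_closed; [lra|]. intros; lra. }
assert (Hm0 : 0 <= m).
{ apply Hub. split; [lra|]. intros r Hr. replace r with 0 by lra.
  apply agreement_closed; [lra|]. intros; lra. }
assert (Hmt : m <= t) by (apply Hlub; intros s [Hs _]; lra).
assert (Hlt : forall s, 0 <= s < m -> lam s = s /\ ut (lam s) = u s).
{ intros s Hs. apply NNPP. intro Hn.
  assert (Hc : m <= s); [|lra]. apply Hlub. intros r [Hr1 Hr2].
  apply Rnot_lt_le. intro. apply Hn, Hr2. lra. }
pose proof (agreement_closed m Hm0 Hlt) as Hm.
assert (Hle : forall s, 0 <= s <= m -> lam s = s /\ ut (lam s) = u s).
{ intros s Hs. destruct (Req_dec s m) as [->|n]; auto. apply Hlt; lra. }
destruct (Req_dec m t) as [<-|n]; auto. exfalso.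
destruct (local_rigidity m Hm0 (proj1 Hm)) as (eta & Heta & Hext).
{ destruct Hm as [e1 e2]. rewrite e1 in e2. exact e2. }
{ apply chains_agree; auto. }
set (s := Rmin (m + eta) t).
assert (s <= m + eta) by apply Rmin_l. assert (s <= t) by apply Rmin_r.
assert (Hs : m < s) by (apply Rmin_glb_lt; lra).
assert (s <= m); [|lra]. apply Hub. split; [lra|].
intros r Hr. destruct (Rle_dec r m); [apply Hle; lra|apply Hext; lra].
Qed.

End Rigidity.

Theorem mainTheorem8
  (D : Cplx -> Prop) (phi psi dphi : Cplx -> Cplx)
  (Hphi : conformal_param D phi psi dphi)
  (bm1 b0 b1 s0 s1 : R) (h : R -> Cplx -> Cplx)
  (Hh : is_flow D (sigma_field psi dphi s0 s1) h)
  (u ut : R -> R) (g gt : R -> Cplx -> Cplx)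
  (Hg : loewner_chain D (b_field psi dphi bm1 b0 b1) h u g)
  (Hgt : loewner_chain D (b_field psi dphi bm1 b0 b1) h ut gt)
  (lam : R -> R)
  (Hlam_cont : cont_nonneg lam) (Hlam_mono : monotone_nonneg lam)
  (Hlam0 : lam 0 = 0) (Hlam_nonneg : forall t, 0 <= t -> 0 <= lam t)
  (Hdom : forall t, 0 <= t -> forall z,
      exist_dom D (b_field psi dphi bm1 b0 b1) h ut (lam t) z <->
      exist_dom D (b_field psi dphi bm1 b0 b1) h u t z) :
  forall t, 0 <= t ->
    lam t = t /\ ut (lam t) = u t /\
    (forall z, exist_dom D (b_field psi dphi bm1 b0 b1) h u t z -> g t z = gt (lam t) z).
Proof.
destruct (exp_coeffs_exist (s0 ^ 2 / 4 - s1)) as (Cf & Sf & HCS).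
assert (A : forall t, 0 <= t -> lam t = t /\ ut (lam t) = u t).
{ intros t Ht. eapply (agreement D phi psi dphi Hphi bm1 b0 b1 s0 s1 Cf Sf HCS h Hh u ut g gt); eauto. }
intros t Ht. destruct (A t Ht) as [E1 E2]. split; [exact E1|]. split; [exact E2|].
intros z Hz. rewrite E1. symmetry.
apply (chains_agree D psi dphi bm1 b0 b1 h u ut g gt Hg Hgt lam t Ht); auto.
intros s Hs. apply A; lra.
Qed.
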